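(* Let $G$ be a para-$\mathfrak{Nil}$-Hamiltonian group. If $G$ has a finite insoluble subgroup, then $G$ is finite and $G\cong A_5$ or $G\cong \mathrm{SL}(2,5)$.
   Context: A group is minimal non-nilpotent if it is not nilpotent but all its proper subgroups are nilpotent. A group $G$ is para-$\mathfrak{Nil}$-Hamiltonian if $G$ is non-nilpotent and every non-normal subgroup of $G$ is either nilpotent or minimal non-nilpotent. *)

(* Defs.v *)
From mathcomp Require Import all_boot all_order all_algebra all_fingroup all_solvable.
From Stdlib Require Import List.

Set Implicit Arguments.
Unset Strict Implicit.
Unset Printing Implicit Defensive.

Record Grp := MkGrp {
  carrier :> Type;
  gmul : carrier -> carrier -> carrier;
  gone : carrier;
  ginv : carrier -> carrier;
  gmulA : forall x y z, gmul x (gmul y z) = gmul (gmul x y) z;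
  gmul1 : forall x, gmul gone x = x;
  gmulV : forall x, gmul (ginv x) x = gone
}.

Section GroupNotions.
Variable G : Grp.

Definition gsubset (A B : G -> Prop) : Prop := forall x, A x -> B x.

Definition is_subgroup (H : G -> Prop) : Prop :=
  H (gone G) /\ (forall x y, H x -> H y -> H (gmul x y)) /\
  (forall x, H x -> H (ginv x)).

Definition gen (S : G -> Prop) : G -> Prop :=
  fun x => forall K, is_subgroup K -> gsubset S K -> K x.

Definition gcomm (x y : G) : G := gmul (gmul (ginv x) (ginv y)) (gmul x y).

Definition commSub (A B : G -> Prop) : G -> Prop :=
  gen (fun z => exists x y, A x /\ B y /\ z = gcomm x y).

Fixpoint lcs (H : G -> Prop) (n : nat) : G -> Prop :=
  match n with
  | O => H
  | S m => commSub (lcs H m) H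
  end.

Fixpoint dser (H : G -> Prop) (n : nat) : G -> Prop :=
  match n with
  | O => H
  | S m => commSub (dser H m) (dser H m)
  end.

Definition is_trivial (A : G -> Prop) : Prop := forall x, A x -> x = gone G.

Definition nilpotent_sub (H : G -> Prop) : Prop := exists n, is_trivial (lcs H n).
Definition soluble_sub (H : G -> Prop) : Prop := exists n, is_trivial (dser H n).

Definition proper_subgroup (K H : G -> Prop) : Prop :=
  is_subgroup K /\ gsubset K H /\ exists x, H x /\ ~ K x.

Definition min_non_nilpotent_sub (H : G -> Prop) : Prop :=
  is_subgroup H /\ ~ nilpotent_sub H /\
  forall K, proper_subgroup K H -> nilpotent_sub K.

Definition normal_sub (H : G -> Prop) : Prop :=
  forall g x, H x -> H (gmul (gmul (ginv g) x) g).

Definition finite_sub (H : G -> Prop) : Prop :=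
  exists s : list (carrier G), forall x, H x -> In x s.

Definition setT_G : G -> Prop := fun _ => True.

Definition group_nilpotent : Prop := nilpotent_sub setT_G.
Definition group_finite : Prop := finite_sub setT_G.

Definition para_Nil_Hamiltonian : Prop :=
  ~ group_nilpotent /\
  forall H, is_subgroup H -> ~ normal_sub H ->
    nilpotent_sub H \/ min_non_nilpotent_sub H.

Definition isomorphic_to (gT : finGroupType) (K : {set gT}) : Prop :=
  exists f : carrier G -> gT,
    (forall x y, f (gmul x y) = (f x * f y)%g) /\
    (forall x y, f x = f y -> x = y) /\
    (forall x, f x \in K) /\
    (forall y, y \in K -> exists x, f x = y).

End GroupNotions.

Definition A5 : {set {perm 'I_5}} := ('Alt_('I_5))%g.

Definition SL25 : {set {'GL_2['F_5]}} :=
  [set M : {'GL_2['F_5]} | (\det (GLval M) == 1)%R].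

(* Main.v *)
(** Let H be a minimal insoluble finite subgroup of G. A subgroup containing H is
    neither nilpotent nor, by Schmidt's theorem, minimal non-nilpotent, so H is
    normal in G.

    Let S be the simple quotient of H. Every proper subgroup of S is nilpotent or
    minimal non-nilpotent. Maximal Sylow intersections, transfer and counting
    show that each Sylow subgroup P of S is TI and elementary abelian, that
    C_S(x) = P for all x in P^#, and that N_S(P) is a Frobenius group with
    complement of prime order. If #|S| is odd, the exceptional characters
    attached to the primes dividing #|S| satisfy incompatible bounds for the
    prime with smallest Sylow subgroup. If #|S| is even, counting the pairs of
    involutions with a given product yields #|S| = 60 and a subgroup of index 5,
    whence S = A5. The kernel R of H -> S is then a cyclic 2-group, because the
    preimages of the normalisers of a Sylow 3- and a Sylow 5-subgroup are minimal
    non-nilpotent; so R is central, and transfer gives #|R| <= 2. If #|R| = 2, the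
    derived subgroup of the fibre product of H and SL(2,5) over A5 has order 120
    and is the graph of an isomorphism.

    Finally let P be a Sylow 2-subgroup of H. If G were larger than H, the Frattini
    argument would make N_G(P) larger than N_H(P), which is not nilpotent; so
    N_G(P) would be normal in G and N_H(P) normal in H, which is false. *)

Require Import Defs.
From HB Require Import structures.
From mathcomp Require Import all_boot all_order all_algebra all_fingroup all_solvable.
From mathcomp Require Import all_field all_character.
From mathcomp Require Import boolp.
From mathcomp Require Import zify ring.

Set Implicit Arguments.
Unset Strict Implicit.
Unset Printing Implicit Defensive.

(** * Transfer and fusion *)

Section TransferFusion.

Import GroupScope FiniteModule.

Lemma pnat_neq_coprime (p q m n : nat) :
  p != q -> p.-nat m -> q.-nat n -> coprime m n.
Proof.
move=> neq pm qn; apply: pnat_coprime pm (sub_in_pnat _ qn) => r _.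
by rewrite !inE => /eqP->; rewrite eq_sym.
Qed.

Lemma Sylow_neq1 (gT : finGroupType) p (P G : {group gT}) :
  prime p -> p %| #|G| -> p.-Sylow(G) P -> P :!=: 1.
Proof.
move=> p_pr pG sylP.
by rewrite -cardG_gt1 (card_Hall sylP) p_part_gt1 mem_primes p_pr cardG_gt0.
Qed.

Lemma simple_perfect (gT : finGroupType) (G : {group gT}) :
  simple G -> ~~ solvable G -> G^`(1) = G.
Proof.
move=> /simpleP[_ simG] nsol; case: (simG _ (der_normal 1 G)) => // G'1.
by case/negP: nsol; rewrite abelian_sol //; apply/derG1P.
Qed.

Lemma simple_norm_proper (gT : finGroupType) (D G : {group gT}) :
  simple G -> D \proper G -> D :!=: 1 -> 'N_G(D) \proper G.
Proof.
move=> /simpleP[_ simG] ltD ntD; rewrite properEneq subsetIl andbT.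
apply: contraNneq ntD => /setIidPl nDG.
have [-> // | defD] : D :=: 1 \/ D :=: G by apply: simG; rewrite /normal proper_sub.
by rewrite defD properxx in ltD.
Qed.

Section Transfer.
Variable gT : finGroupType.
Implicit Types (G K P : {group gT}).

Lemma transfer_der1 (aT : finGroupType) G P (f : {morphism P >-> aT})
    (abP : abelian (f @* P)) g :
  P \subset G -> g \in G^`(1) -> transfer G abP g = 0%R.
Proof.
move=> sPG G'g.
suff /subsetP/(_ g G'g)/mker : G^`(1) \subset 'ker (transfer_morphism G abP) by [].
rewrite gen_subG; apply/subsetP=> _ /imset2P[x y Gx Gy ->].
rewrite !inE groupR //= [transfer G abP _](morphR (transfer_morphism G abP)) //.
by apply/commgP; apply: GRing.addrC.
Qed.

(* The transfer G -> P / K is trivial on G', while the fusion hypothesis makes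
   it send g to the class of g ^+ #|G : P|, where #|G : P| is prime to p. *)
Lemma Sylow_der1_transfer p P K G g :
    p.-Sylow(G) P -> K <| P -> abelian (P / K) -> g \in P -> g \in G^`(1) ->
    (forall k x, x \in G -> (g ^+ k) ^ x \in P -> [~ g ^+ k, x] \in K) ->
  g \in K.
Proof.
move=> sylP /andP[sKP nKP] abPK Pg G'g fusK.
have [sPG pP coPi] := and3P sylP; have Gg := subsetP sPG g Pg.
pose alpha := [morphism of restrm nKP (coset K)].
have abA : abelian (alpha @* P) by rewrite morphim_restrm setIid.
have trX := transversalP (rcosets_cycle_partition sPG Gg).
set X := transversal _ _ in trX.
have /and3P[_ sXG _] := trX.
have: (fmod abA (alpha g) *+ #|G : P| = 0)%R.
  rewrite -(transfer_der1 abA sPG G'g) (transfer_cycle_expansion sPG abA Gg trX).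
  rewrite -(sum_index_rcosets_cycle sPG Gg trX) -GRing.sumrMnr.
  apply: eq_bigr => x Xx; set n := #|_ : _|.
  have Pgx : (g ^+ n) ^ x^-1 \in P.
    by rewrite conjgE invgK mulgA -mem_rcoset mulg_exp_card_rcosets.
  have Kgx : [~ g ^+ n, x^-1] \in K by apply: fusK Pgx; rewrite groupV (subsetP sXG).
  rewrite -[(_ *+ _)%R]morphX ?mem_morphim //= -morphX //= /restrm.
  congr fmod; rewrite conjg_mulR -[LHS]mulg1 -(coset_id Kgx) -morphM //.
    by rewrite (subsetP nKP) ?groupX.
  by rewrite (subsetP nKP) ?(subsetP sKP).
move/(congr1 val); rewrite fmval0 fmvalZ fmodK ?mem_morphim //= /restrm.
move/(congr1 (fun y => y ^+ expg_invn (P / K) #|G : P|)).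
have coPK : coprime #|P / K| #|G : P| by rewrite (pnat_coprime (quotient_pgroup _ pP)).
rewrite expg1n expgK ?mem_quotient // => Kg1.
by rewrite coset_idr ?(subsetP nKP).
Qed.

Definition norm_controls_fusion G P :=
  forall x g, x \in P -> g \in G -> x ^ g \in P ->
    exists2 h, h \in 'N_G(P) & x ^ g = x ^ h.

Lemma abelian_Sylow_controls_fusion p P G :
  p.-Sylow(G) P -> abelian P -> norm_controls_fusion G P.
Proof.
move=> sylP abP x g Px Gg Pxg; have [sPG pP _] := and3P sylP.
set C := 'C_G[x ^ g].
have sPC : P \subset C by rewrite subsetI sPG sub_cent1 (subsetP abP).
have sPgC : P :^ g \subset C.
  by rewrite subsetI conj_subG //= cent1J conjSg sub_cent1 (subsetP abP).
have sylPC : p.-Sylow(C) P by apply: pHall_subl sylP; rewrite ?subsetIl.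
have sylPgC : p.-Sylow(C) (P :^ g).
  by apply: (pHall_subl sPgC (subsetIl _ _)); rewrite pHallJ.
have [c /setIP[Gc cc] defP] := Sylow_trans sylPgC sylPC.
exists (g * c); last first.
  by rewrite conjgM; apply/esym/conjg_fixP/commgP; apply/commute_sym/cent1P.
by rewrite inE groupM //=; apply/normP; rewrite conjsgM -defP.
Qed.

Lemma normedTI_controls_fusion P G :
  normedTI P^# G 'N_G(P) -> norm_controls_fusion G P.
Proof.
case/normedTI_memJ_P=> _ _ tiP x g Px Gg Pxg; have [-> | ntx] := eqVneq x 1.
  by exists 1; rewrite ?group1 // !conj1g.
by exists g => //; rewrite -(tiP x) // !inE ?conjg_eq1 ntx.
Qed.

Lemma nilpotent_norm_Sylow_commutator p P G x g :
    p.-Sylow(G) P -> nilpotent 'N_G(P) -> norm_controls_fusion G P ->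
    x \in P -> g \in G -> x ^ g \in P ->
  [~ x, g] \in P^`(1).
Proof.
move=> sylP nilN fusP Px Gg Pxg; have [sPG pP _] := and3P sylP.
have sylPN : p.-Sylow('N_G(P)) P.
  by apply: pHall_subl sylP; rewrite ?subsetIl // subsetI sPG normG.
have := nilpotent_pcoreC p nilN; rewrite -(nilpotent_Hall_pcore nilN sylPN).
case/dprodP=> _ defN cPC _.
have [h] := fusP _ _ Px Gg Pxg; rewrite -defN => /mulsgP[y z Py Cz ->] xgE.
rewrite commgEl xgE conjgM (_ : (x ^ y) ^ z = x ^ y) -?commgEl ?mem_commg //.
by apply/conjg_fixP/commgP/commute_sym/(centsP cPC); rewrite ?groupJ.
Qed.

Lemma perfect_norm_Sylow_not_nil p P G :
    p.-Sylow(G) P -> P :!=: 1 -> G^`(1) = G -> norm_controls_fusion G P ->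
  ~~ nilpotent 'N_G(P).
Proof.
move=> sylP ntP defG' fusP; apply/negP=> nilN; have [sPG pP _] := and3P sylP.
have := sol_der1_proper (pgroup_sol pP) (subxx P) ntP.
rewrite properE => /andP[_ /negP[]]; apply/subsetP=> g Pg.
apply: (Sylow_der1_transfer sylP (der_normal 1 P) (sub_der1_abelian _) Pg) => //.
  by rewrite defG' (subsetP sPG).
move=> k x Gx; apply: nilpotent_norm_Sylow_commutator sylP nilN fusP _ Gx.
exact: groupX.
Qed.

Definition max_conj_inter G P g :=
  [/\ g \in G, P :^ g != P, P :&: P :^ g != 1
    & {in G, forall h, P :^ h != P -> #|P :&: P :^ h| <= #|P :&: P :^ g|}].

Lemma normedTI_or_max_conj_inter P G : P \subset G -> P :!=: 1 ->
  normedTI P^# G 'N_G(P) \/ exists g, max_conj_inter G P g.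
Proof.
move=> sPG ntP; pose bad g := [&& g \in G, P :^ g != P & P :&: P :^ g != 1].
have [g0 bad0 | nobad] := pickP bad; last first.
  left; apply/normedTI_P; rewrite setD_eq0 subG1 normD1 subsetI subsetIl subsetIr.
  split=> // g Gg; rewrite -setI_eq0 conjD1g -setDIl setD_eq0 subG1 => nt.
  rewrite inE Gg; apply/normP/eqP.
  by have := nobad g; rewrite /bad Gg nt andbT => /negbFE.
right; case: (arg_maxnP (fun g => #|P :&: P :^ g|) bad0) => g /and3P[Gg neq nt] maxg.
exists g; split=> // h Gh neqh; have [-> | nth] := eqVneq (P :&: P :^ h) 1.
  by rewrite cards1 cardG_gt0.
by apply: maxg; apply/and3P.
Qed.

Section MaxConjInter.
Variables (p : nat) (P G : {group gT}) (g : gT).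
Hypotheses (sylP : p.-Sylow(G) P) (maxg : max_conj_inter G P g).
Let D := P :&: P :^ g.
Let pP : p.-group P := pHall_pgroup sylP.

Lemma max_conj_inter_proper : D \proper P /\ D \proper P :^ g.
Proof.
have [_ neqP _ _] := maxg; rewrite !properEneq subsetIl subsetIr !andbT.
split; apply: contraNneq neqP => defD.
  by rewrite eq_sym eqEcard cardJg leqnn andbT -{1}defD subsetIr.
by rewrite eqEcard cardJg leqnn andbT -{1}defD subsetIl.
Qed.

Lemma proper_max_conj_inter (V : {group gT}) :
  p.-group V -> D \proper V -> D \proper 'N_V(D).
Proof. by move=> pV; apply: nilpotent_proper_norm (pgroup_nil pV). Qed.

Lemma max_conj_inter_pgroup_sub (V : {group gT}) :
  p.-group V -> V \subset G -> 'N_P(D) \subset V -> V \subset P.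
Proof.
move=> pV sVG sNV; have [Gg _ _ maxD] := maxg.
have [h Gh] := Sylow_Jsub sylP sVG pV; rewrite sub_conjg => sVP.
have [<- // | neqP] := eqVneq (P :^ h^-1) P.
have ltDN := proper_max_conj_inter pP max_conj_inter_proper.1.
have /proper_card : D \proper P :&: P :^ h^-1.
  apply: proper_sub_trans ltDN _.
  by rewrite subsetI subsetIl (subset_trans sNV).
by rewrite ltnNge maxD ?groupV.
Qed.

Lemma max_conj_inter_Sylow : p.-Sylow('N_G(D)) 'N_P(D).
Proof.
have sPG := pHall_sub sylP; have pN : p.-group 'N_P(D) := pgroupS (subsetIl _ _) pP.
have [V sylV sNV] := Sylow_superset (setSI 'N(D) sPG) pN.
have [sVN pV _] := and3P sylV; suff -> : 'N_P(D) = V by [].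
have [sVG nDV] := subsetIP sVN.
by apply/eqP; rewrite eqEsubset sNV subsetI max_conj_inter_pgroup_sub.
Qed.

Lemma max_conj_inter_nnormal : ~~ ('N_P(D) <| 'N_G(D)).
Proof.
apply/negP=> /andP[sNN nNN]; have [Gg _ _ _] := maxg.
have sPgG : P :^ g \subset G by rewrite (pHall_sub (_ : p.-Sylow(G) _)) ?pHallJ.
have pPg : p.-group (P :^ g) by rewrite pgroupJ.
have sNgP : 'N_(P :^ g)(D) \subset P.
  apply: subset_trans (joing_subr 'N_P(D) _) _; apply: max_conj_inter_pgroup_sub.
  - rewrite /= norm_joinEr ?pgroupM ?(pgroupS (subsetIl _ _)) //.
    by apply: subset_trans nNN; rewrite setSI.
  - by rewrite join_subG !subIset ?sPgG ?(pHall_sub sylP).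
  exact: joing_subl.
have /andP[_ /negP[]] := @proper_max_conj_inter (P :^ g)%G pPg max_conj_inter_proper.2.
by rewrite subsetI sNgP; apply: subsetIl.
Qed.

End MaxConjInter.
End Transfer.

End TransferFusion.

(** * Groups all of whose proper subgroups are nilpotent *)

Section ProperNil.

Import GroupScope.

Definition proper_nil (gT : finGroupType) (M : {set gT}) :=
  forall L : {group gT}, L \proper M -> nilpotent L.

Lemma proper_nil_quo (gT : finGroupType) (M N : {group gT}) :
  proper_nil M -> N <| M -> proper_nil (M / N).
Proof.
move=> nilM nNM L ltLM.
have [L1 defL sNL1 sL1M] := inv_quotientS nNM (proper_sub ltLM).
rewrite defL quotient_nil // nilM // properEneq sL1M andbT.
by apply: contraTneq ltLM => eqL1; rewrite defL eqL1 properxx.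
Qed.

Lemma nil_Sylow_normal (gT : finGroupType) p (P N : {group gT}) :
  nilpotent N -> p.-Sylow(N) P -> P <| N.
Proof. by move=> nilN sylP; rewrite (nilpotent_Hall_pcore nilN sylP) pcore_normal. Qed.

Lemma simple_proper_nil_sol (gT : finGroupType) (M : {group gT}) :
  simple M -> proper_nil M -> solvable M.
Proof.
move=> simM nilM; apply/idPn=> nsolM; have defM' := simple_perfect simM nsolM.
have M_gt1 : 1 < #|M| by rewrite cardG_gt1; case/simpleP: simM.
have p_pr := pdiv_prime M_gt1; set p := pdiv #|M| in p_pr.
have [P sylP] := Sylow_exists p M; have [sPM pP _] := and3P sylP.
have ntP : P :!=: 1 := Sylow_neq1 p_pr (pdiv_dvd _) sylP.
have ltPM : P \proper M.
  rewrite properEneq sPM andbT; apply: contraNneq nsolM => <-.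
  exact: pgroup_sol pP.
have [tiP | [g maxg]] := normedTI_or_max_conj_inter sPM ntP.
  have /negP[] := perfect_norm_Sylow_not_nil sylP ntP defM' (normedTI_controls_fusion tiP).
  by rewrite nilM ?simple_norm_proper.
have /negP[] := max_conj_inter_nnormal sylP maxg; have [_ _ ntD _] := maxg.
apply: nil_Sylow_normal (max_conj_inter_Sylow sylP maxg); apply: nilM.
by apply: simple_norm_proper => //; apply: sub_proper_trans ltPM; apply: subsetIl.
Qed.

(* Schmidt's theorem. *)
Theorem proper_nil_sol (gT : finGroupType) (M : {group gT}) :
  proper_nil M -> solvable M.
Proof.
have [n] := ubnP #|M|; elim: n => // n IHn in gT M * => leMn nilM.
have [-> | ntM] := eqVneq M 1%G; first exact: solvable1.
have [N maxN] := ex_maxnormal_ntrivg ntM.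
have [nNM ltNM] := (maxnormal_normal maxN, maxnormal_proper maxN).
rewrite (series_sol nNM) nilpotent_sol ?nilM //=.
have nilMN := proper_nil_quo nilM nNM.
by apply: simple_proper_nil_sol => //; rewrite quotient_simple.
Qed.

Lemma prime_index_pcore_Sylow (gT : finGroupType) (K M : {group gT}) r :
    K \subset M -> nilpotent K -> prime #|M : K| -> r != #|M : K| ->
  r.-Sylow(M) 'O_r(K).
Proof.
move=> sKM nilK q_pr neqr; have sylO := nilpotent_pcore_Hall r nilK.
rewrite pHallE (subset_trans (pcore_sub _ _) sKM) (card_Hall sylO) -(Lagrange sKM).
rewrite partnM ?cardG_gt0 ?indexg_gt0 //= [X in (_ * X)%N]part_p'nat ?muln1 //.
by rewrite pnatE // !inE eq_sym.
Qed.

Lemma sub_Sylow_full (gT : finGroupType) (N M : {group gT}) :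
    N \subset M ->
    {in primes #|M|, forall p, exists2 P : {group gT}, p.-Sylow(M) P & P \subset N} ->
  N :=: M.
Proof.
move=> sNM sylN; apply/eqP; rewrite eqEcard sNM dvdn_leq ?cardG_gt0 //.
apply/dvdn_partP=> // p; rewrite inE => /sylN[P sylP sPN].
by rewrite -(card_Hall sylP) cardSg.
Qed.

Lemma proper_nil_coprime_cent (gT : finGroupType) (A B M : {group gT}) :
    proper_nil M -> A \subset M -> B \subset M -> B \subset 'N(A) ->
    coprime #|A| #|B| -> A * B != M ->
  B \subset 'C(A).
Proof.
move=> nilM sAM sBM nAB coAB neqM; have /nilM nilAB : A <*> B \proper M.
  by rewrite properEneq join_subG sAM sBM norm_joinEr ?neqM.
exact: sub_nilpotent_cent2 nilAB (joing_subl _ _) (joing_subr _ _) coAB.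
Qed.

Record Schmidt (gT : finGroupType) (p q : nat) (M P Q : {group gT}) : Prop := {
  Schmidt_ker_prime : prime p;
  Schmidt_compl_prime : prime q;
  Schmidt_neq : p != q;
  Schmidt_ker_Sylow : p.-Sylow(M) P;
  Schmidt_compl_Sylow : q.-Sylow(M) Q;
  Schmidt_sdprod : P ><| Q = M;
  Schmidt_compl_cyclic : cyclic Q;
  Schmidt_compl_ncent : ~~ (Q \subset 'C(P));
  Schmidt_proper_compl_cent :
    forall Q0 : {group gT}, Q0 \proper Q -> Q0 \subset 'C(P);
  Schmidt_proper_ker_cent :
    forall P0 : {group gT}, P0 \proper P -> Q \subset 'N(P0) -> P0 \subset 'C(Q)
}.

Section ProperNilStructure.
Variables (gT : finGroupType) (M : {group gT}).
Hypotheses (nilM : proper_nil M) (nnilM : ~~ nilpotent M).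

Lemma proper_nil_normal_Sylow :
  exists p q (P Q : {group gT}),
    [/\ prime p, prime q, p != q, p.-Sylow(M) P & q.-Sylow(M) Q]
    /\ P <| M /\ ~~ (Q \subset 'C(P)).
Proof.
have ntM : M :!=: 1 by apply: contraNneq nnilM => ->; apply: nilpotent1.
have [K nKM q_pr] := sol_prime_factor_exists (proper_nil_sol nilM) ntM.
have [sKM _] := andP nKM; set q := #|M : K| in q_pr.
have nilK : nilpotent K by apply: nilM; rewrite properE sKM -indexg_gt1 prime_gt1.
have sylO p : p != q -> p.-Sylow(M) 'O_p(K) by apply: prime_index_pcore_Sylow.
have norO p : 'O_p(K) <| M by apply: gFnormal_trans.
have [Q sylQ] := Sylow_exists q M; have [sQM qQ _] := and3P sylQ.
have [cO | ] := boolP (all [pred p | (p != q) ==> (Q \subset 'C('O_p(K)))] (primes #|M|)).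
  have defN : 'N_M(Q) = M.
    apply: sub_Sylow_full; rewrite ?subsetIl // => p /(allP cO)/=.
    have [-> _ | neqp /= cQO] := eqVneq p q; first by exists Q; rewrite // subsetI sQM normG.
    exists 'O_p(K)%G; first exact: sylO.
    by rewrite subsetI (pHall_sub (sylO p neqp)) cents_norm // centsC.
  have nQM : Q <| M by rewrite /normal sQM -{1}defN subsetIr.
  case/negP: nnilM; suff <- : 'F(M) = M by apply: Fitting_nil.
  apply: sub_Sylow_full => [|p _]; first exact: Fitting_sub.
  have [-> | neqp] := eqVneq p q.
    by exists Q; rewrite // Fitting_max // (pgroup_nil qQ).
  exists 'O_p(K)%G; first exact: sylO.
  exact: Fitting_max (norO p) (pgroup_nil (pcore_pgroup p K)).
case/allPn=> p; rewrite mem_primes negb_imply => /and3P[p_pr _ _] /andP[neqp ncQ].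
exists p, q, 'O_p(K)%G, Q; split; first by split=> //; apply: sylO.
by split; first apply: norO.
Qed.

Theorem Schmidt_exists : exists p q (P Q : {group gT}), Schmidt p q M P Q.
Proof.
have [p [q [P [Q [[p_pr q_pr neqpq sylP sylQ] [nPM ncQ]]]]]] := proper_nil_normal_Sylow.
have [[sPM pP _] [sQM qQ _]] := (and3P sylP, and3P sylQ).
have nPQ : Q \subset 'N(P) := subset_trans sQM (normal_norm nPM).
have copq : coprime #|P| #|Q| := pnat_neq_coprime neqpq pP qQ.
have tiPQ : P :&: Q = 1 := coprime_TIg copq.
have cent (A B : {group gT}) : A \subset P -> B \subset Q -> B \subset 'N(A) ->
    A * B != M -> B \subset 'C(A).
  move=> sA sB nAB; apply: proper_nil_coprime_cent; rewrite ?(subset_trans sA) //.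
    exact: subset_trans sQM.
  by rewrite (coprimeSg sA) ?(coprimegS sB).
have defM : P * Q = M by apply/eqP; apply: contraNT ncQ; apply: cent.
have cQ0 (Q0 : {group gT}) : Q0 \proper Q -> Q0 \subset 'C(P).
  case/andP=> sQ0 nsQ0; apply: cent => //; first exact: subset_trans nPQ.
  apply: contraNneq nsQ0 => defM0; rewrite -(mul1g Q0) -tiPQ setIC group_modr //.
  by rewrite defM0 subsetI sQM subxx.
exists p, q, P, Q; split=> // [||P0 /andP[sP0 nsP0] nP0]; last first.
- rewrite centsC; apply: cent => //; apply: contraNneq nsP0 => defM0.
  by rewrite -(mulg1 P0) -tiPQ setIC group_modl // defM0 subsetI subxx sPM.
- apply: contraR ncQ => ncyc; apply/subsetP=> x Qx; rewrite -cycle_subG cQ0 //.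
  rewrite properEneq cycle_subG Qx andbT.
  by apply: contraNneq ncyc => <-; apply: cycle_cyclic.
by rewrite sdprodE.
Qed.

End ProperNilStructure.

End ProperNil.

Section SchmidtGroups.

Import GroupScope.

Lemma pq_elt1 (gT : finGroupType) (p q : nat) (x : gT) : p != q -> p.-elt x -> q.-elt x -> x = 1.
Proof.
move=> neqpq px qx; apply/eqP; rewrite -order_eq1 -dvdn1.
have /eqP <- : coprime #[x] #[x] by apply: pnat_neq_coprime px qx.
by rewrite gcdnn.
Qed.

Variables (gT : finGroupType) (p q : nat) (M P Q : {group gT}).
Hypothesis schM : Schmidt p q M P Q.
Implicit Types (U : {group gT}) (r : nat).

Let sylP : p.-Sylow(M) P := Schmidt_ker_Sylow schM.
Let sylQ : q.-Sylow(M) Q := Schmidt_compl_Sylow schM.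
Let pP : p.-group P := pHall_pgroup sylP.

Lemma Schmidt_coprime : coprime #|P| #|Q|.
Proof. exact: pnat_neq_coprime (Schmidt_neq schM) pP (pHall_pgroup sylQ). Qed.

Lemma Schmidt_card : #|M| = (#|P| * #|Q|)%N.
Proof. by rewrite (sdprod_card (Schmidt_sdprod schM)). Qed.

Lemma Schmidt_ker_normal : P <| M.
Proof. by have [] := sdprod_context (Schmidt_sdprod schM). Qed.

Lemma Schmidt_compl_norm : Q \subset 'N(P).
Proof. by have [_ _ _] := sdprod_context (Schmidt_sdprod schM). Qed.

Lemma Schmidt_compl_neq1 : Q :!=: 1.
Proof. by apply: contraNneq (Schmidt_compl_ncent schM) => ->; apply: sub1G. Qed.

Lemma Schmidt_ker_neq1 : P :!=: 1.
Proof.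
by apply: contraNneq (Schmidt_compl_ncent schM) => ->; rewrite centsC; apply: sub1G.
Qed.

Lemma Schmidt_compl_nnormal : ~~ (Q <| M).
Proof.
apply: contra (Schmidt_compl_ncent schM) => /andP[_ nQM].
rewrite centsC; apply/commG1P/trivgP; rewrite -(coprime_TIg Schmidt_coprime).
rewrite subsetI commg_subl commg_subr Schmidt_compl_norm.
exact: subset_trans (normal_sub Schmidt_ker_normal) nQM.
Qed.

Lemma Schmidt_nnil : ~~ nilpotent M.
Proof.
by apply: contra Schmidt_compl_nnormal => nilM; apply: nil_Sylow_normal sylQ.
Qed.

Lemma Schmidt_pi r : prime r -> r %| #|M| -> (r == p) || (r == q).
Proof.
move=> r_pr; rewrite Schmidt_card Euclid_dvdM // => /orP[dvP | dvQ].
  by have := pgroupP pP r r_pr dvP; rewrite inE => ->.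
by have := pgroupP (pHall_pgroup sylQ) r r_pr dvQ; rewrite inE orbC => ->.
Qed.

Lemma Schmidt_constt_eq1 x : x \in M -> (x.`_p == 1) = q.-elt x.
Proof.
move=> Mx; apply/eqP/idP=> [/constt1P p'x | qx]; last first.
  by apply: pq_elt1 (Schmidt_neq schM) (p_elt_constt _ _) (mem_p_elt qx (mem_cycle _ _)).
apply: sub_in_pnat p'x => r; rewrite mem_primes => /and3P[r_pr _ rx].
have := Schmidt_pi r_pr (dvdn_trans rx (order_dvdG Mx)).
by rewrite !inE => /orP[-> |].
Qed.

Lemma Schmidt_Sylow_pi r U :
  prime r -> r.-Sylow(M) U -> U :!=: 1 -> (r == p) || (r == q).
Proof.
move=> r_pr sylU ntU; apply: Schmidt_pi => //.
have [_ /dvdn_trans-> //] := pgroup_pdiv (pHall_pgroup sylU) ntU.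
by rewrite cardSg ?(pHall_sub sylU).
Qed.

Lemma Schmidt_normal_Sylow r U :
  prime r -> r.-Sylow(M) U -> U :!=: 1 -> U <| M -> r = p /\ U :=: P.
Proof.
move=> r_pr sylU ntU /andP[_ nUM].
have eqU (V : {group gT}) : r.-Sylow(M) V -> V :=: U.
  by case/(Sylow_trans sylU)=> x Mx ->; rewrite (normP (subsetP nUM x Mx)).
case/orP: (Schmidt_Sylow_pi r_pr sylU ntU) => /eqP eqr; rewrite eqr in eqU *.
  by rewrite (eqU P).
by case/negP: Schmidt_compl_nnormal; rewrite /normal (pHall_sub sylQ) (eqU Q).
Qed.

Lemma Schmidt_nnormal_Sylow r U :
  prime r -> r.-Sylow(M) U -> ~~ (U <| M) -> r = q /\ cyclic U.
Proof.
move=> r_pr sylU nnU.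
have ntU : U :!=: 1 by apply: contraNneq nnU => ->; rewrite normal1.
case/orP: (Schmidt_Sylow_pi r_pr sylU ntU) => /eqP eqr; rewrite eqr in sylU *.
  case/negP: nnU; have [x Mx ->] := Sylow_trans sylP sylU.
  by rewrite (normsP (normal_norm Schmidt_ker_normal)) // Schmidt_ker_normal.
have [x Mx ->] := Sylow_trans sylQ sylU.
by rewrite cyclicJ (Schmidt_compl_cyclic schM).
Qed.

Lemma Schmidt_abelian_cent : abelian P -> 'C_P(Q) = 1.
Proof.
move=> abP; have := coprime_abel_cent_TI Schmidt_compl_norm Schmidt_coprime abP.
have sPQ : [~: P, Q] \subset P by rewrite commg_subl Schmidt_compl_norm.
have [-> // | neqPQ] := eqVneq [~: P, Q] P.
have cPQ : [~: P, Q] \subset 'C(Q).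
  by apply: (Schmidt_proper_ker_cent schM); rewrite ?commg_normr // properEneq neqPQ.
move/setIidPl: cPQ => -> /commG1P cPQ.
by case/negP: (Schmidt_compl_ncent schM); rewrite centsC.
Qed.

Section FixedPointFree.
Hypothesis fpfPQ : 'C_P(Q) = 1.

Lemma Schmidt_proper_ker_eq1 (P0 : {group gT}) :
  P0 \proper P -> Q \subset 'N(P0) -> P0 :=: 1.
Proof.
move=> ltP0 nP0; apply/trivgP.
by rewrite -fpfPQ subsetI proper_sub // (Schmidt_proper_ker_cent schM).
Qed.

Lemma Schmidt_ker_minnormal : minnormal P M.
Proof.
apply/mingroupP; split=> [|P0 /andP[ntP0 nP0] sP0].
  by rewrite Schmidt_ker_neq1 normal_norm // Schmidt_ker_normal.
apply/eqP; rewrite eqEproper sP0; apply: contra ntP0 => /Schmidt_proper_ker_eq1-> //.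
exact: subset_trans (pHall_sub sylQ) nP0.
Qed.

Lemma Schmidt_Frobenius : #|Q| = q -> [Frobenius M = P ><| Q].
Proof.
move=> oQ; apply/prime_FrobeniusP; rewrite ?oQ ?Schmidt_ker_neq1 //.
  exact: Schmidt_compl_prime schM.
by split; first apply: Schmidt_sdprod schM.
Qed.

End FixedPointFree.

Lemma Schmidt_ker_large : 'C_P(Q) != 1 -> p ^ 2 <= #|P|.
Proof.
apply: contraR; rewrite -ltnNge => ltP.
have p_pr := Schmidt_ker_prime schM; apply/eqP/Schmidt_abelian_cent/(p2group_abelian pP).
have [k oP] := p_natP pP; rewrite oP pfactorK // ltnW //.
by rewrite -(ltn_exp2l _ _ (prime_gt1 p_pr)) -oP.
Qed.

End SchmidtGroups.

(** * Simple groups whose second maximal subgroups are nilpotent *)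

Section SimpleProperNil.

Import GroupScope.

Section CountingConjugates.
Variable gT : finGroupType.
Implicit Types (G M P Q : {group gT}) (A B : {set gT}).

Lemma class_support_Sylow p P G :
  p.-Sylow(G) P -> class_support P G = [set x in G | p.-elt x].
Proof.
move=> sylP; have [sPG pP _] := and3P sylP; apply/setP=> x; rewrite inE.
apply/idP/andP=> [/imset2P[y g Py Gg ->] | [Gx px]].
  by rewrite p_eltJ (mem_p_elt pP) // groupJ // (subsetP sPG).
have [|g Gg] := Sylow_Jsub sylP _ px; first by rewrite cycle_subG.
rewrite sub_conjg cycle_subG class_supportEr => Px.
by apply/bigcupP; exists g^-1; rewrite ?groupV.
Qed.

Lemma card_class_support_leq P G :
  #|class_support P G| <= 1 + #|P|.-1 * #|G : 'N_G(P)|.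
Proof.
have -> : class_support P G = 1 |: cover (P^# :^: G).
  rewrite cover_imset class_supportEr; apply/setP=> x; rewrite in_setU1.
  apply/bigcupP/orP=> [[g Gg Px] | [/eqP-> | /bigcupP[g Gg]]].
  - have [-> | ntx] := eqVneq x 1; [by left | right].
    by apply/bigcupP; exists g; rewrite // conjD1g !inE ntx.
  - by exists 1; rewrite ?group1.
  by rewrite conjD1g => /setD1P[_ Px]; exists g.
apply: leq_trans (leq_card_setU _ _).1 _; rewrite cards1 leq_add2l.
apply: leq_trans (leq_card_cover _).1 _.
rewrite (eq_bigr (fun=> #|P|.-1)) => [|_ /imsetP[g _ ->]].
  by rewrite sum_nat_const mulnC card_conjugates normD1.
by rewrite cardJg [in RHS](cardsD1 1 P) group1.
Qed.

Lemma normedTI_constt p P G :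
    p.-Sylow(G) P -> normedTI P^# G 'N_G(P) ->
  normedTI [set x in 'N_G(P) | x.`_p != 1] G 'N_G(P).
Proof.
move=> sylP tiP; have [ntP _ tiPG] := normedTI_memJ_P tiP.
have [sPG pP _] := and3P sylP.
have sylPN : p.-Sylow('N_G(P)) P.
  by apply: pHall_subl sylP; rewrite ?subsetIl // subsetI sPG normG.
have consttP x : x \in 'N_G(P) -> x.`_p != 1 -> x.`_p \in P^#.
  move=> Nx ntx; rewrite in_setD1 ntx (mem_normal_Hall sylPN) ?normalSG ?p_elt_constt //.
  exact: groupX.
have memA x : (x \in [set x in 'N_G(P) | x.`_p != 1]) = (x \in 'N_G(P)) && (x.`_p != 1).
  by rewrite in_set.
apply/normedTI_memJ_P; split=> [||x g]; last 1 first.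
- rewrite !memA consttJ conjg_eq1 => /andP[Nx ntx] Gg.
  rewrite ntx andbT; apply/idP/idP=> [Nxg | Ng]; last by rewrite groupJ.
  by rewrite -(tiPG _ _ (consttP x Nx ntx)) // -consttJ consttP // consttJ conjg_eq1.
- have [x /setD1P[ntx Px]] := set0Pn _ ntP; apply/set0Pn; exists x.
  by rewrite memA constt_p_elt ?(mem_p_elt pP) // ntx (subsetP (pHall_sub sylPN)).
exact: subsetIl.
Qed.

Lemma card_disjoint_class_support (p q : nat) G A B :
    p != q -> A \subset G -> {in A, forall x, x.`_p != 1} ->
    B \subset G^# -> {in B, forall x, q.-elt x} ->
  #|class_support A G| + #|class_support B G| < #|G|.
Proof.
move=> neqpq /subsetP sAG Ap /subsetP sBG Bq.
have Ap' x : x \in class_support A G -> x.`_p != 1 /\ x \in G.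
  by case/imset2P=> a g Aa Gg ->; rewrite consttJ conjg_eq1 Ap // groupJ // sAG.
have Bq' x : x \in class_support B G -> [/\ x != 1, x \in G & q.-elt x].
  case/imset2P=> b g Bb Gg ->; have /setD1P[ntb Gb] := sBG b Bb.
  by rewrite conjg_eq1 ntb groupJ // p_eltJ Bq.
have tiAB : class_support A G :&: class_support B G = set0.
  apply/setP=> x; rewrite !inE; apply/negP=> /andP[/Ap'[/eqP ntx _] /Bq'[_ _ qx]].
  by case: ntx; apply: pq_elt1 neqpq (p_elt_constt _ _) _; apply: mem_p_elt qx (mem_cycle _ _).
rewrite -cardsUI tiAB cards0 addn0 (cardsD1 1 G) group1 ltnS.
apply/subset_leq_card/subsetP=> x; rewrite in_setD1.
case/setUP=> [/Ap'[ntx ->] | /Bq'[-> ->] //]; rewrite andbT.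
by apply: contraNneq ntx => ->; rewrite constt1.
Qed.

End CountingConjugates.

(* Dividing by g: the first family of conjugates fills at least
   1 - (1 + (q - 1) e) / (n q) of the group, the second one (t - 1) / (t p). *)
Lemma two_class_supports_arith (p q n t a u e i j g : nat) :
    1 < p -> 1 < q -> (p ^ 2 <= n -> q ^ 2 <= t -> e * p <= n ->
    u <= 1 + q.-1 * e -> a + u = n * q -> n * q * i = g -> t * p * j = g ->
  g <= a * i + t.-1 * j)%N.
Proof.
rewrite -!mulnn => p1 q1 pn qt ep uq oA oGi oGj; rewrite leqNgt; apply/negP=> ltg.
have lt_tu : (t.-1 * j + 1 <= u * i)%N by nia.
have le_up : (u * i * p <= i * p + q.-1 * (i * n))%N.
  rewrite -mulnA; apply: leq_trans (leq_mul uq (leqnn (i * p)%N)) _.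
  by rewrite mulnDl mul1n leq_add2l -mulnA leq_mul2l mulnCA leq_mul2l ep !orbT.
have le_tp : (t * p * j + p <= t.-1 * j * p + p + j * p)%N by nia.
have le_n : (i * n + p <= i * p + j * p)%N.
  have split_n : (n * q * i = i * n + q.-1 * (i * n))%N by nia.
  have := leq_mul lt_tu (leqnn p); rewrite mulnDl mul1n; lia.
have le_ip : (2 * (i * p) <= i * n)%N by nia.
have le_jp : (2 * (j * p) <= i * n)%N.
  have : (q * (q * (j * p)) <= q * (i * n))%N by nia.
  by rewrite leq_pmul2l ?(ltnW q1) //; apply: leq_trans; rewrite leq_mul2r q1 orbT.
lia.
Qed.

Lemma cyclic_norm_eq (gT : finGroupType) (p : nat) (D P : {group gT}) :
  p.-group P -> D \subset P -> cyclic 'N_P(D) -> 'N_P(D) = P.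
Proof.
move=> pP sDP cycN; apply/eqP/idPn=> neqN.
have ltN : 'N_P(D) \proper P by rewrite properEneq neqN subsetIl.
have := nilpotent_proper_norm (pgroup_nil pP) ltN.
rewrite properE => /andP[_ /negP[]]; rewrite subsetI subsetIl /=.
apply: subset_trans (subsetIr _ _) (char_norms _).
by rewrite sub_cyclic_char // subsetI sDP normG.
Qed.

Record FrobSylow (gT : finGroupType) (G : {group gT}) (p : nat) (P : {group gT}) : Prop := {
  FrobSylow_prime : prime p;
  FrobSylow_Sylow : p.-Sylow(G) P;
  FrobSylow_Frobenius : [Frobenius 'N_G(P) with kernel P];
  FrobSylow_index_prime : prime #|'N_G(P) : P|;
  FrobSylow_minnormal : minnormal P 'N_G(P);
  FrobSylow_TI : normedTI P^# G 'N_G(P)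
}.

Section SimpleStructure.
Variables (gT : finGroupType) (G : {group gT}).
Hypotheses (simG : simple G) (nsolG : ~~ solvable G).
Hypothesis nil2 : forall K : {group gT}, K \proper G -> proper_nil K.
Implicit Types (p q : nat) (P Q T : {group gT}).

Lemma simple_norm_pgroup_proper p P :
  p.-group P -> P \subset G -> P :!=: 1 -> 'N_G(P) \proper G.
Proof.
move=> pP sPG; apply: simple_norm_proper => //; rewrite properEneq sPG andbT.
by apply: contraNneq nsolG => <-; apply: pgroup_sol pP.
Qed.

Lemma controlled_Sylow_Schmidt p P :
    prime p -> p.-Sylow(G) P -> P :!=: 1 -> norm_controls_fusion G P ->
  exists q Q, Schmidt p q 'N_G(P) P Q.
Proof.
move=> p_pr sylP ntP fusP; have [sPG pP _] := and3P sylP.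
have ltN := simple_norm_pgroup_proper pP sPG ntP.
have nnilN := perfect_norm_Sylow_not_nil sylP ntP (simple_perfect simG nsolG) fusP.
have [r [q [P1 [Q schN]]]] := Schmidt_exists (nil2 ltN) nnilN.
have sylPN : p.-Sylow('N_G(P)) P.
  by apply: pHall_subl sylP; rewrite ?subsetIl // subsetI sPG normG.
have [| eqp eqP] := Schmidt_normal_Sylow schN p_pr sylPN ntP; first by rewrite normalSG.
by exists q, Q; rewrite eqp {2}(val_inj eqP : P = P1).
Qed.

Lemma simple_Sylow_normedTI p P :
  prime p -> p.-Sylow(G) P -> P :!=: 1 -> normedTI P^# G 'N_G(P).
Proof.
move=> p_pr sylP ntP; have [sPG pP _] := and3P sylP.
have [// | [g maxg]] := normedTI_or_max_conj_inter sPG ntP.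
have [ltDP _] := max_conj_inter_proper maxg.
have nnN := max_conj_inter_nnormal sylP maxg.
have sylN := max_conj_inter_Sylow sylP maxg.
have [_ _ ntD _] := maxg; set D := P :&: P :^ g in ltDP nnN sylN ntD.
have sDP : D \subset P := subsetIl _ _.
have ltN : 'N_G(D) \proper G.
  apply: simple_norm_pgroup_proper (pgroupS sDP pP) _ ntD; exact: subset_trans sPG.
have nnilN : ~~ nilpotent 'N_G(D).
  by apply: contra nnN => nilN; apply: nil_Sylow_normal sylN.
have [p1 [q1 [P1 [Q1 schD]]]] := Schmidt_exists (nil2 ltN) nnilN.
have [_ cycND] := Schmidt_nnormal_Sylow schD p_pr sylN nnN.
have cycP : cyclic P by rewrite -(cyclic_norm_eq pP sDP cycND).
have abP := cyclic_abelian cycP.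
have fusP := abelian_Sylow_controls_fusion sylP abP.
have [q [Q schP]] := controlled_Sylow_Schmidt p_pr sylP ntP fusP.
case/eqP: ntD; apply: (Schmidt_proper_ker_eq1 schP (Schmidt_abelian_cent schP abP) ltDP).
apply: subset_trans (Schmidt_compl_norm schP) (char_norms _).
by rewrite sub_cyclic_char.
Qed.

Lemma simple_Sylow_Schmidt p P :
  prime p -> p.-Sylow(G) P -> P :!=: 1 -> exists q Q, Schmidt p q 'N_G(P) P Q.
Proof.
move=> p_pr sylP ntP; apply: controlled_Sylow_Schmidt => //.
exact: normedTI_controls_fusion (simple_Sylow_normedTI p_pr sylP ntP).
Qed.

Lemma simple_cent1_Sylow_sub p P x :
  prime p -> p.-Sylow(G) P -> x \in P^# -> 'C_G[x] \subset 'N_G(P).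
Proof.
move=> p_pr sylP Px; have [ntx Px1] := setD1P Px.
apply: cent1_normedTI (simple_Sylow_normedTI p_pr sylP _) _ Px.
by apply/trivgPn; exists x.
Qed.

Section SchmidtNormaliser.
Variables (p q : nat) (P Q : {group gT}).
Hypotheses (sylP : p.-Sylow(G) P) (schP : Schmidt p q 'N_G(P) P Q).
Let p_pr : prime p := Schmidt_ker_prime schP.
Let q_pr : prime q := Schmidt_compl_prime schP.
Let sQN : Q \subset 'N_G(P) := pHall_sub (Schmidt_compl_Sylow schP).
Let qQ : q.-group Q := pHall_pgroup (Schmidt_compl_Sylow schP).

(* Otherwise an element z of order q of Q centralises P, and C_G(z) lies in the
   normaliser of a Sylow q-subgroup T, which is then equal to N_G(P). *)
Lemma simple_Schmidt_compl_card : #|Q| = q.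
Proof.
have [_ dvqQ _] := pgroup_pdiv qQ (Schmidt_compl_neq1 schP).
have [z Qz oz] := Cauchy q_pr dvqQ.
have ntz : z != 1 by rewrite -order_gt1 oz prime_gt1.
apply/eqP/idPn=> neqQ.
have cPz : <[z]> \subset 'C(P).
  apply: (Schmidt_proper_compl_cent schP); rewrite properEcard cycle_subG Qz /= -orderE oz.
  by rewrite ltn_neqAle eq_sym neqQ dvdn_leq.
have sNC : 'N_G(P) \subset 'C_G[z].
  rewrite subsetI subsetIl -(sdprodW (Schmidt_sdprod schP)) mul_subG ?sub_cent1 //.
    by rewrite -cycle_subG.
  exact: subsetP (cyclic_abelian (Schmidt_compl_cyclic schP)) z Qz.
have [T sylT sQT] := Sylow_superset (subset_trans sQN (subsetIl _ _)) qQ.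
have [sTG qT _] := and3P sylT; have Tz : z \in T^# by rewrite !inE ntz (subsetP sQT).
have ntT : T :!=: 1 by apply/trivgPn; exists z; rewrite ?(subsetP sQT).
have sNN := subset_trans sNC (simple_cent1_Sylow_sub q_pr sylT Tz).
have defN : 'N_G(P) = 'N_G(T).
  apply/eqP/idPn=> neqN; case/negP: (Schmidt_nnil schP).
  apply: (nil2 (simple_norm_pgroup_proper qT sTG ntT)).
  by rewrite properEneq neqN.
case/negP: (Schmidt_compl_nnormal schP); rewrite /= defN.
have <- : T :=: Q; last by rewrite normalSG.
apply: (sub_pHall (Schmidt_compl_Sylow schP) qT sQT).
by rewrite /= defN subsetI sTG normG.
Qed.

End SchmidtNormaliser.

Section FixedPoints.
Variables (p q : nat) (P Q T : {group gT}) (z : gT).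
Hypotheses (sylP : p.-Sylow(G) P) (schP : Schmidt p q 'N_G(P) P Q).
Hypotheses (Pz : z \in P) (ntz : z != 1) (cQz : z \in 'C(Q)).
Hypotheses (sylT : q.-Sylow(G) T) (sQT : Q \subset T).
Let p_pr : prime p := Schmidt_ker_prime schP.
Let q_pr : prime q := Schmidt_compl_prime schP.
Let neqpq : p != q := Schmidt_neq schP.
Let pP : p.-group P := pHall_pgroup sylP.
Let qT : q.-group T := pHall_pgroup sylT.
Let ntP : P :!=: 1 := Schmidt_ker_neq1 schP.
Let ntQ : Q :!=: 1 := Schmidt_compl_neq1 schP.
Let oQ : #|Q| = q := simple_Schmidt_compl_card schP.

Let ntT : T :!=: 1.
Proof. by apply: contraNneq ntQ => T1; rewrite -subG1 -T1. Qed.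

Let pz : p.-elt z := mem_p_elt pP Pz.

Lemma fixed_point_norm : z \in 'N_G(T).
Proof.
have [y Qy nty] := trivgPn _ ntQ.
have Ty : y \in T^# by rewrite !inE nty (subsetP sQT).
apply: (subsetP (simple_cent1_Sylow_sub q_pr sylT Ty)).
by rewrite inE (subsetP (pHall_sub sylP)) //; apply/cent1P/(centP cQz).
Qed.

Lemma fixed_point_Schmidt : exists R, Schmidt q p 'N_G(T) T R.
Proof.
have [r [R schT]] := simple_Sylow_Schmidt q_pr sylT ntT; exists R.
have [|_ pdz _] := pgroup_pdiv (pz : p.-group <[z]>); first by rewrite cycle_eq1.
have := Schmidt_pi schT p_pr (dvdn_trans pdz (order_dvdG fixed_point_norm)).
by rewrite (negPf neqpq) => /eqP->.
Qed.

Lemma fixed_point_large : p ^ 2 <= #|P| /\ q ^ 2 <= #|T|.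
Proof.
split; first by apply: (Schmidt_ker_large schP); apply/trivgPn; exists z; rewrite // inE Pz.
have [R schT] := fixed_point_Schmidt; apply: (Schmidt_ker_large schT).
apply/eqP=> fpfR; have oR := simple_Schmidt_compl_card schT.
have /FrobeniusWker/Frobenius_kerP[_ _ _ cT] := Schmidt_Frobenius schT fpfR oR.
have [y Qy nty] := trivgPn _ ntQ.
have Ty : y \in T^# by rewrite !inE nty (subsetP sQT).
case/eqP: ntz; apply: pq_elt1 neqpq pz (mem_p_elt qT _).
apply: (subsetP (cT y Ty)); rewrite inE fixed_point_norm.
by apply/cent1P/(centP cQz).
Qed.

Lemma fixed_point_norm_index : #|'N_G(P) : 'N_('N_G(P))(Q)| * p <= #|P|.
Proof.
have nPN : P <| 'N_G(P) := Schmidt_ker_normal schP.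
have sQN := pHall_sub (Schmidt_compl_Sylow schP).
have sCN : 'C_P(Q) * Q \subset 'N_('N_G(P))(Q).
  rewrite mul_subG // subsetI; last by rewrite sQN normG.
  by rewrite (subset_trans (subsetIl _ _) (normal_sub nPN)) subIset // cent_sub orbT.
have tiCQ : 'C_P(Q) :&: Q = 1.
  by apply/trivgP; rewrite -(coprime_TIg (Schmidt_coprime schP)) setSI ?subsetIl.
have ntC : 'C_P(Q) != 1 by apply/trivgPn; exists z; rewrite // inE Pz.
have pC : p %| #|'C_P(Q)|.
  by have [] := pgroup_pdiv (pgroupS (subsetIl _ _) pP : p.-group 'C_P(Q)) ntC.
have le_pq : p * q <= #|'N_('N_G(P))(Q)|.
  apply: leq_trans (subset_leq_card sCN).
  by rewrite TI_cardMg // oQ leq_pmul2r ?prime_gt0 // dvdn_leq.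
rewrite -(leq_pmul2r (prime_gt0 q_pr)) -{2}oQ -(Schmidt_card schP).
by rewrite -(Lagrange (subsetIl 'N_G(P) 'N(Q))) -mulnA mulnC leq_pmul2r ?indexg_gt0.
Qed.

Lemma no_fixed_point : False.
Proof.
have [R schT] := fixed_point_Schmidt; have oR := simple_Schmidt_compl_card schT.
have tiP := simple_Sylow_normedTI p_pr sylP ntP.
have tiT := simple_Sylow_normedTI q_pr sylT ntT.
set A := [set x in 'N_G(P) | x.`_p != 1].
have tiA : normedTI A G 'N_G(P) := normedTI_constt sylP tiP.
have sANP : A \subset 'N_G(P) by apply/subsetP=> x; rewrite in_set => /andP[].
have : #|class_support A G| + #|class_support T^# G| < #|G|.
  apply: card_disjoint_class_support neqpq _ _ _ _.
  - exact: subset_trans sANP (subsetIl _ _).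
  - by move=> x; rewrite in_set => /andP[].
  - by rewrite setSD ?(pHall_sub sylT).
  by move=> x /setD1P[_]; apply: mem_p_elt.
have oT : #|T^#| = #|T|.-1 by rewrite (cardsD1 1 T) group1.
rewrite (card_support_normedTI tiA) (card_support_normedTI tiT) oT ltnNge => /negP[].
have [pP2 qT2] := fixed_point_large.
have le_qelts := card_class_support_leq Q 'N_G(P).
rewrite (class_support_Sylow (Schmidt_compl_Sylow schP)) oQ in le_qelts.
have cardA : (#|A| + #|[set x in 'N_G(P) | q.-elt x]| = #|P| * q)%N.
  rewrite -{2}oQ -(Schmidt_card schP) -(cardsID A 'N_G(P)) (setIidPr sANP).
  congr (_ + _)%N; apply: eq_card => x; rewrite in_setD [x \in A]in_set [LHS]in_set.
  by case Nx: (x \in 'N_G(P)); rewrite ?andbF //= -(Schmidt_constt_eq1 schP) // negbK andbT.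
apply: (two_class_supports_arith (prime_gt1 p_pr) (prime_gt1 q_pr) pP2 qT2
  fixed_point_norm_index le_qelts cardA).
  by rewrite -{1}oQ -(Schmidt_card schP) Lagrange ?subsetIl.
by rewrite -{1}oR -(Schmidt_card schT) Lagrange ?subsetIl.
Qed.

End FixedPoints.

Theorem simple_FrobSylow p P :
  prime p -> p.-Sylow(G) P -> P :!=: 1 -> FrobSylow G p P.
Proof.
move=> p_pr sylP ntP; have [q [Q schP]] := simple_Sylow_Schmidt p_pr sylP ntP.
have oQ := simple_Schmidt_compl_card schP.
have fpf : 'C_P(Q) = 1.
  apply/eqP/idPn=> /trivgPn[z /setIP[Pz cQz] ntz].
  have [sQN qQ _] := and3P (Schmidt_compl_Sylow schP).
  have [T sylT sQT] := Sylow_superset (subset_trans sQN (subsetIl _ _)) qQ.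
  exact: no_fixed_point sylP schP Pz ntz cQz sylT sQT.
have frobN := Schmidt_Frobenius schP fpf oQ; have [defN _ _ _ _] := Frobenius_context frobN.
split=> //; first exact: FrobeniusWker frobN.
- rewrite -(index_sdprod defN) oQ; exact: Schmidt_compl_prime schP.
- exact: Schmidt_ker_minnormal schP fpf.
exact: simple_Sylow_normedTI p_pr sylP ntP.
Qed.

End SimpleStructure.

Section FrobSylowTheory.
Variables (gT : finGroupType) (G : {group gT}) (p : nat) (P : {group gT}).
Hypothesis frobP : FrobSylow G p P.
Local Notation N := 'N_G(P).

Lemma FrobSylow_sub : P \subset G.
Proof. exact: pHall_sub (FrobSylow_Sylow frobP). Qed.

Lemma FrobSylow_sub_norm : P \subset N.
Proof. by rewrite subsetI FrobSylow_sub normG. Qed.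

Lemma FrobSylow_pgroup : p.-group P.
Proof. exact: pHall_pgroup (FrobSylow_Sylow frobP). Qed.

Lemma FrobSylow_neq1 : P :!=: 1.
Proof. by case/Frobenius_kerP: (FrobSylow_Frobenius frobP). Qed.

Lemma FrobSylow_dvd : p %| #|G|.
Proof.
have [_ pP _] := pgroup_pdiv FrobSylow_pgroup FrobSylow_neq1.
exact: dvdn_trans pP (cardSg FrobSylow_sub).
Qed.

Lemma FrobSylow_abelem : p.-abelem P.
Proof.
have [_ _ /is_abelemP[r r_pr abelP]] :=
  minnormal_solvable (FrobSylow_minnormal frobP) (subxx _) (pgroup_sol FrobSylow_pgroup).
suff <- : r = p by [].
have [_ pP _] := pgroup_pdiv FrobSylow_pgroup FrobSylow_neq1.
by have := pgroupP (abelem_pgroup abelP) p (FrobSylow_prime frobP) pP; rewrite inE => /eqP.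
Qed.

Lemma FrobSylow_abelian : abelian P.
Proof. exact: abelem_abelian FrobSylow_abelem. Qed.

Lemma FrobSylow_order x : x \in P^# -> #[x] = p.
Proof. by case/setD1P=> ntx Px; apply: abelem_order_p FrobSylow_abelem Px ntx. Qed.

Lemma FrobSylow_card_norm : #|N| = (#|P| * #|N : P|)%N.
Proof. by rewrite Lagrange ?FrobSylow_sub_norm. Qed.

Lemma FrobSylow_norm_proper : simple G -> N \proper G.
Proof.
move=> simG; apply: simple_norm_proper FrobSylow_neq1 => //.
rewrite properEcard FrobSylow_sub; apply: leq_trans (subset_leq_card (subsetIl G 'N(P))).
by rewrite FrobSylow_card_norm ltn_Pmulr ?cardG_gt0 ?prime_gt1 ?(FrobSylow_index_prime frobP).
Qed.

Lemma FrobSylow_card : #|G| = (#|G : N| * (#|P| * #|N : P|))%N.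
Proof. by rewrite -FrobSylow_card_norm mulnC Lagrange ?subsetIl. Qed.

Lemma FrobSylow_index_dvd : #|N : P| %| #|P|.-1.
Proof. exact: Frobenius_ker_dvd_ker1 (FrobSylow_Frobenius frobP). Qed.

Lemma FrobSylow_cent1 x : x \in P^# -> 'C_G[x] = P.
Proof.
move=> Px; have [_ Px1] := setD1P Px; apply/eqP; rewrite eqEsubset; apply/andP; split.
  have [_ _ _ cP] := Frobenius_kerP (FrobSylow_Frobenius frobP).
  apply: subset_trans (cP x Px); rewrite subsetI subsetIr andbT.
  exact: cent1_normedTI (FrobSylow_TI frobP) x Px.
by rewrite subsetI FrobSylow_sub sub_cent1 (subsetP FrobSylow_abelian).
Qed.

Lemma FrobSylow_norm_elt x g : x \in P^# -> g \in G -> x ^ g \in P -> g \in N.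
Proof.
move=> Px Gg Pxg; have /normedTI_memJ_P[_ _ ti] := FrobSylow_TI frobP.
by rewrite -(ti x) // in_setD1 conjg_eq1 Pxg andbT; case/setD1P: Px.
Qed.

Lemma FrobSylow_conj_fix x y : x \in P -> y \in N -> x ^ y = x -> x != 1 -> y \in P.
Proof.
move=> Px Ny cxy ntx; rewrite -(FrobSylow_cent1 (x := x)) ?in_setD1 ?ntx // inE.
have [-> _] := setIP Ny; apply/cent1P; apply/commute_sym; apply/commgP.
exact/conjg_fixP.
Qed.

Lemma FrobSylow_norm_nnil : ~~ nilpotent N.
Proof.
have sPN := FrobSylow_sub_norm; apply/negP=> nilN.
have nPN : P <| N by rewrite /normal sPN subsetIr.
have /trivgPn[x /setIP[Px /centerP[_ cNx]] ntx] := meet_center_nil nilN nPN FrobSylow_neq1.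
have := prime_gt1 (FrobSylow_index_prime frobP); rewrite indexg_gt1; case/negP.
apply/subsetP=> y Ny; apply: (FrobSylow_conj_fix Px Ny _ ntx).
exact/conjg_fixP/commgP/cNx.
Qed.

Lemma FrobSylow_prime_neq_index : p != #|N : P|.
Proof.
have [p_gt1 p_dv _] := pgroup_pdiv FrobSylow_pgroup FrobSylow_neq1.
apply: contraTneq FrobSylow_index_dvd => <-; apply: contraL p_dv => p_dv1.
by rewrite -(prednK (cardG_gt0 P)) -addn1 dvdn_addr // dvdn1 neq_ltn (prime_gt1 p_gt1) orbT.
Qed.

Lemma FrobSylow_Sylow_index_nnormal (U : {group gT}) : #|N : P|.-Sylow(N) U -> ~~ (U <| N).
Proof.
set q := #|_ : _| => sylU; apply/negP=> nUN.
have [sUN qU _] := and3P sylU; have sPN := FrobSylow_sub_norm.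
have q_pr : prime q := FrobSylow_index_prime frobP.
have q_dv : q %| #|N| by rewrite FrobSylow_card_norm dvdn_mull.
have /trivgPn[y Uy nty] := Sylow_neq1 q_pr q_dv sylU.
have /trivgPn[x Px ntx] := FrobSylow_neq1.
have copPU : coprime #|P| #|U|.
  exact: pnat_neq_coprime FrobSylow_prime_neq_index FrobSylow_pgroup qU.
have cPU : U \subset 'C(P).
  rewrite (sameP commG1P trivgP) -(coprime_TIg copPU) setIC.
  rewrite subsetI commg_subl commg_subr (subset_trans sPN (normal_norm nUN)).
  by rewrite (subset_trans sUN) ?subsetIr.
have Py := FrobSylow_conj_fix Px (subsetP sUN y Uy) _ ntx.
have : y \in P :&: U by rewrite inE Uy Py //; apply/conjg_fixP/commgP/commute_sym/(centsP cPU).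
by rewrite coprime_TIg // inE (negPf nty).
Qed.

End FrobSylowTheory.

End SimpleProperNil.

Section FrobSylowGroups.

Import GroupScope.

Definition p_support (gT : finGroupType) (G : {set gT}) (p : nat) :=
  [set x in G^# | p.-elt x].

Definition Sylow_repr (gT : finGroupType) (G : {group gT}) p : {group gT} :=
  sval (Sylow_exists p G).

Lemma Sylow_reprP (gT : finGroupType) (G : {group gT}) p : p.-Sylow(G) (Sylow_repr G p).
Proof. exact: svalP (Sylow_exists p G). Qed.

Definition Sylow_norm_index (gT : finGroupType) (G : {group gT}) p :=
  #|'N_G(Sylow_repr G p) : Sylow_repr G p|.

Definition FrobSylow_group (gT : finGroupType) (G : {group gT}) :=
  forall (p : nat) (P : {group gT}),
    prime p -> p.-Sylow(G) P -> P :!=: 1 -> FrobSylow G p P.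

Lemma p_support_class (gT : finGroupType) p (P G : {group gT}) :
  p.-Sylow(G) P -> p_support G p = class_support P^# G.
Proof.
move=> sylP; apply/setP=> x; have := class_support_Sylow sylP.
rewrite inE in_setD1 -andbA => /setP/(_ x); rewrite [RHS]inE => <-.
rewrite !class_supportEr; apply/andP/bigcupP=> [[ntx /bigcupP[g Gg Px]] | [g Gg]].
  by exists g; rewrite // conjD1g in_setD1 ntx.
by rewrite conjD1g => /setD1P[ntx Px]; split; last by apply/bigcupP; exists g.
Qed.

Lemma Sylow_sub_p_support (gT : finGroupType) (p : nat) (P G : {group gT}) :
  p.-Sylow(G) P -> P^# \subset p_support G p.
Proof.
case/and3P=> sPG pP _; apply/subsetP=> x /setD1P[ntx Px].
by rewrite !inE ntx (subsetP sPG) ?(mem_p_elt pP).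
Qed.

Lemma Sylow_norm_indexE (gT : finGroupType) p (P G : {group gT}) :
  p.-Sylow(G) P -> #|'N_G(P) : P| = Sylow_norm_index G p.
Proof.
move=> sylP; have [g Gg ->] := Sylow_trans (Sylow_reprP G p) sylP.
by rewrite -{1}(conjGid Gg) normJ -conjIg indexJg.
Qed.

Lemma mem_p_support_inj (gT : finGroupType) (G : {set gT}) p q x :
  x \in p_support G p -> x \in p_support G q -> p = q.
Proof.
rewrite !inE => /andP[/andP[ntx _] px] /andP[_ qx]; apply/eqP/idPn => neqpq.
by rewrite (pq_elt1 neqpq px qx) eqxx in ntx.
Qed.

Lemma big_p_support (gT : finGroupType) (G : {group gT}) (R : Type) (idx : R)
    (op : Monoid.com_law idx) (F : gT -> R) :
    {in G^#, forall x, exists2 p : nat, p \in primes #|G| & p.-elt x} ->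
  \big[op/idx]_(x in G) F x =
    op (F 1) (\big[op/idx]_(p <- primes #|G|) \big[op/idx]_(x in p_support G p) F x).
Proof.
move=> primary; rewrite (big_setD1 1) //=; congr (op _ _).
rewrite (exchange_big_dep (mem G^#)) /=; last by move=> p x _; rewrite inE => /andP[].
apply: eq_bigr => x Gx; have [p pG px] := primary x Gx.
rewrite (eq_bigl (pred1 p)) => [|r].
  by rewrite -big_filter filter_pred1_uniq ?primes_uniq // big_seq1.
have supp_p : x \in p_support G p by rewrite inE Gx.
by apply/idP/eqP=> [supp_r | ->]; first apply: mem_p_support_inj supp_r supp_p.
Qed.

Section Theory.
Variables (gT : finGroupType) (G : {group gT}).
Hypothesis frobG : FrobSylow_group G.
Implicit Types (p : nat) (P : {group gT}) (x y i : gT).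

Lemma FrobSylow_repr p : p \in primes #|G| -> FrobSylow G p (Sylow_repr G p).
Proof.
rewrite mem_primes => /and3P[p_pr _ pG].
by apply: frobG (Sylow_reprP G p) _; rewrite // (Sylow_neq1 p_pr pG (Sylow_reprP G p)).
Qed.

Lemma FrobSylow_primes p P : FrobSylow G p P -> p \in primes #|G|.
Proof.
by move=> frobP; rewrite mem_primes (FrobSylow_prime frobP) cardG_gt0 (FrobSylow_dvd frobP).
Qed.

Lemma mem_FrobSylow x : x \in G^# -> exists p P, FrobSylow G p P /\ x \in P^#.
Proof.
case/setD1P=> ntx Gx; have ox : 1 < #[x] by rewrite order_gt1.
have p_pr := pdiv_prime ox; set p := pdiv #[x] in p_pr.
have nty : x.`_p != 1.
  by rewrite -order_gt1 order_constt p_part_gt1 mem_primes p_pr order_gt0 pdiv_dvd.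
have sG : <[x.`_p]> \subset G by rewrite cycle_subG groupX.
have [P sylP] := Sylow_superset sG (p_elt_constt p x); rewrite cycle_subG => Py.
have frobP : FrobSylow G p P by apply: frobG => //; apply/trivgPn; exists x.`_p.
exists p, P; split; rewrite // in_setD1 ntx -(FrobSylow_cent1 frobP (x := x.`_p)).
  by rewrite inE Gx; apply/cent1P/commuteX.
by rewrite in_setD1 nty.
Qed.

Lemma FrobSylow_primary : {in G^#, forall x, exists2 p : nat, p \in primes #|G| & p.-elt x}.
Proof.
move=> x /mem_FrobSylow[p [P [frobP /setD1P[_ Px]]]]; exists p.
  exact: FrobSylow_primes frobP.
exact: mem_p_elt (FrobSylow_pgroup frobP) Px.
Qed.

Lemma card_FrobSylow_group :
  #|G| = (1 + \sum_(p <- primes #|G|) #|p_support G p|)%N.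
Proof.
rewrite -[LHS]sum1_card (big_p_support _ _ FrobSylow_primary).
by congr (_ + _)%N; apply: eq_bigr => p _; rewrite sum1_card.
Qed.

Lemma p_support_FrobSylow p x : p \in primes #|G| -> x \in p_support G p ->
  exists2 P, FrobSylow G p P & x \in P^#.
Proof.
move=> pG Gx; have := Gx; rewrite inE => /andP[/mem_FrobSylow[r [P [frobP Px]]] _].
suff <- : r = p by exists P.
apply: mem_p_support_inj _ Gx.
exact: subsetP (Sylow_sub_p_support (FrobSylow_Sylow frobP)) x Px.
Qed.

Lemma card_p_support p P :
  FrobSylow G p P -> #|p_support G p| = (#|P|.-1 * #|G : 'N_G(P)|)%N.
Proof.
move=> frobP; rewrite (p_support_class (FrobSylow_Sylow frobP)).
by rewrite (card_support_normedTI (FrobSylow_TI frobP)) (cardsD1 1 P) group1.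
Qed.

End Theory.

End FrobSylowGroups.

(** * Even order: counting involutions *)

Section InvolutionArithmetic.

Lemma prod_primes_dvd (K : seq nat) m :
  uniq K -> all prime K -> all (fun p => p %| m) K -> \prod_(p <- K) p %| m.
Proof.
elim: K => [|p K IHK] /=; first by rewrite big_nil dvd1n.
case/andP=> npK uK /andP[p_pr prK] /andP[pm Km].
rewrite big_cons Gauss_dvd ?pm ?IHK // big_seq.
apply: (big_ind (coprime p)) => [|x y px py|r Kr]; rewrite ?coprimen1 ?coprimeMr ?px //.
rewrite prime_coprime // dvdn_prime2 ?(allP prK r Kr) //.
by apply: contraNneq npK => ->.
Qed.

Lemma sum_leq_prod_primes (K : seq nat) :
  all prime K -> 1 + \sum_(p <- K) p.-1 <= \prod_(p <- K) p ?= iff (size K <= 1).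
Proof.
elim: K => [|p [|r K] IHK] /=; rewrite ?big_nil ?big_seq1; first by move=> _; apply/leqif_refl.
  by rewrite andbT => /prime_gt0/prednK; rewrite add1n => ->; apply/leqif_refl.
case/andP=> p_pr prK; have [leK _] := IHK prK; have [r_pr _] := andP prK.
rewrite ![\big[_/_]_(_ <- p :: _) _]big_cons; move: leK.
have : 0 < \sum_(l <- r :: K) l.-1 by rewrite big_cons addn_gt0 -subn1 subn_gt0 prime_gt1.
have := prime_gt1 p_pr; move: (\sum_(_ <- _) _) (\prod_(_ <- _) _) => s t.
by move=> p_gt1 s_gt0 le_st; split; [|apply/negbTE]; nia.
Qed.

(* The hypothesis eq_pairs counts the pairs of involutions by their product;
   2 ^ a is the order of a Sylow 2-subgroup, m its number of conjugates and K
   the set of primes whose Sylow normalisers are dihedral. *)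
Section InvolutionEquation.
Variables (a q u m : nat) (K : seq nat).
Hypotheses (a_gt0 : 0 < a) (q_pr : prime q) (def2a : 2 ^ a = u * q + 1) (m_gt1 : 1 < m).
Hypotheses (uK : uniq K) (prK : all prime K) (K2 : 2 \notin K).
Hypothesis dvK : {in K, forall p, p %| m * (2 ^ a * q)}.
Hypothesis eq_pairs : 2 * (m.-1 * (u * q) ^ 2) = 2 ^ a * q * \sum_(p <- K) p.-1.
Let s := \sum_(p <- K) p.-1.
Let s' := \sum_(p <- rem q K) p.-1.
Let q_gt1 : 1 < q := prime_gt1 q_pr.

Lemma involution_multiplicity : exists2 k, 0 < k & m = 1 + 2 ^ a * k /\ s = 2 * (u ^ 2 * q * k).
Proof.
have odd_uq : odd (u * q).
  have : ~~ odd (2 ^ a) by rewrite oddX /= orbF -lt0n.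
  by rewrite def2a oddD /= addbT negbK.
have eq_s : 2 * (m.-1 * (u ^ 2 * q)) = 2 ^ a * s.
  by apply/eqP; rewrite -(eqn_pmul2l (ltnW q_gt1)); apply/eqP; rewrite /s; nia.
have /dvdnP[s2 defs] : 2 %| s.
  rewrite /s big_seq; apply: dvdn_sum => p Kp; rewrite dvdn2.
  have p_pr := allP prK p Kp; have [p2|odd_p] := even_prime p_pr.
    by have := K2; rewrite -p2 Kp.
  by rewrite -subn1 oddB ?prime_gt0 // odd_p.
have co2 : coprime (2 ^ a) (u ^ 2 * q).
  by rewrite coprimeXl // coprime2n oddM oddX; move: odd_uq; rewrite oddM => /andP[-> ->].
have /dvdnP[k defk] : 2 ^ a %| m.-1.
  by rewrite -(Gauss_dvdl _ co2); apply/dvdnP; exists s2; nia.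
exists k; first by case: k defk; rewrite ?mul0n; lia.
split; first by lia.
apply/eqP; rewrite -(eqn_pmul2l (expn_gt0 2 a)); apply/eqP; nia.
Qed.

Let prK' : all prime (rem q K).
Proof. by apply/allP=> p /mem_rem/(allP prK). Qed.

Lemma prod_dihedral_dvd : \prod_(p <- rem q K) p %| m.
Proof.
apply: prod_primes_dvd => //; first exact: rem_uniq.
apply/allP=> p; rewrite mem_rem_uniq // inE => /andP[neqpq Kp].
have p_pr := allP prK p Kp; have := dvK Kp; rewrite Gauss_dvdl // coprimeMr.
rewrite coprimeXr ?prime_coprime ?dvdn_prime2 ?neqpq //.
by apply: contraNneq K2 => <-.
Qed.

Lemma sum_dihedral_split : s = (q \in K) * q.-1 + s'.
Proof.
have [Kq | nKq] := boolP (q \in K).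
  by rewrite mul1n /s (perm_big _ (perm_to_rem Kq)) big_cons.
by rewrite /s' rem_id.
Qed.

Lemma sum_dihedral_leq : 1 + s' <= m.
Proof.
have [le1 _] := sum_leq_prod_primes prK'; apply: leq_trans le1 _.
by rewrite dvdn_leq ?prod_dihedral_dvd // ltnW.
Qed.

Lemma involution_parameters : [/\ u = 1, m = q + 2, q \in K & s' = q + 1].
Proof.
have [k k_gt0 [defm defs]] := involution_multiplicity.
have := sum_dihedral_split; rewrite defs => eq_s.
have := sum_dihedral_leq; rewrite {1}defm def2a leq_add2l => le_s'.
have u_gt0 : 0 < u.
  rewrite lt0n; apply: contra_eqN def2a => /eqP->.
  by rewrite mul0n -[0 + 1](expn0 2) eqn_exp2l // -lt0n.
have le_q : q <= u * q * k by rewrite -mulnA mulnC -mulnA leq_pmulr ?muln_gt0 ?k_gt0.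
have le_k : k <= u * q * k by rewrite leq_pmull ?muln_gt0 ?u_gt0 ?prime_gt0.
have le_b : (q \in K) * q.-1 <= q.-1 by case: (q \in K); rewrite ?mul1n.
have u1 : u = 1.
  apply/eqP; rewrite eqn_leq u_gt0 andbT leqNgt; apply/negP=> u_gt1.
  have : 2 * (u * q * k) <= u * (u * q * k) by rewrite leq_mul2r u_gt1 orbT.
  have -> : u * (u * q * k) = u ^ 2 * q * k by rewrite -mulnn !mulnA.
  by lia.
move: eq_s le_s'; rewrite u1 exp1n !mul1n => eq_s le_s'.
have le_kb : k * q.-1 <= (q \in K) * q.-1 by nia.
rewrite leq_pmul2r -?subn1 ?subn_gt0 // in le_kb.
have [k1 Kq] : k = 1 /\ q \in K by move: k_gt0 le_kb; case: (q \in K); case: (k) => [|[|]].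
by move: eq_s; rewrite k1 Kq !mul1n !muln1 => eq_s; split=> //; lia.
Qed.

Lemma involution_arith : [/\ 2 ^ a = 4, q = 3, m = 5, 3 \in K & 5 \in K].
Proof.
have [u1 defm Kq eq_s'] := involution_parameters.
have [le1 eq1] := sum_leq_prod_primes prK'; rewrite -/s' eq_s' in le1 eq1.
have prodK' : \prod_(p <- rem q K) p = m.
  apply/eqP; rewrite eqn_leq dvdn_leq ?prod_dihedral_dvd ?(ltnW m_gt1) //=.
  by apply: leq_trans le1; rewrite defm; lia.
have sizeK' : size (rem q K) <= 1 by rewrite -eq1 prodK' defm; apply/eqP; lia.
have [Km pr_m] : m \in K /\ prime m.
  case: (rem q K) (fun p => @mem_rem _ q K p) prodK' sizeK' prK' => [|r [|]] //;
    rewrite ?big_nil ?big_seq1.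
    by move=> _ m1; have := m_gt1; rewrite -m1.
  by move=> sub <- _ /andP[-> _]; rewrite sub ?mem_head.
have [q30 | q31 | q32] : [\/ 3 %| q, 3 %| q + 1 | 3 %| q + 2].
  have : q %% 3 < 3 by rewrite ltn_mod.
  rewrite /dvdn -(modnDml q 1) -(modnDml q 2).
  by case: (q %% 3) => [|[|[|]]] // _; [apply: Or31 | apply: Or33 | apply: Or32].
- have q3 : q = 3 by move: q30; rewrite dvdn_prime2 // => /eqP.
  have m5 : m = 5 by rewrite defm q3.
  by split=> //; [rewrite def2a u1 q3 | rewrite -q3 | rewrite -m5].
- by move: q31; rewrite -[q]mul1n -[in X in X * q]u1 -def2a Euclid_dvdX.
by move: q32; rewrite -defm dvdn_prime2 // defm => /eqP; lia.
Qed.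

End InvolutionEquation.
End InvolutionArithmetic.

Section EvenOrder.

Import GroupScope.

Section DihedralNormaliser.
Variables (gT : finGroupType) (G : {group gT}) (p : nat) (P : {group gT}).
Hypotheses (frobP : FrobSylow G p P) (index2 : #|'N_G(P) : P| = 2).
Local Notation N := 'N_G(P).

Lemma dihedral_norm_order y : y \in N :\: P -> #[y] = 2.
Proof.
case/setDP=> Ny nPy; apply/prime_nt_dvdP => //.
  by rewrite order_eq1; apply: contraNneq nPy => ->.
have nPN : P <| N by rewrite normalSG // (FrobSylow_sub frobP).
have Py2 : y ^+ 2 \in P.
  rewrite coset_idr ?groupX ?(subsetP (normal_norm nPN)) // morphX ?(subsetP (normal_norm nPN)) //.
  by rewrite -index2 -card_quotient ?normal_norm // expg_cardG ?mem_quotient.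
rewrite order_dvdn; apply: contraNT nPy; apply: (FrobSylow_conj_fix frobP Py2 Ny).
by apply/conjg_fixP/commgP/commute_sym/commuteX.
Qed.

Lemma dihedral_norm_invert x y : x \in P -> y \in N :\: P -> x ^ y = x^-1.
Proof.
move=> Px Dy; have [Ny nPy] := setDP Dy.
have Pxy : x ^ y \in P by rewrite memJ_norm //; case/setIP: Ny.
have y2 : y * y = 1 by have := expg_order y; rewrite dihedral_norm_order.
have fixy : (x * x ^ y) ^ y = x * x ^ y.
  by rewrite conjMg -conjgM y2 conjg1; apply: (centsP (FrobSylow_abelian frobP)).
apply/eqP; rewrite eq_sym eq_invg_mul; apply: contraNT nPy.
exact: (FrobSylow_conj_fix frobP (groupM Px Pxy) Ny fixy).
Qed.

Lemma dihedral_norm_card : #|P| = p.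
Proof.
have [x Px ntx] := trivgPn _ (FrobSylow_neq1 frobP).
rewrite -(FrobSylow_order frobP (x := x)) ?in_setD1 ?ntx // orderE.
have /mingroupP[_ minP] := FrobSylow_minnormal frobP.
rewrite (minP <[x]>%G) //= ?cycle_subG // cycle_eq1 ntx; apply/subsetP=> y Ny.
rewrite inE -cycleJ cycle_subG; have [Py | nPy] := boolP (y \in P).
  by rewrite (conjg_fixP _) ?cycle_id //; apply/commgP/(centsP (FrobSylow_abelian frobP)).
by rewrite dihedral_norm_invert ?groupV ?cycle_id // inE nPy.
Qed.

Lemma dihedral_norm_card_diff : #|N :\: P| = p.
Proof.
rewrite cardsD (setIidPr (FrobSylow_sub_norm frobP)) (FrobSylow_card_norm frobP) index2.
by rewrite dihedral_norm_card muln2 -addnn addnK.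
Qed.

Lemma dihedral_prime_neq2 : p != 2.
Proof. by rewrite -index2 FrobSylow_prime_neq_index. Qed.

End DihedralNormaliser.

Definition involutions (gT : finGroupType) (G : {set gT}) := [set x in G | #[x] == 2].

Definition involution_factors (gT : finGroupType) (G : {set gT}) x :=
  [set i in involutions G | i * x \in involutions G].

Section CountInvolutions.
Variables (gT : finGroupType) (G : {group gT}).
Hypothesis frobG : FrobSylow_group G.
Local Notation I := (involutions G).
Implicit Types (p : nat) (P : {group gT}) (x y i : gT).

Lemma involutionV i : i \in I -> i^-1 = i.
Proof. by rewrite inE => /andP[_ /eqP oi]; rewrite invg_expg oi. Qed.

Lemma involution_sub : I \subset G.
Proof. by apply/subsetP=> i; rewrite inE => /andP[]. Qed.

Lemma involutions_p_support : I = p_support G 2.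
Proof.
apply/setP=> x; apply/idP/idP=> [| Gx2].
  rewrite !inE => /andP[Gx /eqP ox].
  by rewrite Gx -order_gt1 ox /p_elt ox pnat_id.
have Gx : x \in G by move: Gx2; rewrite !inE => /andP[/andP[]].
have /(mem_FrobSylow frobG)[p [P [frobP Px]]] : x \in G^# by move: Gx2; rewrite inE => /andP[].
rewrite inE Gx (FrobSylow_order frobP Px); apply/eqP.
apply: mem_p_support_inj Gx2.
exact: subsetP (Sylow_sub_p_support (FrobSylow_Sylow frobP)) x Px.
Qed.

Lemma involution_factors1 : involution_factors G 1 = I.
Proof. by apply/setP=> i; rewrite !inE mulg1 andbb. Qed.

Lemma involution_factors_Sylow2 P x :
  FrobSylow G 2 P -> x \in P^# -> involution_factors G x = P :\: [set 1; x].
Proof.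
move=> frobP Px; have [ntx Px1] := setD1P Px.
have sP1I y : y \in P^# -> y \in I.
  move=> Py; rewrite inE (FrobSylow_order frobP Py) eqxx andbT.
  by case/setD1P: Py => _; apply: subsetP (FrobSylow_sub frobP) y.
have xV : x^-1 = x := involutionV (sP1I x Px).
have nI1 : 1 \notin I by rewrite inE order1 andbF.
apply/setP=> i; rewrite in_set in_setD in_set2 negb_or; apply/andP/idP.
  case=> Ii Iix; rewrite (memPn nI1 i Ii) /=; apply/andP; split.
    by apply: contraNneq nI1 => eqix; rewrite -(mulVg x) xV -{1}eqix.
  rewrite -(FrobSylow_cent1 frobP Px) inE (subsetP involution_sub) //; apply/cent1P.
  by have := involutionV Iix; rewrite invMg (involutionV Ii) xV.
case/andP=> /andP[nti neqix] Pi; split; apply: sP1I; rewrite in_setD1 ?nti // groupM // andbT.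
by apply: contraNneq neqix => ix1; rewrite -(mulgK x i) ix1 mul1g xV.
Qed.

Lemma involution_factors_norm p P x :
  FrobSylow G p P -> x \in P^# -> involution_factors G x \subset 'N_G(P).
Proof.
move=> frobP Px; apply/subsetP=> i; rewrite in_set => /andP[Ii Iix].
apply: (FrobSylow_norm_elt frobP Px); first exact: subsetP involution_sub i Ii.
rewrite (_ : x ^ i = x^-1) ?groupV; first by case/setD1P: Px.
by rewrite conjgE (involutionV Ii) mulgA -(involutionV Iix) invMg mulgKV.
Qed.

Lemma involution_factors_dihedral p P x :
    FrobSylow G p P -> #|'N_G(P) : P| = 2 -> x \in P^# ->
  involution_factors G x = 'N_G(P) :\: P.
Proof.
move=> frobP index2 Px; have [_ Px1] := setD1P Px.
have nDI y : y \in 'N_G(P) :\: P -> y \in I.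
  move=> Dy; rewrite inE (dihedral_norm_order frobP index2 Dy) eqxx andbT.
  by case/setDP: Dy => /setIP[].
apply/eqP; rewrite eqEsubset; apply/andP; split; apply/subsetP=> i.
  move=> Ii; rewrite in_setD (subsetP (involution_factors_norm frobP Px)) // andbT.
  apply: contra (dihedral_prime_neq2 frobP index2) => Pi.
  move: Ii; rewrite !inE => /andP[/andP[_ /eqP oi] _].
  by rewrite -oi (FrobSylow_order frobP) // in_setD1 Pi -order_gt1 oi.
move=> Di; rewrite in_set !nDI //; have [Ni nPi] := setDP Di.
by rewrite in_setD groupMr // nPi groupM // (subsetP (FrobSylow_sub_norm frobP)).
Qed.

Lemma involution_factors0 p P x :
    FrobSylow G p P -> p != 2 -> #|'N_G(P) : P| != 2 -> x \in P^# ->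
  involution_factors G x = set0.
Proof.
move=> frobP neqp2 index_neq2 Px; apply/setP=> i; rewrite in_set0; apply/negP=> xi.
have Ni := subsetP (involution_factors_norm frobP Px) i xi.
have : 2 %| #|'N_G(P)|.
  by move: xi; rewrite !inE => /andP[/andP[_ /eqP <-] _]; apply: order_dvdG.
rewrite (FrobSylow_card_norm frobP) Euclid_dvdM // [_ %| #|_ : _|]dvdn_prime2 //; last first.
  exact: FrobSylow_index_prime frobP.
rewrite eq_sym (negPf index_neq2) orbF => /(pgroupP (FrobSylow_pgroup frobP) 2 isT).
by rewrite inE eq_sym (negPf neqp2).
Qed.

Lemma sum_involution_factors : (\sum_(x in G) #|involution_factors G x| = #|I| * #|I|)%N.
Proof.
under eq_bigr => x Gx do rewrite cardsE -sum1_card big_mkcondr /=.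
rewrite exchange_big /= -sum_nat_const; apply: eq_bigr => i Ii.
have Gi := subsetP involution_sub i Ii.
rewrite -big_mkcondr sum1_card -(card_lcoset I i^-1); apply: eq_card => x.
rewrite mem_lcoset invgK; transitivity ((x \in G) && (i * x \in I)) => //.
case Iix: (i * x \in I); rewrite ?andbF // andbT -(groupMl _ Gi).
exact: subsetP involution_sub _ Iix.
Qed.

Definition dihedral_primes := [seq p <- primes #|G| | Sylow_norm_index G p == 2].

Lemma dihedral_primes_neq2 : 2 \notin dihedral_primes.
Proof.
rewrite mem_filter; apply/andP=> -[/eqP index2 /(FrobSylow_repr frobG) frob2].
by have /eqP := dihedral_prime_neq2 frob2 index2.
Qed.

Lemma sum_p_support_involution_factors p : p \in primes #|G| -> p != 2 ->
  (\sum_(x in p_support G p) #|involution_factors G x| =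
    (Sylow_norm_index G p == 2) * (#|p_support G p| * p))%N.
Proof.
move=> pG neqp2; rewrite -sum_nat_const big_distrr /=.
apply: eq_bigr => x /(p_support_FrobSylow frobG pG).
case=> P frobP Px; rewrite -(Sylow_norm_indexE (FrobSylow_Sylow frobP)).
have [index2 | index_neq2] := eqVneq.
  rewrite (involution_factors_dihedral frobP index2 Px) mul1n.
  exact: dihedral_norm_card_diff frobP index2.
by rewrite (involution_factors0 frobP neqp2 index_neq2 Px) cards0.
Qed.

Lemma involution_equation : 2 %| #|G| ->
  (#|I| * #|I| = #|I| + #|I| * (#|Sylow_repr G 2| - 2)
     + \sum_(p <- dihedral_primes) #|p_support G p| * p)%N.
Proof.
move=> evG; have G2 : 2 \in primes #|G| by rewrite mem_primes evG cardG_gt0.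
rewrite -sum_involution_factors (big_p_support _ _ (FrobSylow_primary frobG)) -addnA.
congr (_ + _)%N; first by rewrite involution_factors1.
rewrite (bigD1_seq 2) ?primes_uniq //=; congr (_ + _)%N.
  rewrite {1}involutions_p_support -sum_nat_const; apply: eq_bigr => x.
  case/(p_support_FrobSylow frobG G2) => P frobP Px; have [ntx Px1] := setD1P Px.
  rewrite (involution_factors_Sylow2 frobP Px) cardsD (setIidPr _) ?cards2 1?eq_sym ?ntx.
    by rewrite (card_Hall (FrobSylow_Sylow frobP)) (card_Hall (Sylow_reprP G 2)).
  by apply/subsetP=> y /set2P[]->; rewrite ?group1.
rewrite big_filter [LHS]big_mkcond [RHS]big_mkcond [LHS]big_seq [RHS]big_seq.
apply: eq_bigr => p pG.
have [-> | neqp2] /= := eqVneq p 2.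
  by have := dihedral_primes_neq2; rewrite mem_filter G2 andbT => /negPf->.
by rewrite sum_p_support_involution_factors //; case: ifP; rewrite ?mul1n.
Qed.

Lemma sum_dihedral_p_support :
  (2 * \sum_(p <- dihedral_primes) #|p_support G p| * p =
     #|G| * \sum_(p <- dihedral_primes) p.-1)%N.
Proof.
rewrite !big_distrr big_seq [RHS]big_seq; apply: eq_bigr => p /=.
rewrite mem_filter => /andP[/eqP index2 /(FrobSylow_repr frobG) frobP].
rewrite (card_p_support frobP) (FrobSylow_card frobP) -/(Sylow_norm_index G p) index2.
rewrite (dihedral_norm_card frobP index2); ring.
Qed.

Theorem even_FrobSylow_group : simple G -> 2 %| #|G| ->
  [/\ #|G| = 60, #|G : 'N_G(Sylow_repr G 2)| = 5,
      Sylow_norm_index G 3 = 2 & Sylow_norm_index G 5 = 2].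
Proof.
move=> simG evG; have G2 : 2 \in primes #|G| by rewrite mem_primes evG cardG_gt0.
have frob2 := FrobSylow_repr frobG G2; have q_pr := FrobSylow_index_prime frob2.
have oG := FrobSylow_card frob2; have := FrobSylow_index_dvd frob2.
set P := Sylow_repr G 2 in frob2 q_pr oG *; set q := #|'N_G(P) : P| in q_pr oG *.
set m := #|G : 'N_G(P)| in oG *.
have [a oP] := p_natP (FrobSylow_pgroup frob2).
have a_gt0 : 0 < a.
  rewrite lt0n; apply: contraNneq (FrobSylow_neq1 frob2) => a0.
  by apply/eqP/card1_trivg; rewrite oP a0.
case/dvdnP=> u defu; have def2a : (2 ^ a = u * q + 1)%N.
  by rewrite -defu addn1 oP prednK ?expn_gt0.
have m_gt1 : 1 < m.
  by rewrite indexg_gt1; case/andP: (FrobSylow_norm_proper frob2 simG).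
have oI : #|I| = (u * q * m)%N by rewrite involutions_p_support (card_p_support frob2) defu.
have [|||||o2 q3 m5 dih3 dih5] := @involution_arith a q u m dihedral_primes a_gt0 q_pr def2a m_gt1.
- by rewrite filter_uniq ?primes_uniq.
- by apply/allP=> p; rewrite mem_filter mem_primes => /andP[_ /and3P[]].
- exact: dihedral_primes_neq2.
- by move=> p; rewrite mem_filter mem_primes -oP -oG => /andP[_ /and3P[]].
- move: (involution_equation evG) sum_dihedral_p_support; rewrite oI -/P oG oP def2a.
  move: (\sum_(p <- _) #|p_support G p| * p)%N (\sum_(p <- _) p.-1)%N => s1 s2.
  have : 0 < u * q by move: def2a; have := leq_pexp2l (isT : 0 < 2) a_gt0; lia.
  case: (u * q)%N => // w _; case: m m_gt1 {oG oI} => // n _ eq1 eq2.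
  have def_s1 : s1 = (n.+1 * (n * w.+1 ^ 2))%N.
    by move: eq1; rewrite (_ : w.+1 + 1 - 2 = w)%N; lia.
  by apply/eqP; rewrite -(eqn_pmul2l (ltn0Sn n)) [X in _ == X]mulnA -eq2 def_s1 mulnCA.
have dih p : p \in dihedral_primes -> Sylow_norm_index G p = 2.
  by rewrite mem_filter => /andP[/eqP].
by split; rewrite ?dih // oG oP o2 q3 m5.
Qed.

End CountInvolutions.
End EvenOrder.

(** * Odd order: exceptional characters *)

Section Characters.

Import Order.TTheory GroupScope GRing.Theory Num.Theory.
Local Open Scope ring_scope.

Lemma sum_sqr_diff (T : finType) (a : T -> int) :
  \sum_i \sum_j (a i - a j) ^+ 2 =
    2 * (#|T|%:Z * \sum_i a i ^+ 2 - (\sum_i a i) ^+ 2).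
Proof.
have sum_const (c : int) : \sum_(i : T) c = #|T|%:Z * c by rewrite sumr_const -mulr_natl natz.
have sum_row i : \sum_j (a i - a j) ^+ 2 =
    #|T|%:Z * a i ^+ 2 + \sum_j a j ^+ 2 + (-2 * \sum_j a j) * a i.
  rewrite (eq_bigr (fun j => a i ^+ 2 + a j ^+ 2 + (-2 * a i) * a j)) => [|j _]; last by ring.
  by rewrite !big_split /= sum_const -mulr_sumr; ring.
rewrite (eq_bigr _ (fun i _ => sum_row i)) !big_split /= sum_const -!mulr_sumr; ring.
Qed.

Lemma variance_two_values (T : finType) (a : T -> int) (A B : {set T}) (n : nat) (c d : int) :
    #|A| = n -> #|B| = n -> [disjoint A & B] -> c != d ->
    {in A, forall i, a i = c} -> {in B, forall i, a i = d} ->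
  n%:Z * (#|T|%:Z - n%:Z) <= #|T|%:Z * \sum_i a i ^+ 2 - (\sum_i a i) ^+ 2.
Proof.
move=> oA oB tiAB neqcd aA aB; pose g i := \sum_(j in A :|: B) (a i - a j) ^+ 2.
have sqr_ge0 i j : 0 <= (a i - a j) ^+ 2 by apply: sqr_ge0.
have sqr_ge1 i j : a i != a j -> 1 <= (a i - a j) ^+ 2.
  by rewrite -subr_eq0 => nz; rewrite -gtz0_ge1 exprn_even_gt0.
have g_ge_sub i (D : {set T}) : #|D| = n -> D \subset A :|: B ->
    {in D, forall j, a i != a j} -> n%:Z <= g i.
  move=> <- sD neqD; rewrite /g (big_setID D) /= (setIidPr sD) ler_wpDr ?sumr_ge0 //.
  by rewrite -natz -sumr_const; apply: ler_sum => j /neqD/sqr_ge1.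
have g_ge i : n%:Z <= g i.
  have [ai | neq] := eqVneq (a i) c.
    by apply: (g_ge_sub i B); rewrite ?subsetUr // => j /aB->; rewrite ai.
  by apply: (g_ge_sub i A); rewrite ?subsetUl // => j /aA->.
have sum_g (D : {set T}) : #|D|%:Z * n%:Z <= \sum_(i in D) g i.
  by rewrite -[#|D|%:Z]natz mulr_natl -sumr_const ler_sum.
rewrite -(ler_pM2l (ltr0n _ 2)) -sum_sqr_diff (bigID (mem (A :|: B))) /=.
have -> : \sum_(i in A :|: B) \sum_j (a i - a j) ^+ 2 = \sum_(i in setT) g i.
  rewrite exchange_big /=; apply: eq_big => [i | j _]; first by rewrite inE.
  by apply: eq_bigr => i _; rewrite -[RHS]sqrrN opprB.
have -> : 2 * (n%:Z * (#|T|%:Z - n%:Z)) =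
    #|[set: T]|%:Z * n%:Z + #|~: (A :|: B)|%:Z * n%:Z.
  have := cardsC (A :|: B); rewrite cardsU (disjoint_setI0 tiAB) cards0 subn0 oA oB cardsT => <-.
  by rewrite !PoszD; ring.
rewrite lerD ?sum_g // (eq_bigl (mem (~: (A :|: B)))) => [|i]; last by rewrite !inE.
apply: le_trans (sum_g _) _; apply: ler_sum => i _.
by rewrite [leRHS](bigID (mem (A :|: B))) /= ler_wpDr ?sumr_ge0.
Qed.

Lemma leq_sum_card_disjoint (I : eqType) (T : finType) (r : seq I) (E : I -> {set T})
    (S : {set T}) :
    uniq r -> {in r, forall i, E i \subset S} ->
    {in r &, forall i j, i != j -> [disjoint E i & E j]} ->
  (\sum_(i <- r) #|E i| <= #|S|)%N.
Proof.
elim: r S => [|i r IHr] S /=; first by rewrite big_nil.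
case/andP=> nri ur sES tiE; rewrite big_cons -(cardsID (E i) S) leq_add //.
  by rewrite subset_leq_card // subsetI subxx sES ?mem_head.
apply: IHr => // [j rj | j k rj rk]; last by apply: tiE; rewrite inE ?rj ?rk orbT.
rewrite subsetD sES ?inE ?rj ?orbT //= tiE ?mem_head ?inE ?rj ?orbT //.
by apply: contraNneq nri => <-.
Qed.

Lemma vchar_inv (gT : finGroupType) (G : {group gT}) (phi : 'CF(G)) x :
  phi \in 'Z[irr G] -> phi x^-1%g = (phi x)^*.
Proof.
by case/vcharP=> [chi1 N1 [chi2 N2 ->]]; rewrite !cfunE !char_inv // rmorphB.
Qed.

Section RealVirtualCharacters.
Variables (gT : finGroupType) (G : {group gT}).
Hypothesis oddG : odd #|G|.
Implicit Types phi psi : 'CF(G).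

(* In odd order the non-trivial elements come in pairs {x, x^-1}. *)
Lemma odd_real_vchar_sum phi :
    phi \in 'Z[irr G] -> phi^*%CF = phi ->
  exists2 beta, beta \in Aint & \sum_(x in G) phi x = phi 1%g + 2%:R * beta.
Proof.
move=> Zphi realphi; pose lt (x : gT) := (enum_rank x < enum_rank x^-1%g)%N.
exists (\sum_(x in G^# | lt x) phi x); first by apply: rpred_sum => x _; apply: Aint_vchar.
rewrite (big_setD1 1%g) //=; congr (_ + _).
rewrite (bigID lt) /= mulr_natl mulr2n; congr (_ + _).
rewrite (reindex_inj invg_inj) /=; apply: eq_big => [x | x _]; last first.
  by rewrite vchar_inv // -{2}realphi cfunE.
rewrite !inE invg_eq1 groupV /lt invgK -leqNgt.
have [-> | ntx] := eqVneq x 1%g; first by rewrite invg1.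
have [Gx | _] := boolP (x \in G) => //=.
rewrite leq_eqVlt; case: eqP => //= /val_inj/enum_rank_inj eqx.
case/eqP: ntx; apply/eqP; rewrite -order_eq1 -dvdn1.
have /eqP <- : coprime 2 #|G| by rewrite coprime2n.
by rewrite dvdn_gcd order_dvdG // andbT order_dvdn expgS expg1 {1}eqx mulVg.
Qed.

Lemma odd_real_vchar phi :
  phi \in 'Z[irr G] -> phi^*%CF = phi -> (phi 1%g == '[phi, 1] %[mod 2])%A.
Proof.
move=> Zphi realphi; have [beta Zbeta] := odd_real_vchar_sum Zphi realphi.
have Zdot : '[phi, 1] \in Aint by rewrite Aint_Cint // Cint_cfdot_vchar // rpred1.
have -> : \sum_(x in G) phi x = #|G|%:R * '[phi, 1].
  rewrite cfdotE mulVKf ?neq0CG //; apply: eq_bigr => x Gx.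
  by rewrite cfun1E Gx conjC1 mulr1.
rewrite -{1}[#|G|]odd_double_half oddG add1n -natr1 mulrDl mul1r -mul2n natrM -mulrA => eq_phi.
have -> : phi 1%g = 2%:R * (#|G|./2%:R * '[phi, 1] - beta) + '[phi, 1].
  by rewrite mulrBr addrAC eq_phi addrK.
rewrite -[X in (_ == X %[mod _])%A]add0r eqAmodDr eqAmodMr0 //.
by rewrite rpredB // rpredM // rpred_nat.
Qed.

Lemma odd_real_vchar_dot phi psi :
    phi \in 'Z[irr G] -> phi^*%CF = phi -> psi \in 'Z[irr G] -> psi^*%CF = psi ->
    '[phi, 1] = 0 ->
  (2 %| '[phi, psi])%A.
Proof.
move=> Zphi rphi Zpsi rpsi phi1.
have := odd_real_vchar (mul_vchar Zphi Zpsi); rewrite rmorphM /= rphi rpsi => /(_ erefl).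
have -> : '[phi * psi, 1] = '[phi, psi].
  rewrite !cfdotE; congr (_ * _); apply: eq_bigr => x Gx.
  by rewrite cfun1E Gx conjC1 mulr1 cfunE -{1}rpsi [(_^*)%CF x]cfunE.
rewrite -eqAmod0 eqAmod_sym cfunE => /eqAmod_trans; apply.
rewrite -(mul0r (psi 1%g)); apply: eqAmodMr; first by rewrite Aint_vchar.
by rewrite -phi1 odd_real_vchar.
Qed.

End RealVirtualCharacters.

Section NormedTIInduction.
Variables (gT : finGroupType) (G L : {group gT}) (A : {set gT}).
Hypothesis tiA : normedTI A G L.
Let sLG : L \subset G. Proof. by case/normedTI_memJ_P: tiA. Qed.

Lemma normedTI_cfInd (phi : 'CF(L)) : phi \in 'CF(L, A) -> {in A, 'Ind[G] phi =1 phi}.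
Proof.
move=> Aphi x Ax; have /normedTI_memJ_P[_ _ memJ] := tiA.
rewrite cfIndE // (big_setID L) /= (setIidPr sLG) addrC big1 ?add0r => [|y /setDP[Gy nLy]].
  rewrite (eq_bigr (fun=> phi x)) => [|y Ly]; last by rewrite cfunJ.
  by rewrite sumr_const -[phi x *+ _]mulr_natl mulKf ?neq0CG.
by rewrite (cfun_on0 Aphi) // memJ.
Qed.

Lemma normedTI_cfdot_Ind (phi psi : 'CF(L)) :
  phi \in 'CF(L, A) -> psi \in 'CF(L, A) -> '['Ind[G] phi, 'Ind[G] psi] = '[phi, psi].
Proof.
move=> Aphi Apsi; rewrite -Frobenius_reciprocity !cfdotE; congr (_ * _).
apply: eq_bigr => x Lx; have [Ax | nAx] := boolP (x \in A); last by rewrite (cfun_on0 Aphi) ?mul0r.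
by rewrite cfResE // normedTI_cfInd.
Qed.

Lemma sum_class_support (phi : 'CF(G)) :
  \sum_(x in class_support A G) `|phi x| ^+ 2 = (\sum_(x in A) `|phi x| ^+ 2) *+ #|G : L|.
Proof.
rewrite (set_partition_big _ (partition_normedTI tiA)) /=.
have [_ _ /eqP defL] := and3P tiA.
rewrite -defL -card_conjugates -sumr_const; apply: eq_bigr => _ /imsetP[g Gg ->].
rewrite big_imset /=; last by move=> x y _ _; apply: conjg_inj.
by apply: eq_bigr => x _; rewrite cfunJ.
Qed.

End NormedTIInduction.

Lemma card_irr_constt_leq_cfnorm (gT : finGroupType) (G : {group gT}) (phi : 'CF(G)) :
  phi \in 'Z[irr G] -> #|[set s | '[phi, 'chi_s] != 0]|%:R <= '[phi].
Proof.
move=> Zphi; rewrite cfdot_sum_irr -sum1_card natr_sum big_mkcond; apply: ler_sum => s _.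
rewrite -normCK inE; case: ifP => [nz | _]; last exact: exprn_ge0.
by rewrite exprn_ege1 // norm_intr_ge1 // Cint_cfdot_vchar ?irr_vchar.
Qed.

Lemma card_Iirr_neq0 (gT : finGroupType) (P : {group gT}) :
  abelian P -> #|[set j : Iirr P | j != 0]| = #|P|.-1.
Proof.
move=> abP; rewrite -(card_Iirr_abelian abP) -cardsT (cardsD1 0 setT) in_setT /=.
by apply: eq_card => j; rewrite !inE andbT.
Qed.

Lemma sum_sqr_cfnorm (gT : finGroupType) (G : {group gT}) (phi : 'CF(G)) :
  \sum_(x in G) `|phi x| ^+ 2 = #|G|%:R * '[phi].
Proof.
by rewrite cfdotE mulVKf ?neq0CG //; apply: eq_bigr => x _; rewrite -normCK.
Qed.

Lemma abelian_irr1 (gT : finGroupType) (P : {group gT}) (j : Iirr P) :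
  abelian P -> 'chi_j 1%g = 1.
Proof. by move=> abP; rewrite lin_char1 //; apply/char_abelianP. Qed.

Lemma abelian_sum_sqr_vchar (gT : finGroupType) (P : {group gT}) (psi : 'CF(P)) :
    abelian P -> psi \in 'Z[irr P] ->
  exists2 a : Iirr P -> int, forall k, '[psi, 'chi_k] = (a k)%:~R
    & \sum_(x in P^#%g) `|psi x| ^+ 2 =
      (#|Iirr P|%:Z * \sum_k a k ^+ 2 - (\sum_k a k) ^+ 2)%:~R.
Proof.
move=> abP Zpsi; pose a k := Num.floor '[psi, 'chi_k].
have aE k : '[psi, 'chi_k] = (a k)%:~R by rewrite floorK // Cint_cfdot_vchar ?irr_vchar.
exists a => //.
have sumP : \sum_(x in P) `|psi x| ^+ 2 = #|P|%:R * \sum_k (a k)%:~R ^+ 2.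
  rewrite sum_sqr_cfnorm cfdot_sum_irr; congr (_ * _); apply: eq_bigr => k _.
  by rewrite !aE -normCK real_normK // realz.
have psi1 : psi 1%g = (\sum_k a k)%:~R.
  rewrite [psi in LHS]cfun_sum_cfdot sum_cfunE rmorph_sum.
  by apply: eq_bigr => k _; rewrite cfunE abelian_irr1 // mulr1 aE.
rewrite (big_setD1 1%g) //= psi1 real_normK ?realz // in sumP.
have sum_sqr : \sum_k (a k)%:~R ^+ 2 = (\sum_k a k ^+ 2)%:~R :> algC.
  by rewrite rmorph_sum; apply: eq_bigr => k _; rewrite rmorphXn.
rewrite card_Iirr_abelian // rmorphB rmorphM rmorphXn /= -pmulrn -sum_sqr -sumP.
by rewrite addrAC subrr add0r.
Qed.

Section InducedDifferences.
Variables (gT : finGroupType) (G : {group gT}) (p : nat) (P : {group gT}).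
Hypothesis frobP : FrobSylow G p P.
Local Notation N := 'N_G(P).
Local Notation q := #|N : P|.
Implicit Types (j k : Iirr P).

Let sPN : P \subset N := FrobSylow_sub_norm frobP.
Let nPN : P <| N. Proof. by rewrite normalSG // (FrobSylow_sub frobP). Qed.
Let abP : abelian P := FrobSylow_abelian frobP.
Let irr1 j : 'chi_j 1%g = 1 := abelian_irr1 j abP.

Definition norm_Ind j : 'CF(N) := 'Ind[N] 'chi_j.

Definition Ind_diff j k : 'CF(G) := 'Ind[G] ('chi_j - 'chi_k).

Lemma norm_Ind_irr j : j != 0 -> norm_Ind j \in irr N.
Proof. exact: irr_induced_Frobenius_ker (FrobSylow_Frobenius frobP) j. Qed.

Lemma norm_Ind_dot j k :
  j != 0 -> k != 0 -> '[norm_Ind j, norm_Ind k] = (norm_Ind j == norm_Ind k)%:R.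
Proof.
move=> /norm_Ind_irr/irrP[a ->] /norm_Ind_irr/irrP[b ->].
by rewrite cfdot_irr (inj_eq irr_inj).
Qed.

Lemma norm_Ind_dotE j k :
  '[norm_Ind j, norm_Ind k] = #|P|%:R^-1 * \sum_(y in N) (j == conjg_Iirr k y)%:R.
Proof.
rewrite /norm_Ind -Frobenius_reciprocity cfResInd // cfdotZr.
rewrite fmorphV rmorph_nat; congr (_ * _); rewrite cfdot_sumr.
by apply: eq_bigr => y _; rewrite -conjg_IirrE cfdot_irr.
Qed.

Lemma norm_Ind0_dot j : j != 0 -> '[norm_Ind 0, norm_Ind j] = 0.
Proof.
move=> nzj; rewrite norm_Ind_dotE big1 ?mulr0 // => y _.
by rewrite eq_sym conjg_Iirr_eq0 (negPf nzj).
Qed.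

Lemma norm_Ind0_norm : '[norm_Ind 0] = q%:R.
Proof.
rewrite norm_Ind_dotE (eq_bigr (fun=> 1)) => [|y _]; last by rewrite conjg_Iirr0 eqxx.
by rewrite sumr_const -(Lagrange sPN) natrM mulKf ?neq0CG.
Qed.

Lemma norm_Ind1 j : norm_Ind j 1%g = q%:R.
Proof. by rewrite /norm_Ind cfInd1 // irr1 mulr1. Qed.

Lemma norm_Ind_conjC j : norm_Ind (conjC_Iirr j) = ((norm_Ind j)^*)%CF.
Proof. by rewrite /norm_Ind conjC_IirrE cfAutInd. Qed.

Lemma norm_Ind_conjC_neq j : odd #|G| -> j != 0 -> norm_Ind (conjC_Iirr j) != norm_Ind j.
Proof.
move=> oddG nzj; rewrite norm_Ind_conjC; have oddN : odd #|N| by apply: oddSg oddG; apply: subsetIl.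
have oddq : odd q := dvdn_odd (dvdn_indexg N P) oddN.
apply: contraL oddq => /eqP realj.
have := odd_real_vchar oddN (cfInd_vchar N (irr_vchar j)) realj.
rewrite -/(norm_Ind j) norm_Ind1 -Frobenius_reciprocity rmorph1 -irr0 cfdot_irr (negPf nzj).
by rewrite (eqAmod0_nat 2) dvdn2.
Qed.

Lemma card_norm_Ind_fiber k : k != 0 ->
  #|[set j | (j != 0) && (norm_Ind j == norm_Ind k)]| = q.
Proof.
move=> nzk; apply/eqP; rewrite -(eqr_nat algC); apply/eqP.
rewrite -[RHS](norm_Ind1 k) -(cfRes1 P) ['Res[P] _]cfun_sum_cfdot.
rewrite sum_cfunE -sum1_card natr_sum big_mkcond /=; apply: eq_bigr => j _.
rewrite cfunE irr1 mulr1 inE cfdotC Frobenius_reciprocity -/(norm_Ind j).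
have [-> | nzj] := eqVneq j 0; first by rewrite norm_Ind0_dot // conjC0.
by rewrite norm_Ind_dot //; case: eqP; rewrite ?conjC1 ?conjC0.
Qed.

Lemma irr_Res_norm_Ind (s : Iirr G) j k :
  norm_Ind j = norm_Ind k -> '['Res[P] 'chi_s, 'chi_j] = '['Res[P] 'chi_s, 'chi_k].
Proof.
have dotE i : '['Res[P] 'chi_s, 'chi_i] = '['chi_s, 'Ind[G] (norm_Ind i)].
  by rewrite cfIndInd ?subsetIl // cfdotC Frobenius_reciprocity -cfdotC.
by rewrite !dotE => ->.
Qed.

Lemma Ind_diffE j k : Ind_diff j k = 'Ind[G] (norm_Ind j - norm_Ind k).
Proof. by rewrite -raddfB cfIndInd ?subsetIl. Qed.

Lemma norm_Ind_diff_on j k : norm_Ind j - norm_Ind k \in 'CF(N, P^#).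
Proof.
rewrite cfun_onD1 -raddfB cfInd_normal //= cfInd1 // !cfunE !irr1 subrr mulr0.
by rewrite eqxx.
Qed.

Lemma Ind_diff_dot j1 j2 k1 k2 :
  '[Ind_diff j1 j2, Ind_diff k1 k2] =
  '[norm_Ind j1, norm_Ind k1] - '[norm_Ind j1, norm_Ind k2]
    - '[norm_Ind j2, norm_Ind k1] + '[norm_Ind j2, norm_Ind k2].
Proof.
rewrite !Ind_diffE (normedTI_cfdot_Ind (FrobSylow_TI frobP)) ?norm_Ind_diff_on //.
by rewrite cfdotBl !cfdotBr; ring.
Qed.

Lemma Ind_diff_vchar j k : Ind_diff j k \in 'Z[irr G, G^#].
Proof.
rewrite zcharD1E cfInd_vchar ?rpredB ?irr_vchar //= cfInd1 ?(FrobSylow_sub frobP) //.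
by rewrite !cfunE !irr1 subrr mulr0.
Qed.

Lemma Ind_diff_norm j k :
  j != 0 -> k != 0 -> norm_Ind j != norm_Ind k -> '[Ind_diff j k] = 2%:R.
Proof.
move=> nzj nzk neqjk; rewrite Ind_diff_dot !norm_Ind_dot // !eqxx [norm_Ind k == _]eq_sym.
by rewrite (negPf neqjk) !subr0 -natrD.
Qed.

Lemma Ind_diff_eq0 j k : norm_Ind j = norm_Ind k -> Ind_diff j k = 0.
Proof. by move=> eqjk; rewrite Ind_diffE eqjk subrr raddf0. Qed.

Lemma Ind_diff_conjC j : ((Ind_diff j (conjC_Iirr j))^*)%CF = - Ind_diff j (conjC_Iirr j).
Proof.
by rewrite /Ind_diff cfAutInd rmorphB /= conjC_IirrE cfConjCK -raddfN opprB.
Qed.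

Lemma Ind_diff0_norm j : j != 0 -> '[Ind_diff 0 j] = q%:R + 1.
Proof.
move=> nzj; rewrite Ind_diff_dot norm_Ind0_norm norm_Ind0_dot // (norm_Ind_dot nzj nzj) eqxx.
by rewrite [X in _ - X + _]cfdotC norm_Ind0_dot // conjC0 !subr0.
Qed.

Lemma Ind_diff0_dot1 j : j != 0 -> '[Ind_diff 0 j, 1] = 1.
Proof.
move=> nzj; rewrite -Frobenius_reciprocity rmorph1 -irr0 cfdotBl !cfdot_irr eqxx.
by rewrite (negPf nzj) subr0.
Qed.

Section ExceptionalCharacters.
Hypothesis oddG : odd #|G|.

Let nreal j (nzj : j != 0) : norm_Ind (conjC_Iirr j) != norm_Ind j :=
  norm_Ind_conjC_neq oddG nzj.

Lemma Ind_diff_conjC_norm j : j != 0 -> '[Ind_diff j (conjC_Iirr j)] = 2%:R.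
Proof. by move=> nzj; rewrite Ind_diff_norm ?conjC_Iirr_eq0 // eq_sym nreal. Qed.

Lemma Ind_diff_conjC_irr j : j != 0 ->
  exists s, Ind_diff j (conjC_Iirr j) = 'chi_s - 'chi_(conjC_Iirr s).
Proof.
move=> nzj; have [s [t neqst defj]] := vchar_norm2 (Ind_diff_vchar _ _) (Ind_diff_conjC_norm nzj).
exists s; rewrite defj; congr (_ - 'chi_ _); apply/esym/eqP.
have := Ind_diff_conjC j; rewrite defj rmorphB /= -!conjC_IirrE opprB.
move/(congr1 (cfdot^~ 'chi_t)); rewrite !cfdotBl !cfdot_irr eqxx [s == t]eq_sym.
rewrite (negPf neqst) subr0; case: (conjC_Iirr s == t) => //; rewrite sub0r => /eqP.
by rewrite eq_sym -subr_eq0 opprK -natrD pnatr_eq0 addn_eq0.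
Qed.

Definition exc_Iirr j : Iirr G :=
  odflt 0 [pick s | Ind_diff j (conjC_Iirr j) == 'chi_s - 'chi_(conjC_Iirr s)].

Lemma exc_IirrE j : j != 0 ->
  Ind_diff j (conjC_Iirr j) = 'chi_(exc_Iirr j) - 'chi_(conjC_Iirr (exc_Iirr j)).
Proof.
move=> /Ind_diff_conjC_irr[s defj]; rewrite /exc_Iirr; case: pickP => [t /eqP // | /(_ s)].
by rewrite defj eqxx.
Qed.

Lemma exc_Iirr_nreal j : j != 0 -> conjC_Iirr (exc_Iirr j) != exc_Iirr j.
Proof.
move=> nzj; apply/eqP=> eqs; have := Ind_diff_conjC_norm nzj.
by rewrite exc_IirrE // eqs subrr cfdot0l => /eqP; rewrite eq_sym pnatr_eq0.
Qed.

Lemma exc_Iirr_neq0 j : j != 0 -> exc_Iirr j != 0.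
Proof. by move/exc_Iirr_nreal; apply: contraNneq => ->; rewrite conjC_Iirr0. Qed.

Lemma exc_Iirr_inj j k : j != 0 -> k != 0 -> exc_Iirr j = exc_Iirr k -> norm_Ind j = norm_Ind k.
Proof.
move=> nzj nzk eqs; apply/eqP/idPn=> neqjk.
have : '[Ind_diff j (conjC_Iirr j), Ind_diff k (conjC_Iirr k)] = 2%:R.
  by rewrite -(Ind_diff_conjC_norm nzk) !exc_IirrE // eqs.
rewrite Ind_diff_dot !norm_Ind_dot ?conjC_Iirr_eq0 // (negPf neqjk).
have -> : (norm_Ind (conjC_Iirr j) == norm_Ind (conjC_Iirr k)) = false.
  by apply: contraNF neqjk; rewrite !norm_Ind_conjC (inj_eq (can_inj (@cfConjCK _ _))).
rewrite sub0r addr0 -opprD -natrD => /eqP.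
by rewrite eq_sym -subr_eq0 opprK -natrD pnatr_eq0.
Qed.

Definition exc_set : {set Iirr G} := exc_Iirr @: [set j | j != 0].

Lemma exc_setP s : reflect (exists2 j, j != 0 & s = exc_Iirr j) (s \in exc_set).
Proof.
by apply: (iffP imsetP) => -[j]; [rewrite inE | move=> nzj]; exists j; rewrite ?inE.
Qed.

Lemma card_exc_set : (#|P|.-1 <= #|exc_set| * q)%N.
Proof.
rewrite -(card_Iirr_neq0 abP) -sum1_card (partition_big_imset exc_Iirr) /= -sum_nat_const.
apply: leq_sum => s /exc_setP[k nzk ->].
rewrite -(card_norm_Ind_fiber nzk) sum1_card; apply: subset_leq_card.
apply/subsetP=> j /andP[]; rewrite !inE => nzj /eqP eqs.
by rewrite nzj; apply/eqP/exc_Iirr_inj.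
Qed.

Lemma Ind_diff0_dot_conjC j : j != 0 -> '[Ind_diff 0 j, Ind_diff j (conjC_Iirr j)] = -1.
Proof.
move=> nzj; have nzj' : conjC_Iirr j != 0 by rewrite conjC_Iirr_eq0.
rewrite Ind_diff_dot !norm_Ind0_dot // !norm_Ind_dot // eqxx eq_sym (negPf (nreal nzj)).
by rewrite !sub0r oppr0 add0r addr0.
Qed.

Definition exc_real j : 'CF(G) := Ind_diff 0 j + 'chi_(exc_Iirr j) - 1.

Lemma exc_real_vchar j : exc_real j \in 'Z[irr G].
Proof. by rewrite rpredB ?rpred1 ?rpredD ?irr_vchar ?(zcharW (Ind_diff_vchar _ _)). Qed.

Lemma exc_real_dot1 j : j != 0 -> '[exc_real j, 1] = 0.
Proof.
move=> nzj; rewrite cfdotBl cfdotDl Ind_diff0_dot1 // -irr0 !cfdot_irr eqxx.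
by rewrite (negPf (exc_Iirr_neq0 nzj)) addr0 subrr.
Qed.

Lemma exc_real_conjC j : j != 0 -> ((exc_real j)^*)%CF = exc_real j.
Proof.
move=> nzj; rewrite /exc_real rmorphB rmorph1 /=; congr (_ - _).
rewrite rmorphD /= -conjC_IirrE /Ind_diff cfAutInd rmorphB /=.
have := exc_IirrE nzj; rewrite /Ind_diff !raddfB /= -!conjC_IirrE conjC_Iirr0.
move/eqP; rewrite subr_eq => /eqP->; rewrite opprD opprB.
by rewrite -[LHS]addrA -[RHS]addrA; congr (_ + _); rewrite [RHS]addrAC subrK addrC.
Qed.

Lemma exc_Iirr_Res j : j != 0 ->
  '['Res[P] 'chi_(exc_Iirr j), 'chi_j] =
    '['Res[P] 'chi_(exc_Iirr j), 'chi_(conjC_Iirr j)] + 1.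
Proof.
move=> nzj; apply/eqP; rewrite addrC -subr_eq -cfdotBr; apply/eqP.
rewrite cfdotC Frobenius_reciprocity -cfdotC -/(Ind_diff _ _) exc_IirrE //.
by rewrite cfdotBr !cfdot_irr eqxx eq_sym (negPf (exc_Iirr_nreal nzj)) subr0.
Qed.

Lemma exc_Iirr_sum_sqr j : j != 0 ->
  (q * (#|P| - q))%:R <= \sum_(x in P^#%g) `|'chi_(exc_Iirr j) x| ^+ 2.
Proof.
move=> nzj; have nzj' : conjC_Iirr j != 0 by rewrite conjC_Iirr_eq0.
pose A := [set k | (k != 0) && (norm_Ind k == norm_Ind j)].
pose B := [set k | (k != 0) && (norm_Ind k == norm_Ind (conjC_Iirr j))].
have oA : #|A| = q := card_norm_Ind_fiber nzj.
have oB : #|B| = q := card_norm_Ind_fiber nzj'.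
have tiAB : [disjoint A & B].
  apply/pred0P=> k /=; rewrite !inE; apply/negP=> /andP[/andP[_ /eqP->] /andP[_]].
  by rewrite eq_sym (negPf (nreal nzj)).
have [a aE sum_a] := abelian_sum_sqr_vchar abP (cfRes_vchar P (irr_vchar (exc_Iirr j))).
have aAB i k : norm_Ind k = norm_Ind i -> a k = a i.
  by move=> eqik; apply: (@intr_inj algC); rewrite -!aE (irr_Res_norm_Ind _ eqik).
have neqa : a j != a (conjC_Iirr j).
  have := exc_Iirr_Res nzj; rewrite !aE -(rmorphD _ _ 1) => /intr_inj->.
  by rewrite -subr_eq0 addrAC subrr add0r oner_eq0.
have le_q : (q <= #|P|)%N by rewrite -(card_Iirr_abelian abP) -oA max_card.
have -> : \sum_(x in P^#%g) `|'chi_(exc_Iirr j) x| ^+ 2 =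
    \sum_(x in P^#%g) `|'Res[P] 'chi_(exc_Iirr j) x| ^+ 2.
  by apply: eq_bigr => x /setD1P[_ Px]; rewrite cfResE ?(FrobSylow_sub frobP).
rewrite sum_a pmulrn ler_int PoszM -subzn // -{1}(card_Iirr_abelian abP).
apply: variance_two_values oA oB tiAB neqa _ _ => k.
  by rewrite inE => /andP[_ /eqP/aAB].
by rewrite inE => /andP[_ /eqP/aAB].
Qed.

End ExceptionalCharacters.
End InducedDifferences.
End Characters.

(* For the Sylow p-subgroup P of least order, N = #|P|, q is its index in its
   normaliser and M * N = #|G|. O and X are the numbers of elements of prime order
   l != p with [odd_on l] true and false, and E is the number of exceptional
   characters of the latter primes. *)
Lemma odd_order_arith (q w M O X E : nat) (N := w * q + 1) :
    2 < q -> 1 < w -> 2 < M -> (N - q) * M + O <= M * N -> 2 + E <= q + 1 ->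
    M * N <= 1 + (w * M + (O + X)) -> N.+1 * X <= E * (M * N) ->
    (0 < X -> N.+1 <= M) ->
  False.
Proof.
move=> q_gt2 w_gt1 M_gt2 row column cover even_count large.
have le_qN : q <= N by rewrite /N; nia.
have leO : O <= q * M.
  have : M * N = (N - q) * M + q * M by rewrite -mulnDl subnK // mulnC.
  by lia.
have splitN : N = (w - 1) * (q - 1) + w + q by rewrite /N; nia.
have geX : M * (q - 1) <= X + 1.
  have : M * (q - 1) <= M * ((w - 1) * (q - 1)).
    by rewrite leq_mul2l leq_pmull ?orbT // subn_gt0.
  have : M * N = M * ((w - 1) * (q - 1)) + w * M + q * M by rewrite {1}splitN; ring.
  by lia.
have leNM : N.+1 <= M.
  by apply: large; have : 3 * 2 <= M * (q - 1); [apply: leq_mul; lia | lia].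
have leX : N.+1 * X <= (q - 1) * (M * N).
  by apply: leq_trans even_count _; rewrite leq_mul2r; apply/orP; right; lia.
have : N.+1 * (M * (q - 1)) <= N.+1 * (X + 1) by rewrite leq_mul2l geX orbT.
have : N.+1 * (M * (q - 1)) = (q - 1) * (M * N) + M * (q - 1) by rewrite -addn1; ring.
have : M * 2 <= M * (q - 1) by rewrite leq_mul2l; lia.
lia.
Qed.

Section OddOrder.

Import Order.TTheory GroupScope GRing.Theory Num.Theory.
Local Open Scope ring_scope.

Section DistinctPrimes.
Variables (gT : finGroupType) (G : {group gT}) (oddG : odd #|G|).
Variables (p p' : nat) (P P' : {group gT}).
Hypotheses (frobP : FrobSylow G p P) (frobP' : FrobSylow G p' P') (neqp : p != p').
Implicit Types (j : Iirr P) (k : Iirr P').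
Let sP'G : P' \subset G := FrobSylow_sub frobP'.

Lemma cfdot_Ind_neq_prime (phi : 'CF(P)) (psi : 'CF(P')) :
  phi 1%g = 0 -> '['Ind[G] phi, 'Ind[G] psi] = 0.
Proof.
move=> phi1; rewrite -Frobenius_reciprocity cfdotE big1 ?mulr0 // => x Px.
have [-> | ntx] := eqVneq x 1%g; first by rewrite phi1 mul0r.
rewrite cfResE ?(FrobSylow_sub frobP) // cfIndE // big1 ?mulr0 ?conjC0 ?mulr0 // => y _.
apply: cfun0; apply: contra neqp => P'xy; apply/eqP.
rewrite -(FrobSylow_order frobP (x := x)) ?in_setD1 ?ntx // -(orderJ x y).
by apply: (FrobSylow_order frobP'); rewrite in_setD1 conjg_eq1 ntx.
Qed.

Lemma Ind_diff_orthogonal j1 j2 k1 k2 : '[Ind_diff G j1 j2, Ind_diff G k1 k2] = 0.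
Proof.
by rewrite cfdot_Ind_neq_prime // !cfunE !abelian_irr1 ?subrr ?(FrobSylow_abelian frobP).
Qed.

Lemma exc_Iirr_neq j k : j != 0 -> k != 0 -> exc_Iirr G j != exc_Iirr G k.
Proof.
move=> nzj nzk; apply/eqP=> eqs.
have := Ind_diff_orthogonal j (conjC_Iirr j) k (conjC_Iirr k).
rewrite (exc_IirrE frobP' oddG nzk) -eqs -(exc_IirrE frobP oddG nzj).
by rewrite (Ind_diff_conjC_norm frobP oddG nzj) => /eqP; rewrite pnatr_eq0.
Qed.

Lemma conjC_exc_Iirr_neq j k :
  j != 0 -> k != 0 -> conjC_Iirr (exc_Iirr G j) != exc_Iirr G k.
Proof.
move=> nzj nzk; apply/eqP=> eqs.
have := Ind_diff_orthogonal j (conjC_Iirr j) k (conjC_Iirr k).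
rewrite (exc_IirrE frobP' oddG nzk) -eqs conjC_IirrK -opprB -(exc_IirrE frobP oddG nzj).
rewrite cfdotNr (Ind_diff_conjC_norm frobP oddG nzj) => /eqP.
by rewrite oppr_eq0 pnatr_eq0.
Qed.

Lemma exc_Iirr_dot_Ind_diff j k k' :
  j != 0 -> k != 0 -> k' != 0 -> '['chi_(exc_Iirr G j), Ind_diff G k k'] = 0.
Proof.
move=> nzj nzk nzk'; have [eqk | neqk] := eqVneq (norm_Ind G k) (norm_Ind G k').
  by rewrite (Ind_diff_eq0 frobP' eqk) cfdot0r.
have := Ind_diff_orthogonal j (conjC_Iirr j) k k'; rewrite (exc_IirrE frobP oddG nzj).
have [s [t neqst ->]] :=
  vchar_norm2 (Ind_diff_vchar frobP' k k') (Ind_diff_norm frobP' nzk nzk' neqk).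
have neqr := exc_Iirr_nreal frobP oddG nzj; set r := exc_Iirr G j in neqr *.
rewrite !cfdotBl !cfdotBr !cfdot_irr.
have [eqrs | neqrs] := eqVneq r s; have [eqrt | neqrt] := eqVneq r t; rewrite ?subrr //.
  rewrite -eqrs (negPf neqr) subr0 sub0r opprK -natrD => /eqP.
  by rewrite pnatr_eq0.
rewrite -eqrt (negPf neqr) subr0 sub0r -opprD -natrD => /eqP.
by rewrite oppr_eq0 pnatr_eq0.
Qed.

(* The restriction of the character to P' is a multiple of the regular character
   plus a multiple of the principal one. *)
Lemma exc_Iirr_val_Sylow j k x : j != 0 -> k != 0 -> x \in P'^#%g ->
  'chi_(exc_Iirr G j) x = '['chi_(exc_Iirr G j), Ind_diff G 0 k].
Proof.
move=> nzj nzk /setD1P[ntx P'x]; set r := exc_Iirr G j; set c := '[_, _].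
have abP' := FrobSylow_abelian frobP'; pose psi := 'Res[P'] 'chi_r.
have dotE k1 k2 : '[psi, 'chi_k1 - 'chi_k2] = '['chi_r, Ind_diff G k1 k2].
  by rewrite cfdotC Frobenius_reciprocity -cfdotC.
have psiE k1 : '[psi, 'chi_k1] = ('[psi, 'chi_0] - c) + c * (k1 == 0)%:R.
  have [-> | nzk1] := eqVneq k1 0; first by rewrite mulr1 subrK.
  have := exc_Iirr_dot_Ind_diff nzj nzk1 nzk; rewrite -dotE cfdotBr mulr0 addr0 => /eqP.
  by rewrite subr_eq0 /c -dotE cfdotBr => /eqP->; rewrite subKr.
have reg0 : \sum_k1 'chi[P']_k1 x = 0.
  have : cfReg P' x = 0 by rewrite cfRegE (negPf ntx).
  rewrite cfReg_sum sum_cfunE => {2}<-; apply: eq_bigr => k1 _.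
  by rewrite cfunE abelian_irr1 // mul1r.
rewrite -(cfResE _ sP'G P'x) -/psi [psi in LHS]cfun_sum_cfdot sum_cfunE.
rewrite (eq_bigr (fun k1 => ('[psi, 'chi_0] - c) * 'chi_k1 x + c * (k1 == 0)%:R)).
  rewrite big_split /= -!big_distrr /= reg0 mulr0 add0r (bigD1 0) //= big1 ?addr0 ?mulr1 //.
  by move=> k1 /negPf->.
move=> k1 _; rewrite cfunE psiE mulrDl; have [-> | _] := eqVneq k1 0; last by rewrite !mulr0 mul0r.
by rewrite irr0 cfun1E P'x !mulr1.
Qed.

Lemma exc_Iirr_val j k x : j != 0 -> k != 0 -> x \in p_support G p' ->
  'chi_(exc_Iirr G j) x = '['chi_(exc_Iirr G j), Ind_diff G 0 k].
Proof.
move=> nzj nzk; rewrite (p_support_class (FrobSylow_Sylow frobP')) => /imset2P[y g Py Gg ->].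
by rewrite cfunJ // (exc_Iirr_val_Sylow nzj nzk).
Qed.

Lemma exc_Iirr_parity j k : j != 0 -> k != 0 ->
  ('['chi_(exc_Iirr G j), Ind_diff G 0 k] + '['chi_(exc_Iirr G k), Ind_diff G 0 j]
    == 1 %[mod 2])%A.
Proof.
move=> nzj nzk; rewrite /eqAmod.
have := odd_real_vchar_dot oddG (exc_real_vchar frobP j) (exc_real_conjC frobP oddG nzj)
  (exc_real_vchar frobP' k) (exc_real_conjC frobP' oddG nzk) (exc_real_dot1 frobP oddG nzj).
rewrite /exc_real; set r := exc_Iirr G j; set s := exc_Iirr G k.
set D := Ind_diff G 0 j; set D' := Ind_diff G 0 k.
have ZD : D \in 'Z[irr G] := zcharW (Ind_diff_vchar frobP 0 j).
have r0 : '['chi_r, 1] = 0 by rewrite -irr0 cfdot_irr (negPf (exc_Iirr_neq0 frobP oddG nzj)).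
have s0 : '[1, 'chi_s] = 0.
  by rewrite -irr0 cfdot_irr eq_sym (negPf (exc_Iirr_neq0 frobP' oddG nzk)).
have D1 : '[D, 1] = 1 := Ind_diff0_dot1 G nzj.
have D'1 : '[1, D'] = 1 by rewrite cfdotC (Ind_diff0_dot1 G nzk) conjC1.
have DD' : '[D, D'] = 0 := Ind_diff_orthogonal 0 j 0 k.
have Ds : '[D, 'chi_s] = '['chi_s, D].
  by rewrite cfdotC; have /intrP[m ->] := Cint_cfdot_vchar (irr_vchar s) ZD; rewrite rmorph_int.
rewrite cfdotBl cfdotDl !cfdotBr !cfdotDr DD' D1 r0 s0 D'1 Ds cfnorm1 cfdot_irr.
rewrite (negPf (exc_Iirr_neq nzj nzk)) !addr0 !add0r subr0 => even_sum.
by rewrite (_ : _ - 1 = '['chi_s, D] - 1 + '['chi_r, D'] - (1 - 1)) //; ring.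
Qed.
End DistinctPrimes.

Section OddFrobSylowGroup.
Variables (gT : finGroupType) (G : {group gT}).
Hypotheses (frobG : FrobSylow_group G) (oddG : odd #|G|).
Local Notation Syl := (Sylow_repr G).
Local Notation pi := (primes #|G|).

Let frobS l : l \in pi -> FrobSylow G l (Syl l) := FrobSylow_repr frobG (p := l).

Section OneCharacter.
Variables (p : nat) (pip : p \in pi).
Let P := Syl p.
Let frobP : FrobSylow G p P := frobS pip.
Local Notation q := #|'N_G(P) : P|.
Variables (j : Iirr P) (nzj : j != 0).
Local Notation r := (exc_Iirr G j).

Definition odd_on l := [exists x in p_support G l, ~~ (2 %| 'chi_r x)%A].

Lemma Iirr_Sylow_neq0 l : l \in pi -> exists k : Iirr (Syl l), k != 0.
Proof. by move=> pil; exists (inord 1); apply: Iirr1_neq0 (FrobSylow_neq1 (frobS pil)). Qed.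

Lemma odd_on_row :
  (q * (#|P| - q) * #|G : 'N_G(P)| +
     \sum_(l <- pi | (l != p) && odd_on l) #|p_support G l| <= #|G|)%N.
Proof.
have sumG : \sum_(x in G) `|'chi_r x| ^+ 2 = #|G|%:R.
  by rewrite sum_sqr_cfnorm cfnorm_irr mulr1.
rewrite -(ler_nat algC) natrD natr_sum natrM -sumG (big_p_support _ _ (FrobSylow_primary frobG)).
rewrite ler_wpDl ?exprn_ge0 // (bigD1_seq p) ?primes_uniq //=; apply: lerD.
  rewrite (p_support_class (FrobSylow_Sylow frobP)) (sum_class_support (FrobSylow_TI frobP)).
  by rewrite -[leRHS]mulr_natr ler_wpM2r ?ler0n // (exc_Iirr_sum_sqr frobP oddG nzj).
rewrite big_mkcondr /= !(big_seq_cond (fun l => l != p)); apply: ler_sum => l /andP[pil neqlp].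
case: ifP => [/exists_inP[y Gy nev] | _]; last by apply: sumr_ge0 => x _; apply: exprn_ge0.
have [k nzk] := Iirr_Sylow_neq0 pil; have neqpl : p != l by rewrite eq_sym.
rewrite -sum1_card natr_sum; apply: ler_sum => x Gx.
have chiE := exc_Iirr_val oddG frobP (frobS pil) neqpl nzj nzk.
have {x Gx} -> : 'chi_r x = 'chi_r y by rewrite !chiE.
rewrite exprn_ege1 // norm_intr_ge1 //; last by apply: contraNneq nev => ->; rewrite rpred0.
by rewrite chiE // Cint_cfdot_vchar ?irr_vchar ?(zcharW (Ind_diff_vchar (frobS pil) _ _)).
Qed.

Lemma even_on_dot_neq0 l s : l \in pi -> l != p -> ~~ odd_on l -> s \in exc_set G (Syl l) ->
  '[Ind_diff G 0 j, 'chi_s] != 0.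
Proof.
move=> pil neqlp /exists_inPn even_l /exc_setP[k nzk ->]; have neqpl : p != l by rewrite eq_sym.
have frobl := frobS pil; have [x Px ntx] := trivgPn _ (FrobSylow_neq1 frobl).
have Gx : x \in p_support G l.
  by rewrite (subsetP (Sylow_sub_p_support (FrobSylow_Sylow frobl))) // in_setD1 ntx.
apply/eqP=> dot0; have := exc_Iirr_parity oddG frobP frobl neqpl nzj nzk.
rewrite [X in _ + X]cfdotC dot0 conjC0 addr0 -(exc_Iirr_val oddG frobP frobl neqpl nzj nzk Gx).
have := even_l x Gx; rewrite negbK -eqAmod0 eqAmod_sym => /eqAmod_trans even_x.
by move/even_x; rewrite eqAmod_sym (eqAmod0_nat 2 1).
Qed.

Lemma conj_pair_dot_neq0 : exists2 s,
  '[Ind_diff G 0 j, 'chi_s] != 0 & s = r \/ s = conjC_Iirr r.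
Proof.
have [dot0 | nz] := eqVneq '[Ind_diff G 0 j, 'chi_r] 0; last by exists r; [|left].
exists (conjC_Iirr r); last by right.
have := Ind_diff0_dot_conjC frobP oddG nzj; rewrite (exc_IirrE frobP oddG nzj) cfdotBr dot0.
by rewrite sub0r => /oppr_inj->; rewrite oner_eq0.
Qed.

Lemma even_on_column :
  (2 + \sum_(l <- pi | (l != p) && ~~ odd_on l) #|exc_set G (Syl l)| <= q + 1)%N.
Proof.
pose S := [set s | '[Ind_diff G 0 j, 'chi_s] != 0].
have leS : (#|S| <= q + 1)%N.
  rewrite -(ler_nat algC) natrD -(Ind_diff0_norm frobP nzj).
  exact: card_irr_constt_leq_cfnorm (zcharW (Ind_diff_vchar frobP 0 j)).
have [e nze defe] := conj_pair_dot_neq0.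
have e0 : e != 0.
  by case: defe => ->; rewrite ?conjC_Iirr_eq0 (exc_Iirr_neq0 frobP oddG nzj).
have S0 : 0 \in S by rewrite inE irr0 Ind_diff0_dot1 // oner_eq0.
have Se : e \in S :\ 0 by rewrite !inE e0.
apply: leq_trans leS; rewrite (cardsD1 0 S) S0 (cardsD1 e) Se addnA leq_add2l -big_filter.
set even_primes := [seq _ <- _ | _].
have evenP l : l \in even_primes -> [/\ l \in pi, p != l & ~~ odd_on l].
  by rewrite mem_filter eq_sym => /andP[/andP[]].
apply: leq_sum_card_disjoint => [|l even_l|l l' even_l even_l' neql].
- by rewrite filter_uniq ?primes_uniq.
- have [pil neqpl nodd] := evenP l even_l; apply/subsetP=> s exc_s.
  rewrite !inE (even_on_dot_neq0 pil) // 1?eq_sym // andbT.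
  have [k nzk ->] := exc_setP _ _ exc_s.
  rewrite (exc_Iirr_neq0 (frobS pil) oddG nzk) andbT.
  have neqr := exc_Iirr_neq oddG frobP (frobS pil) neqpl nzj nzk.
  have neqCr := conjC_exc_Iirr_neq oddG frobP (frobS pil) neqpl nzj nzk.
  by case: defe => ->.
have [[pil _ _] [pil' _ _]] := (evenP l even_l, evenP l' even_l').
apply/pred0P=> s /=; apply/andP=> -[/exc_setP[k nzk ->] /exc_setP[k' nzk']] /eqP.
exact/negP/(exc_Iirr_neq oddG (frobS pil) (frobS pil') neql).
Qed.

End OneCharacter.

Lemma p_support_leq_exc_set l (S := Syl l) : l \in pi ->
  (#|S| * #|p_support G l| <= #|exc_set G S| * #|G|)%N.
Proof.
move=> pil; have frobl := frobS pil; rewrite (card_p_support frobl) (FrobSylow_card frobl).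
set i := #|G : _|; have -> : (#|exc_set G S| * (i * (#|S| * #|'N_G(S) : S|)) =
  #|exc_set G S| * #|'N_G(S) : S| * (#|S| * i))%N by ring.
by rewrite mulnCA leq_mul // (card_exc_set frobl oddG).
Qed.

Lemma Sylow_leq_index p l : p \in pi -> l \in pi -> p != l ->
  (#|Syl l| <= #|G : 'N_G(Syl p)| * #|'N_G(Syl p) : Syl p|)%N.
Proof.
move=> pip pil neqpl; have [frobp frobl] := (frobS pip, frobS pil).
have index_gt0 : (0 < #|G : 'N_G(Syl p)| * #|'N_G(Syl p) : Syl p|)%N.
  by rewrite muln_gt0 !indexg_gt0.
apply: dvdn_leq index_gt0 _; rewrite -(Gauss_dvdr _ (n := #|Syl p|)).
  by rewrite mulnCA -(FrobSylow_card frobp) cardSg ?(FrobSylow_sub frobl).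
rewrite coprime_sym.
exact: pnat_neq_coprime neqpl (FrobSylow_pgroup frobp) (FrobSylow_pgroup frobl).
Qed.

Lemma Sylow_order_neq p l : p \in pi -> l \in pi -> p != l -> #|Syl p| != #|Syl l|.
Proof.
move=> pip pil neqpl; apply: contraNneq (FrobSylow_neq1 (frobS pip)) => eqpl.
have := pnat_neq_coprime neqpl (FrobSylow_pgroup (frobS pip)) (FrobSylow_pgroup (frobS pil)).
by rewrite -eqpl /coprime gcdnn => /eqP/card1_trivg/eqP.
Qed.

Lemma odd_index_bounds p (P := Syl p) (q := #|'N_G(P) : P|) : p \in pi ->
  [/\ 2 < q, 1 < #|P|.-1 %/ q & #|P| = (#|P|.-1 %/ q * q + 1)%N]%N.
Proof.
move=> pip; have frobP := frobS pip; have oddN : odd #|'N_G(P)|.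
  by apply: oddSg oddG; apply: subsetIl.
have q_gt2 : (2 < q)%N.
  rewrite odd_prime_gt2 ?(FrobSylow_index_prime frobP) //.
  exact: dvdn_odd (dvdn_indexg _ _) oddN.
split=> //; last by rewrite divnK ?(FrobSylow_index_dvd frobP) // addn1 prednK.
have /existsP[Q frobN] := FrobSylow_Frobenius frobP; have [defN _ _ _ _] := Frobenius_context frobN.
have := ltn_odd_Frobenius_ker frobN oddN; rewrite (index_sdprod defN) -/q -mul2n => lt_qP.
by rewrite leq_divRL ?(ltnW (ltnW q_gt2)) // -ltnS prednK.
Qed.

Theorem odd_FrobSylow_group_trivial : G :=: 1%g.
Proof.
apply/eqP/idPn=> ntG.
have ex_pi : exists n, has [pred l | #|Syl l| == n] pi.
  rewrite -cardG_gt1 in ntG; exists #|Syl (pdiv #|G|)|; apply/hasP; exists (pdiv #|G|) => //=.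
  by rewrite mem_primes pdiv_prime ?pdiv_dvd ?cardG_gt0.
have [n /hasP[p pip /eqP oP] minP] := ex_minnP ex_pi; move: oP minP => <- {n} minP.
have frobP := frobS pip; have [j nzj] := Iirr_Sylow_neq0 pip.
have [q_gt2 w_gt1 oP] := odd_index_bounds pip; have oG := FrobSylow_card frobP.
have row := odd_on_row pip nzj; have column := even_on_column pip nzj.
have cover := card_FrobSylow_group frobG; have osupp := card_p_support frobP.
set P := Syl p in oP oG osupp j nzj row column minP w_gt1 q_gt2.
set q := #|'N_G(P) : P| in oP oG row column w_gt1 q_gt2.
set m := #|G : 'N_G(P)| in oG row osupp; set w := (_ %/ q)%N in oP w_gt1.
have {}oG : #|G| = (m * q * #|P|)%N by rewrite oG mulnA mulnAC.
have ltP l : l \in pi -> l != p -> (#|P| < #|Syl l|)%N.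
  move=> pil neqlp; rewrite ltn_neqAle Sylow_order_neq 1?eq_sym //= minP //.
  by apply/hasP; exists l => /=.
rewrite (bigD1_seq p) ?primes_uniq //= (bigID (odd_on j)) /= in cover.
set O := (\sum_(l <- _ | _ && odd_on j l) _)%N in row cover.
set X := (\sum_(l <- _ | _ && ~~ odd_on j l) #|p_support _ _|)%N in cover.
set E := (\sum_(l <- _ | _) _)%N in column.
have even_count : (#|P|.+1 * X <= E * #|G|)%N.
  rewrite big_distrr big_distrl /= big_seq_cond [leqRHS]big_seq_cond.
  apply: leq_sum => l /and3P[pil neqlp _]; apply: leq_trans (p_support_leq_exc_set pil).
  by rewrite leq_mul2r ltP ?orbT.
have large : (0 < X -> #|P|.+1 <= m * q)%N.
  have [/hasP[l pil neqlp] _ | /hasPn only_p] := boolP (has (fun l => l != p) pi).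
    by apply: leq_trans (Sylow_leq_index pip pil _); rewrite ?ltP // eq_sym.
  by rewrite /X big_seq_cond big1 // => l /and3P[/only_p/negPf->].
apply: (@odd_order_arith q w (m * q) O X E) => //; rewrite -?oP -?oG //.
- by rewrite (leq_trans q_gt2) // leq_pmull ?indexg_gt0.
- by rewrite (_ : (_ * (m * q) = q * (#|P| - q) * m)%N) //; ring.
by rewrite {1}cover osupp [in #|P|.-1]oP addn1 /= -mulnA [(q * m)%N]mulnC.
Qed.

End OddFrobSylowGroup.
End OddOrder.

(** * Recognition of A5 *)

Section Alt5.

Import GroupScope.

Lemma card_Alt5 : #|'Alt_('I_5)| = 60.
Proof. by apply: double_inj; rewrite -mul2n card_Alt card_ord. Qed.

Lemma simple_Alt_ord5 : simple 'Alt_('I_5).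
Proof. by apply: simple_Alt5; rewrite card_ord. Qed.

Lemma perfect_sub_Alt (T : finType) (I : {group {perm T}}) :
  I^`(1) = I -> I \subset 'Alt_T.
Proof.
move=> defI'; rewrite -{1}defI' gen_subG; apply/subsetP=> _ /imset2P[s t _ _ ->].
by rewrite Alt_even commgEl odd_permM odd_permV odd_permJ addbb.
Qed.

Lemma perfect_nsolvable (gT : finGroupType) (G : {group gT}) :
  G^`(1) = G -> G :!=: 1 -> ~~ solvable G.
Proof.
move=> defG' ntG; apply/negP=> solG; have := sol_der1_proper solG (subxx G) ntG.
by rewrite defG' properxx.
Qed.

Lemma Alt5_perfect_sub (I : {group {perm 'I_5}}) :
  I^`(1) = I -> I :!=: 1 -> I :=: 'Alt_('I_5).
Proof.
move=> defI' ntI; have sIA := perfect_sub_Alt defI'.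
have nsolI := perfect_nsolvable defI' ntI.
have : #|I| \in divisors 60 by rewrite -dvdn_divisors // -card_Alt5 cardSg.
have [] : #|I| = 60 \/ #|I| != 60 by case: eqP; [left | right].
  by move=> oI _; apply/eqP; rewrite eqEcard sIA oI card_Alt5.
move=> neq60 dvI; have o30 : #|I| = 30.
  have small : all [pred d | (size (primes d) <= 2) || (d \in [:: 30; 60])] (divisors 60) by [].
  have /orP[/Burnside_p_a_q_b solI | ] := allP small _ dvI; first by rewrite solI in nsolI.
  by rewrite !inE (negPf neq60) orbF => /eqP.
have nIA : I <| 'Alt_('I_5).
  rewrite index2_normal //; apply/eqP.
  by rewrite -(eqn_pmul2l (cardG_gt0 I)) Lagrange // card_Alt5 o30.
have /simpleP[_ simA] := simple_Alt_ord5; have [I1 | //] := simA I nIA.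
by rewrite I1 eqxx in ntI.
Qed.

Section CosetAction.
Variables (gT : finGroupType) (G N : {group gT}) (n : nat).
Hypothesis iN : #|G : N| = n.

Let S := rcosets N G.
Let SN : gval N \in S. Proof. by apply/rcosetsP; exists 1; rewrite ?group1 ?mulg1. Qed.
Let coset_of_ord (i : 'I_n) : {set gT} := enum_val (cast_ord (esym iN) i).
Let ord_of_coset (X : {set gT}) : 'I_n := cast_ord iN (enum_rank_in SN X).
Let mem_coset_of_ord i : coset_of_ord i \in S. Proof. exact: enum_valP. Qed.

Let coset_of_ordK : cancel coset_of_ord ord_of_coset.
Proof. by move=> i; rewrite /ord_of_coset /coset_of_ord enum_valK_in cast_ordKV. Qed.

Let ord_of_cosetK : {in S, cancel ord_of_coset coset_of_ord}.
Proof. by move=> X SX; rewrite /ord_of_coset /coset_of_ord cast_ordK enum_rankK_in. Qed.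

Let rcosets_mulr X g : g \in G -> X \in S -> X :* g \in S.
Proof.
move=> Gg /rcosetsP[x Gx ->]; rewrite -rcosetM; apply/rcosetsP.
by exists (x * g); rewrite ?groupM.
Qed.

Let coset_act g i := if g \in G then ord_of_coset (coset_of_ord i :* g) else i.

Let coset_act_inj g : injective (coset_act g).
Proof.
move=> i k; rewrite /coset_act; case: ifP => // Gg /(congr1 coset_of_ord).
rewrite !ord_of_cosetK ?rcosets_mulr // => /rcoset_inj.
exact: can_inj coset_of_ordK _ _.
Qed.

Let coset_perm g : {perm 'I_n} := perm (@coset_act_inj g).

Let coset_permM : {in G &, {morph coset_perm : x y / x * y}}.
Proof.
move=> x y Gx Gy; apply/permP=> i; rewrite permM !permE /coset_act groupM // Gx Gy.
by rewrite ord_of_cosetK ?rcosets_mulr // rcosetM.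
Qed.

Lemma coset_perm_representation : exists f : {morphism G >-> {perm 'I_n}}, 'ker f \subset N.
Proof.
exists (Morphism coset_permM); apply/subsetP=> g ker_g.
have Gg := dom_ker ker_g; move/mker/permP/(_ (ord_of_coset N)): ker_g.
rewrite perm1 permE /coset_act Gg ord_of_cosetK // => /(congr1 coset_of_ord).
by rewrite !ord_of_cosetK ?rcosets_mulr // => <-; apply: rcoset_refl.
Qed.

End CosetAction.

Theorem perfect60_index5_isog_Alt5 (gT : finGroupType) (G N : {group gT}) :
    G^`(1) = G -> #|G| = 60 -> #|G : N| = 5 -> G \isog 'Alt_('I_5).
Proof.
move=> defG' oG iN; have [f sKN] := coset_perm_representation iN.
have im_f : f @* G = 'Alt_('I_5).
  apply: Alt5_perfect_sub; first by rewrite -morphim_der // defG'.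
  apply: contra_eqN iN => /eqP im1.
  have sGK : G \subset 'ker f by rewrite ker_trivg_morphim subxx im1 subxx.
  by rewrite (_ : #|G : N| = 1%N) //; apply/eqP; rewrite indexg_eq1 (subset_trans sGK).
have inj_f : 'injm f by rewrite -card_im_injm im_f oG card_Alt5.
by apply/isogP; exists f.
Qed.

End Alt5.

(** * Perfect central extensions by a group of prime order *)

Section CentralExtension.

Import GroupScope.

Variable p : nat.
Hypothesis p_pr : prime p.

Lemma noncyclic_central_full (gT : finGroupType) (K P R : {group gT}) :
    R \subset 'Z(P) -> #|P : R| = (p ^ 2)%N -> R \subset K -> K \subset P -> ~~ abelian K ->
  K :=: P.
Proof.
move=> sRZ iR sRK sKP nabK; apply/eqP; rewrite eqEsubset sKP -indexg_eq1 /=.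
have sRZK : R \subset 'Z(K).
  by rewrite subsetI sRK (subset_trans sRZ) // subIset // orbC centS.
have ncycKR : ~~ cyclic (K / R) by apply: contra nabK => /(cyclic_factor_abelian sRZK).
have nRK : K \subset 'N(R) by rewrite cents_norm // centsC (subset_trans sRZK) ?subsetIr.
have /(dvdn_pfactor _ _ p_pr)[k le_k2 iK] : #|K : R| %| p ^ 2.
  by rewrite -iR -(Lagrange_index sKP sRK) dvdn_mull.
have oKR : #|K / R| = (p ^ k)%N by rewrite card_quotient.
case: k le_k2 iK oKR => [|[|[|]]] // _ iK oKR.
- by case/negP: ncycKR; rewrite (card1_trivg oKR) cyclic1.
- by case/negP: ncycKR; rewrite prime_cyclic // oKR.
by rewrite -(eqn_pmul2r (indexg_gt0 K R)) Lagrange_index // iR iK mul1n.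
Qed.

(* If a and b in P do not commute, then P = R <a, b> and P' = <[a, b]>. *)
Lemma der1_central_index_p2 (gT : finGroupType) (P R : {group gT}) :
  R \subset 'Z(P) -> #|P : R| = (p ^ 2)%N -> #|P^`(1)| %| p.
Proof.
move=> sRZ iR; have [sRP cRP] := subsetIP sRZ.
have [/derG1P-> | nabP] := boolP (abelian P); first by rewrite cards1 dvd1n.
have [a Pa /subsetPn[b Pb ncab]] : exists2 a, a \in P & ~~ (P \subset 'C[a]).
  by move: nabP => /subsetPn[a Pa nca]; exists a; rewrite // sub_cent1.
pose A := <[a]> <*> <[b]>; have sAP : A \subset P by rewrite join_subG !cycle_subG Pa.
have defP : R \* A = P.
  rewrite cprodE; last by rewrite centsC (subset_trans cRP) ?centS.
  rewrite -norm_joinEr; last by rewrite cents_norm // centsC (subset_trans cRP) ?centS.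
  apply: noncyclic_central_full sRZ iR (joing_subl _ _) _ _; first by rewrite join_subG sRP.
  apply: contra ncab => /centsP abRA; apply/cent1P/abRA; apply: subsetP (joing_subr _ _) _ _.
    by rewrite mem_gen // inE cycle_id orbT.
  by rewrite mem_gen // inE cycle_id.
have nRP : P \subset 'N(R) by rewrite cents_norm // centsC.
have oPR : #|P / R| = (p ^ 2)%N by rewrite card_quotient.
have Rab : [~ a, b] \in R.
  by apply: (subsetP (der1_min nRP (card_p2group_abelian p_pr oPR))); apply: mem_commg.
have Rap : a ^+ p \in R.
  apply: coset_idr; first by rewrite groupX ?(subsetP nRP).
  rewrite morphX ?(subsetP nRP) //=; apply/eqP; rewrite -order_dvdn.
  have /(dvdn_pfactor _ _ p_pr)[k le_k2 oa] : #[coset R a] %| p ^ 2.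
    by rewrite -oPR order_dvdG ?mem_quotient.
  case: k le_k2 oa => [|[|[|]]] // _ oa; rewrite oa ?dvd1n ?expn1 //.
  case/negP: nabP; apply: (cyclic_factor_abelian sRZ); apply/cyclicP; exists (coset R a).
  by apply/eqP; rewrite eq_sym eqEcard cycle_subG mem_quotient //= -orderE oa oPR.
have cR x y : x \in R -> y \in P -> commute x y by move=> Rx Py; apply: (centsP cRP).
have cab : [~ a, b] \in 'C(A) by rewrite (subsetP (centS sAP)) // (subsetP cRP).
have -> : P^`(1) = A^`(1).
  have := der_cprod 1 defP; rewrite (derG1P _) ?cprod1g //.
  exact: subset_trans cRP (centS sRP).
rewrite der1_joing_cycles // -orderE order_dvdn -commXg; first exact/commgP/cR.
exact/commute_sym/cR.
Qed.

Lemma perfect_central_pgroup_card (gT : finGroupType) (H R : {group gT}) :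
    H^`(1) = H -> R \subset 'Z(H) -> p.-group R -> (#|H : R|`_p = p ^ 2)%N ->
  #|R| %| p.
Proof.
move=> defH' sRZ pR iR; have [sRH cRH] := subsetIP sRZ.
have [P sylP sRP] := Sylow_superset sRH pR; have [sPH pP _] := and3P sylP.
have sRZP : R \subset 'Z(P) by rewrite subsetI sRP (subset_trans cRH) ?centS.
have iP : #|P : R| = (p ^ 2)%N.
  apply/eqP; rewrite -(eqn_pmul2l (cardG_gt0 R)) Lagrange // (card_Hall sylP).
  by rewrite -(Lagrange sRH) partnM ?cardG_gt0 // iR part_pnat_id.
apply: dvdn_trans (der1_central_index_p2 sRZP iP); apply: cardSg.
apply/subsetP=> z Rz; have Pz := subsetP sRP z Rz.
apply: (Sylow_der1_transfer sylP (der_normal 1 P) (der_abelian 0 P) Pz).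
  by rewrite defH' (subsetP sRH).
move=> k x Hx _; suff /commgP/eqP-> : commute (z ^+ k) x by apply: group1.
by apply/commute_sym/commuteX/commute_sym/(centsP cRH).
Qed.

Section FibreProduct.
Variables (gT rT aT : finGroupType) (H : {group gT}) (L : {group rT}).
Variables (phi : {morphism H >-> aT}) (psi : {morphism L >-> aT}).
Hypothesis eq_im : phi @* H = psi @* L.
Hypotheses (defH' : H^`(1) = H) (defL' : L^`(1) = L).
Hypotheses (cphi : 'ker phi \subset 'Z(H)) (cpsi : 'ker psi \subset 'Z(L)).
Hypotheses (ophi : #|'ker phi| = p) (opsi : #|'ker psi| = p).
Hypothesis im_p2 : (#|phi @* H|`_p = p ^ 2)%N.

Definition fibre_product := [set u : gT * rT | [&& u.1 \in H, u.2 \in L & phi u.1 == psi u.2]].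

Lemma mem_fibre_product x y :
  ((x, y) \in fibre_product) = [&& x \in H, y \in L & phi x == psi y].
Proof. by rewrite inE. Qed.

Lemma fibre_product_group_set : group_set fibre_product.
Proof.
apply/group_setP; split=> [|[x y] [x' y']]; rewrite !mem_fibre_product.
  by rewrite !group1 !morph1 eqxx.
case/and3P=> Hx Ly /eqP exy /and3P[Hx' Ly' /eqP exy'].
by rewrite !groupM //= !morphM // exy exy' eqxx.
Qed.
Canonical fibre_product_group := Group fibre_product_group_set.
Local Notation D := fibre_product_group.

Lemma fibre_product_fst : fst @* D = H.
Proof.
apply/setP=> x; apply/morphimP/idP=> [[[x' y] _] | Hx].
  by rewrite mem_fibre_product => /and3P[Hx' _ _] ->.
have /morphimP[y _ Ly exy] : phi x \in psi @* L by rewrite -eq_im mem_morphim.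
by exists (x, y); rewrite ?inE //= Hx Ly exy eqxx.
Qed.

Lemma fibre_product_snd : snd @* D = L.
Proof.
apply/setP=> y; apply/morphimP/idP=> [[[x y'] _] | Ly].
  by rewrite mem_fibre_product => /and3P[_ Ly' _] ->.
have /morphimP[x _ Hx exy] : psi y \in phi @* H by rewrite eq_im mem_morphim.
by exists (x, y); rewrite ?inE //= Hx Ly exy eqxx.
Qed.

Lemma card_fibre_product : #|D| = (p * #|L|)%N.
Proof.
have kerD : 'ker_D snd = setX ('ker phi) 1.
  apply/setP=> -[x y]; rewrite in_setX in_setI mem_fibre_product.
  apply/idP/idP=> [/andP[/and3P[Hx Ly /eqP exy]] | /andP[kx /set1P->]].
    by move/mker=> /= y1; rewrite y1 morph1 in exy *; rewrite set11 andbT; apply/kerP.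
  rewrite (dom_ker kx) group1 (mker kx) morph1 eqxx /=; exact/kerP.
rewrite -(LagrangeI D ('ker snd)) -fibre_product_snd card_morphim setTI; congr (_ * _)%N.
by rewrite -[RHS]muln1 -ophi -(cards1 (1 : rT)) -cardsX -kerD.
Qed.

Lemma fibre_product_ker_central : setX ('ker phi) ('ker psi) \subset 'Z(D).
Proof.
apply/subsetP=> -[x y]; rewrite in_setX => /andP[kx ky].
have /centerP[Hx cx] := subsetP cphi x kx; have /centerP[Ly cy] := subsetP cpsi y ky.
apply/centerP; split; first by rewrite mem_fibre_product Hx Ly (mker kx) (mker ky) eqxx.
case=> x' y'; rewrite mem_fibre_product => /and3P[Hx' Ly' _].
by congr (_, _); [apply: cx | apply: cy].
Qed.

Lemma fibre_product_ker_index : #|D : setX ('ker phi) ('ker psi)| = #|phi @* H|.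
Proof.
apply/eqP; rewrite -(eqn_pmul2l (cardG_gt0 (setX ('ker phi) ('ker psi)))) Lagrange /=.
  rewrite card_fibre_product cardsX ophi opsi eq_im card_morphim setIid.
  rewrite -mulnA eqn_pmul2l ?prime_gt0 //.
  by rewrite -{1}opsi Lagrange ?normal_sub ?ker_normal.
exact: subset_trans fibre_product_ker_central (center_sub _).
Qed.

Lemma fibre_product_nperfect : D^`(1) \proper D.
Proof.
rewrite properEneq der_sub andbT; apply/eqP=> defD'.
have oK : #|setX ('ker phi) ('ker psi)| = (p ^ 2)%N by rewrite cardsX ophi opsi.
have := @perfect_central_pgroup_card _ D [group of setX ('ker phi) ('ker psi)] defD'
  fibre_product_ker_central.
rewrite /pgroup /= oK fibre_product_ker_index im_p2 pnatX pnat_id // => /(_ isT erefl).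
by rewrite gtnNdvd ?prime_gt0 // -{1}(expn1 p) ltn_exp2l ?prime_gt1.
Qed.

Lemma card_fibre_product_factor : #|L| = #|H|.
Proof.
have oH : #|H| = (p * #|phi @* H|)%N.
  by rewrite card_morphim setIid -ophi Lagrange ?(normal_sub (ker_normal _)).
have oL : #|L| = (p * #|psi @* L|)%N.
  by rewrite card_morphim setIid -opsi Lagrange ?(normal_sub (ker_normal _)).
by rewrite oH oL eq_im.
Qed.

Lemma card_fibre_product_der1 : #|D^`(1)| = #|H|.
Proof.
have imE : fst @* D^`(1) = H by rewrite morphim_der ?subsetT // fibre_product_fst.
have /dvdnP[k oE] : #|H| %| #|D^`(1)| by rewrite -imE dvdn_morphim.
have oD : #|D| = (p * #|H|)%N by rewrite card_fibre_product card_fibre_product_factor.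
have dvk : k %| p by rewrite -(dvdn_pmul2r (cardG_gt0 H)) -oE -oD cardSg ?der_sub.
case/primeP: p_pr => _ /(_ k dvk)/orP[/eqP k1 | /eqP kp]; first by rewrite oE k1 mul1n.
by have := proper_card fibre_product_nperfect; rewrite oE kp -oD ltnn.
Qed.

Lemma fibre_product_isog : H \isog L.
Proof.
pose E := D^`(1)%G.
have iso_im (rT' : finGroupType) (f : {morphism setT >-> rT'}) : #|f @* E| = #|E| -> E \isog f @* E.
  move=> oE; have injf : 'injm (restrm (subsetT E) f).
    by rewrite -card_im_injm morphim_restrm setIid oE.
  apply/isogP; exists [morphism of restrm (subsetT E) f] => //.
  by rewrite morphim_restrm setIid.
have im1 : fst @* E = H by rewrite morphim_der ?subsetT // fibre_product_fst.
have im2 : snd @* E = L by rewrite morphim_der ?subsetT // fibre_product_snd.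
have iso1 : E \isog H by rewrite -im1 iso_im // im1 card_fibre_product_der1.
have iso2 : E \isog L.
  by rewrite -im2 iso_im // im2 card_fibre_product_der1 card_fibre_product_factor.
by rewrite isog_sym in iso1; apply: isog_trans iso2.
Qed.

End FibreProduct.

Theorem perfect_central_ext_isog (gT rT : finGroupType) (H R : {group gT}) (L Z : {group rT}) :
    H^`(1) = H -> L^`(1) = L -> R \subset 'Z(H) -> Z \subset 'Z(L) ->
    #|R| = p -> #|Z| = p -> (#|H : R|`_p = p ^ 2)%N -> H / R \isog L / Z ->
  H \isog L.
Proof.
move=> defH' defL' sRZ sZZ oR oZ iR /isogP[f inj_f im_f].
have [nRH nZL] := (sub_center_normal sRZ, sub_center_normal sZZ).
have sH : H \subset coset R @*^-1 (H / R) by rewrite -sub_morphim_pre ?normal_norm.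
pose phi := restrm_morphism sH (comp_morphism (coset_morphism R) f).
pose psi := restrm_morphism (normal_norm nZL) (coset_morphism Z).
have im_phi : phi @* H = L / Z by rewrite morphim_restrm setIid morphim_comp -im_f.
have im_psi : psi @* L = L / Z by rewrite morphim_restrm setIid.
have ker_phi : 'ker phi = R.
  rewrite ker_restrm ker_comp (trivgP inj_f).
  have -> : coset R @*^-1 1 = R by rewrite -kerE ker_coset.
  exact/setIidPr/normal_sub.
have ker_psi : 'ker psi = Z by rewrite ker_restrm ker_coset; apply/setIidPr/normal_sub.
apply: (@fibre_product_isog _ _ _ H L phi psi); rewrite ?ker_phi ?ker_psi // im_phi ?im_psi //.
by rewrite -im_f card_injm // card_quotient ?normal_norm.
Qed.

End CentralExtension.

(** * Special linear groups of degree 2 *)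

Definition mx2 (R : Type) (a b c d : R) : 'M[R]_2 :=
  \matrix_(i, j) if i == ord0 then if j == ord0 then a else b else if j == ord0 then c else d.
Arguments mx2 {R} (a b c d)%_R.

HB.lock Definition gl2 (F : finFieldType) (a b c d : F) : {'GL_2[F]} :=
  insubd (1%g : {'GL_2[F]}) (mx2 a b c d).
Arguments gl2 {F} (a b c d)%_R.

Section SL2.

Import GroupScope GRing.Theory.

Lemma eq_mx2 (R : Type) (A B : 'M[R]_2) :
    A ord0 ord0 = B ord0 ord0 -> A ord0 ord_max = B ord0 ord_max ->
    A ord_max ord0 = B ord_max ord0 -> A ord_max ord_max = B ord_max ord_max ->
  A = B.
Proof.
have ord2P (i : 'I_2) : i = ord0 \/ i = ord_max.
  by case: i => [[|[|//]] lti]; [left | right]; apply: val_inj.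
by move=> e00 e01 e10 e11; apply/matrixP=> i j; case: (ord2P i) (ord2P j) => -> [] ->.
Qed.

Lemma mx2E (R : Type) (A : 'M[R]_2) :
  A = mx2 (A ord0 ord0) (A ord0 ord_max) (A ord_max ord0) (A ord_max ord_max).
Proof. by apply: eq_mx2; rewrite mxE. Qed.

Lemma mulmx2 (R : pzRingType) (a b c d a' b' c' d' : R) :
  (mx2 a b c d *m mx2 a' b' c' d' =
   mx2 (a * a' + b * c') (a * b' + b * d') (c * a' + d * c') (c * b' + d * d'))%R.
Proof. by apply: eq_mx2; rewrite !mxE !big_ord_recl big_ord0 !mxE addr0. Qed.

Lemma scalar_mx2 (R : pzRingType) (a : R) : (a%:M = mx2 a 0 0 a)%R.
Proof. by apply: eq_mx2; rewrite !mxE. Qed.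

Lemma det_mx2 (R : comPzRingType) (a b c d : R) : (\det (mx2 a b c d) = a * d - b * c)%R.
Proof.
rewrite (expand_det_row _ ord0) !big_ord_recl big_ord0 addr0 /cofactor !det_mx11 !mxE /=.
by rewrite expr0 mul1r expr1 mulN1r mulrN.
Qed.

Variable F : finFieldType.
Local Notation GL2 := {'GL_2[F]}.
Implicit Types a b c d t u : F.
Let GLval_inj : injective (@GLval 2 F) := val_inj.

Lemma val_gl2 a b c d : (a * d - b * c != 0)%R -> GLval (gl2 a b c d) = mx2 a b c d.
Proof.
move=> det_neq0; rewrite unlock -[GLval _]/(val (insubd _ _)) insubdK //.
by rewrite unfold_in /= unitmxE det_mx2 unitfE.
Qed.

Lemma val_gl2_det1 a b c d : (a * d - b * c = 1)%R -> GLval (gl2 a b c d) = mx2 a b c d.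
Proof. by move=> det1; rewrite val_gl2 // det1 oner_neq0. Qed.

Definition SL2 : {set GL2} := [set M : GL2 | (\det (GLval M) == 1)%R].

Lemma SL2_group_set : group_set SL2.
Proof.
apply/group_setP; split=> [|M N]; first by rewrite inE GL_1E det1.
by rewrite !inE => /eqP dM /eqP dN; rewrite GL_MxE det_mulmx dM dN mulr1.
Qed.
Canonical SL2_group := Group SL2_group_set.

Lemma card_SL2 : #|SL2| = (#|F| * #|F|.-1 * #|F|.+1)%N.
Proof.
have unit_det (M : GL2) : (\det (GLval M))%R \is a GRing.unit by rewrite -unitmxE; apply: GL_unit.
pose det_unit (M : GL2) := FinRing.unit F (unit_det M).
have det_unitM : {in [set: GL2] &, {morph det_unit : M N / M * N}}.
  by move=> M N _ _; apply: val_inj; rewrite /= -det_mulmx.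
pose f := Morphism det_unitM.
have ker_f : 'ker f = SL2.
  by apply/setP=> M; rewrite !inE -val_eqE.
have im_f : f @* [set: GL2] = [set: {unit F}].
  apply/eqP; rewrite eqEsubset subsetT; apply/subsetP=> u _; apply/imsetP.
  have u_neq0 : val u != 0%R by rewrite -unitfE; apply: valP.
  have detD : (val u * 1 - 0 * 0 = val u)%R by rewrite mulr1 mulr0 subr0.
  by exists (gl2 (val u) 0 0 1); rewrite ?inE //; apply: val_inj; rewrite /= val_gl2 ?det_mx2 detD.
have F1_gt0 : (0 < #|F|.-1)%N by rewrite -subn1 subn_gt0 finNzRing_gt1.
have oU : #|[set: {unit F}]| = #|F|.-1 by rewrite card_finField_unit.
apply/eqP; rewrite -(eqn_pmul2l F1_gt0) -{1}oU -im_f card_morphim setTI mulnC -{1}ker_f.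
rewrite Lagrange ?subsetT // card_GL_2; apply/eqP; lia.
Qed.

Lemma mem_SL2 a b c d : (a * d - b * c = 1)%R -> gl2 a b c d \in SL2.
Proof. by move=> det1; rewrite inE val_gl2_det1 // det_mx2 det1. Qed.

Variant SL2_spec : GL2 -> Type :=
  SL2_mx a b c d of (a * d - b * c = 1)%R : SL2_spec (gl2 a b c d).

Lemma SL2P M : M \in SL2 -> SL2_spec M.
Proof.
rewrite inE [GLval M]mx2E det_mx2 => /eqP detM.
suff -> : M = gl2 (GLval M ord0 ord0) (GLval M ord0 ord_max)
                  (GLval M ord_max ord0) (GLval M ord_max ord_max) by [].
by apply: GLval_inj; rewrite val_gl2_det1 // -mx2E.
Qed.

Lemma gl2M a b c d (a' b' c' d' : F) :
    (a * d - b * c = 1)%R -> (a' * d' - b' * c' = 1)%R ->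
  gl2 a b c d * gl2 a' b' c' d' =
    gl2 (a * a' + b * c')%R (a * b' + b * d')%R (c * a' + d * c')%R (c * b' + d * d')%R.
Proof.
move=> det1 det1'; apply: GLval_inj; rewrite GL_MxE !val_gl2_det1 ?mulmx2 //.
by transitivity ((a * d - b * c) * (a' * d' - b' * c'))%R; [ring | rewrite det1 det1' mulr1].
Qed.

Lemma gl2_1 : gl2 1 0 0 1 = 1 :> GL2.
Proof. by apply: GLval_inj; rewrite val_gl2_det1 ?mulr0 ?mulr1 ?subr0 // -scalar_mx2. Qed.

Lemma gl2_inj a b c d (a' b' c' d' : F) :
    (a * d - b * c = 1)%R -> (a' * d' - b' * c' = 1)%R ->
  gl2 a b c d = gl2 a' b' c' d' -> [/\ a = a', b = b', c = c' & d = d'].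
Proof.
move=> det1 det1' /(congr1 (fun M : GL2 => GLval M)); rewrite !val_gl2_det1 // => /matrixP eqM.
by split; [have := eqM ord0 ord0 | have := eqM ord0 ord_max
          | have := eqM ord_max ord0 | have := eqM ord_max ord_max]; rewrite !mxE.
Qed.

Lemma SL2_gen_transvections (K : {group GL2}) :
    (forall t, gl2 1 t 0 1 \in K) -> (forall t, gl2 1 0 t 1 \in K) -> SL2 \subset K.
Proof.
move=> KU KL; apply/subsetP=> _ /SL2P[a b c d detM].
have lower_entry_neq0 a1 b1 c1 d1 : (a1 * d1 - b1 * c1 = 1)%R -> c1 != 0%R -> gl2 a1 b1 c1 d1 \in K.
  move=> det1 c1_neq0.
  suff -> : gl2 a1 b1 c1 d1 = gl2 1 ((a1 - 1) / c1) 0 1 * gl2 1 0 c1 1 * gl2 1 ((d1 - 1) / c1) 0 1.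
    by rewrite (groupMr _ (KU _)) (groupMr _ (KL _)).
  have b1E : b1 = ((a1 * d1 - 1) / c1)%R by rewrite -det1; field.
  by rewrite !gl2M ?b1E; try congr gl2; field.
have [c0 | ] := eqVneq c 0%R; last exact: lower_entry_neq0.
rewrite -(groupMr _ (KL 1%R)) gl2M //; last by ring.
apply: lower_entry_neq0; first by rewrite -[RHS]detM; ring.
rewrite c0 mul0r add0r mulr1; apply: contra_eq_neq detM => ->.
by rewrite c0 !mulr0 subr0 eq_sym oner_neq0.
Qed.

Lemma SL2_perfect (u : F) : u != 0%R -> (u ^+ 2)%R != 1%R -> SL2^`(1) = SL2.
Proof.
move=> u_neq0 u2_neq1; have u2B1_neq0 : (u ^+ 2 - 1 != 0)%R by rewrite subr_eq0.
have detD : (u * u^-1 - 0 * 0 = 1)%R by field.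
have commutator_SL2 x y z : x \in SL2 -> y \in SL2 -> x * y = y * x * z -> z \in SL2^`(1).
  by move=> SLx SLy /eqP; rewrite commgC eq_sym (inj_eq (mulgI _)) => /eqP->; apply: mem_commg.
apply/eqP; rewrite eqEsubset der_sub; apply: SL2_gen_transvections => t.
  apply: (commutator_SL2 (gl2 u 0 0 u^-1) (gl2 1 (t * u ^+ 2 / (u ^+ 2 - 1)) 0 1)%R);
    rewrite ?mem_SL2 //; try by ring.
  by rewrite !gl2M //; try congr gl2; field; rewrite ?u_neq0 ?u2B1_neq0.
apply: (commutator_SL2 (gl2 u 0 0 u^-1) (gl2 1 0 (- t / (u ^+ 2 - 1)) 1)%R);
  rewrite ?mem_SL2 //; try by ring.
by rewrite !gl2M //; try congr gl2; field; rewrite ?u_neq0 ?u2B1_neq0.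
Qed.

Lemma gl2N1_central : gl2 (-1) 0 0 (-1) \in 'Z(SL2).
Proof.
apply/centerP; split; first by rewrite mem_SL2 //; ring.
by move=> _ /SL2P[a b c d detM]; rewrite /commute !gl2M //; try congr gl2; ring.
Qed.

Lemma gl2N1_expg2 : gl2 (-1) 0 0 (-1) ^+ 2 = 1 :> GL2.
Proof. by rewrite expgS expg1 gl2M -?gl2_1; try congr gl2; ring. Qed.

Lemma order_gl2N1 : (2%:R != 0 :> F)%R -> #[gl2 (-1) 0 0 (-1) : GL2] = 2.
Proof.
move=> two_neq0; apply: nt_prime_order gl2N1_expg2 _ => //; rewrite -gl2_1.
apply: contraNneq two_neq0 => /gl2_inj[||N1_1 _ _ _]; try by ring.
by rewrite -[2%:R%R]/(1 + 1)%R -{1}N1_1 addNr.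
Qed.

End SL2.

Section QuaternionGenerators.

Import GroupScope.

Variables (gT : finGroupType) (i j z : gT).
Hypotheses (oz : #[z] = 2) (i2 : i ^+ 2 = z) (j2 : j ^+ 2 = z) (ij : i ^ j = i^-1).

Lemma card_quaternion_generators : #|<[i]> <*> <[j]>| = 8.
Proof.
have order4 x : x ^+ 2 = z -> #[x] = 4.
  by move=> x2; apply: (@orderXpnat _ 2 2); rewrite ?x2.
have [oi oj] := (order4 i i2, order4 j j2); set Q := <[i]> <*> <[j]>.
have nij : <[j]> \subset 'N(<[i]>) by rewrite cycle_subG; apply/normP; rewrite -cycleJ ij cycleV.
have cardQ : (#|Q| * #|<[i]> :&: <[j]>| = 4 * 4)%N.
  by rewrite /Q norm_joinEr // -mul_cardG -!orderE oi oj.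
have gt_I1 : 1 < #|<[i]> :&: <[j]>|.
  rewrite cardG_gt1; apply/trivgPn; exists z; last by rewrite -order_gt1 oz.
  by rewrite inE -{1}i2 -j2 !mem_cycle.
have gt_Q4 : 4 < #|Q|.
  rewrite ltnNge; apply: contraNN (isT : ~~ (4 %| 2)) => leQ4.
  have defQ : <[i]> = Q by apply/eqP; rewrite eqEcard joing_subl -orderE oi.
  have cij : commute i j.
    by apply: (centsP (cycle_abelian i)); rewrite ?cycle_id // defQ mem_gen // inE cycle_id orbT.
  by rewrite -oi order_dvdn expgS expg1 -eq_invg_mul -ij; apply/eqP/conjg_fixP/commgP.
have /dvdnP[k oQ] : 4 %| #|Q| by rewrite -oi orderE cardSg ?joing_subl.
by move: cardQ gt_I1 gt_Q4; rewrite oQ; case: k oQ => [|[|[|[|k]]]] _; lia.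
Qed.

Lemma quaternion_generators_norm_card (G : {group gT}) (w : gT) :
    i \in G -> j \in G -> w \in G -> #[w] = 3 -> i ^ w = j -> j ^ w = j * i ->
  24 %| #|'N_G(<[i]> <*> <[j]>)|.
Proof.
move=> Gi Gj Gw ow iw jw; set Q := <[i]> <*> <[j]>.
have Nw : w \in 'N_G(Q).
  rewrite inE Gw inE -genJ gen_subG conjUg -!cycleJ iw jw subUset !cycle_subG.
  by rewrite groupM mem_gen // inE cycle_id ?orbT.
have sQN : Q \subset 'N_G(Q) by rewrite subsetI join_subG !cycle_subG Gi Gj normG.
by rewrite (@Gauss_dvd 8 3) // -{1}card_quaternion_generators cardSg // -ow order_dvdG.
Qed.

End QuaternionGenerators.

Section SL25.

Import GroupScope.

Canonical SL25_group := Group (SL2_group_set 'F_5 : group_set SL25).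

Lemma card_SL25 : #|SL25| = 120.
Proof. by rewrite -[SL25]/(SL2 'F_5) card_SL2 card_Fp. Qed.

Lemma SL25_perfect : SL25^`(1) = SL25.
Proof. exact: (@SL2_perfect 'F_5 2%:R%R). Qed.

Definition SL25_center : {set {'GL_2['F_5]}} := <[gl2 (-1) 0 0 (-1) : {'GL_2['F_5]}]>.
Canonical SL25_center_group := [group of SL25_center].

Lemma SL25_center_central : SL25_center \subset 'Z(SL25).
Proof. by rewrite cycle_subG gl2N1_central. Qed.

Lemma card_SL25_center : #|SL25_center| = 2.
Proof. exact: (@order_gl2N1 'F_5). Qed.

(* Q is the quaternion group, and w permutes its three cyclic subgroups of order 4. *)
Section Quaternion.
Local Notation GL25 := {'GL_2['F_5]}.
Let i : GL25 := gl2 (2%:R) 0 0 (3%:R).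
Let j : GL25 := gl2 0 1 (-1) 0.
Let w : GL25 := gl2 1 (3%:R) (-1) (3%:R).
Let Q := <[i]> <*> <[j]>.

Let gl2M_eq a b c d a' b' c' d' a'' b'' c'' d'' :
    (a * d - b * c = 1)%R -> (a' * d' - b' * c' = 1)%R ->
    [/\ a * a' + b * c' = a'', a * b' + b * d' = b'',
        c * a' + d * c' = c'' & c * b' + d * d' = d'']%R ->
  gl2 a b c d * gl2 a' b' c' d' = gl2 a'' b'' c'' d'' :> GL25.
Proof. by move=> det1 det1' [<- <- <- <-]; apply: gl2M. Qed.

Let SLi : i \in SL25. Proof. by apply: mem_SL2; apply: val_inj. Qed.
Let SLj : j \in SL25. Proof. by apply: mem_SL2; apply: val_inj. Qed.
Let SLw : w \in SL25. Proof. by apply: mem_SL2; apply: val_inj. Qed.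

Let i2 : i ^+ 2 = gl2 (-1) 0 0 (-1).
Proof. by apply: gl2M_eq; [| | split]; apply: val_inj. Qed.

Let j2 : j ^+ 2 = gl2 (-1) 0 0 (-1).
Proof. by apply: gl2M_eq; [| | split]; apply: val_inj. Qed.

Let ow : #[w] = 3.
Proof.
apply: nt_prime_order => //; last first.
  by apply/eqP; rewrite -gl2_1 => /gl2_inj[|| _ /eqP //]; try apply: val_inj.
transitivity (w * gl2 (3%:R) (2%:R) 1 1); last first.
  by rewrite -gl2_1; apply: gl2M_eq; [| | split]; apply: val_inj.
by congr (_ * _); apply: gl2M_eq; [| | split]; apply: val_inj.
Qed.

Let ij : i ^ j = i^-1.
Proof.
apply: (mulgI j); rewrite -(conjgC i j); apply: (mulIg i); rewrite mulgKV.
transitivity (gl2 0 (2%:R) (2%:R) 0 * i); last by apply: gl2M_eq; [| | split]; apply: val_inj.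
by congr (_ * _); apply: gl2M_eq; [| | split]; apply: val_inj.
Qed.

Let iw : i ^ w = j.
Proof.
apply: (mulgI w); rewrite -(conjgC i w).
by transitivity (gl2 (2%:R) 1 (2%:R) (4%:R) : GL25); [| symmetry];
  (apply: gl2M_eq; [| | split]; apply: val_inj).
Qed.

Let jw : j ^ w = j * i.
Proof.
apply: (mulgI w); rewrite -(conjgC j w).
transitivity (w * gl2 0 (3%:R) (3%:R) 0); last first.
  by congr (_ * _); symmetry; apply: gl2M_eq; [| | split]; apply: val_inj.
by transitivity (gl2 (4%:R) (3%:R) (4%:R) (2%:R) : GL25); [| symmetry];
  (apply: gl2M_eq; [| | split]; apply: val_inj).
Qed.

Lemma SL25_sub_index5 :
  exists N : {group GL25}, [/\ SL25_center \subset N, N \subset SL25 & #|SL25 : N| = 5].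
Proof.
exists 'N_SL25(Q)%G; have sQSL : Q \subset SL25 by rewrite join_subG !cycle_subG SLi.
have sQN : Q \subset 'N_SL25(Q) by rewrite subsetI sQSL normG.
have sNSL : 'N_SL25(Q) \subset SL25 by apply: subsetIl.
split=> //.
  by rewrite cycle_subG -i2 groupX // (subsetP sQN) // mem_gen // inE cycle_id.
have oz : #[gl2 (-1) 0 0 (-1) : GL25] = 2 by apply: order_gl2N1.
have dv24 : 24 %| #|'N_SL25(Q)|.
  exact: (quaternion_generators_norm_card oz i2 j2 ij SLi SLj SLw ow iw jw).
have dvi : #|SL25 : 'N_SL25(Q)| %| 5.
  have /dvdnP[k oN] := dv24; have := Lagrange sNSL; rewrite [RHS]card_SL25 oN => oSL.
  by apply/dvdnP; exists k; apply/eqP; rewrite -(eqn_pmul2r (isT : 0 < 24)) mulnAC oSL.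
have /orP[ /eqP i1 | /eqP //] := proj2 (primeP (isT : prime 5)) _ dvi.
have nQ : Q <| SL25.
  by move/eqP: i1; rewrite indexg_eq1 /normal sQSL => /subset_trans->; rewrite ?subsetIr.
have ntSL : SL25 != 1 by rewrite -cardG_gt1 card_SL25.
case/negP: (perfect_nsolvable SL25_perfect ntSL).
have oQ : #|Q| = 8 := card_quaternion_generators oz i2 j2 ij.
have solQ : solvable Q by apply: (@pgroup_sol _ 2); rewrite /pgroup oQ.
have iQ : #|SL25 / Q| = 15 by rewrite card_quotient ?normal_norm // -divgS // card_SL25 oQ.
by rewrite (series_sol nQ) solQ Burnside_p_a_q_b // iQ.
Qed.

End Quaternion.

Theorem SL25_quotient_isog_Alt5 : SL25 / SL25_center \isog 'Alt_('I_5).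
Proof.
have [N [sZN sNSL iN]] := SL25_sub_index5.
have nZ : SL25_center <| SL25 := sub_center_normal SL25_center_central.
apply: (@perfect60_index5_isog_Alt5 _ _ (N / SL25_center)%G).
- by rewrite -quotient_der ?normal_norm // SL25_perfect.
- rewrite card_quotient ?normal_norm // -divgS ?normal_sub //.
  by rewrite card_SL25 card_SL25_center.
by rewrite index_quotient_eq ?normal_norm ?iN // (setIidPr (normal_sub nZ)).
Qed.

End SL25.

(** * Minimal insoluble finite groups *)

Section FiniteClassification.

Import GroupScope.

Lemma cyclic_normal_perfect_central (gT : finGroupType) (H R : {group gT}) :
  H^`(1) = H -> R <| H -> cyclic R -> R \subset 'Z(H).
Proof.
move=> defH' /andP[sRH nRH] cycR; rewrite subsetI sRH centsC -{1}defH'.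
rewrite -ker_conj_aut ker_trivg_morphim (subset_trans (der_sub 1 H)) //=.
rewrite morphim_der // (derG1P _) //.
exact: abelianS (Aut_conj_aut _ _) (Aut_cyclic_abelian cycR).
Qed.

Section MinimalInsoluble.

Variables (gT : finGroupType) (H : {group gT}).
Hypothesis nsolH : ~~ solvable H.
Hypothesis solH : forall K : {group gT}, K \proper H -> solvable K.
Hypothesis hamH : forall K : {group gT}, K \subset H -> K <| H \/ proper_nil K.

Lemma min_insoluble_perfect : H^`(1) = H.
Proof.
apply/eqP; rewrite eqEproper der_sub; apply/negP=> /solH solH'.
case/negP: nsolH; rewrite (series_sol (der_normal 1 H)) solH' /=.
exact: abelian_sol (der_abelian 0 H).
Qed.

Section Radical.

Variable R : {group gT}.
Hypothesis maxR : maxnormal R H H.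
Local Notation S := (H / R).

Let nRH : R <| H := maxnormal_normal maxR.
Let simS : simple S. Proof. by rewrite quotient_simple. Qed.

Let nsolS : ~~ solvable S.
Proof.
have solR : solvable R by apply: solH; apply: maxnormal_proper maxR.
by apply: contra nsolH; rewrite (series_sol nRH) solR.
Qed.

Lemma quotient_normal_trivial_or_full (K : {group gT}) : K <| H -> K / R = 1 \/ K / R = S.
Proof. by move/(quotient_normal R); case/simpleP: simS => _ simS'; apply: simS'. Qed.

Lemma nontrivial_quotient_proper_nil (K : {group gT}) :
  K \subset H -> K / R != 1 -> K / R != S -> proper_nil K.
Proof.
move=> sKH nt nfull; case: (hamH sKH) => // /quotient_normal_trivial_or_full.
by case=> eqK; [rewrite eqK eqxx in nt | rewrite eqK eqxx in nfull].
Qed.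

Lemma proper_quotient_proper_nil (K : {group coset_of R}) : K \proper S -> proper_nil K.
Proof.
move=> ltKS; have [K1 defK sRK1 sK1H] := inv_quotientS nRH (proper_sub ltKS).
have [K_1 | ntK] := eqVneq K 1%G.
  by move=> L; rewrite K_1 properE => /andP[_ /negP[]]; apply: sub1G.
rewrite defK; apply: proper_nil_quo; last exact: normalS sRK1 sK1H nRH.
by apply: nontrivial_quotient_proper_nil; rewrite // -defK ?(proper_neq ltKS).
Qed.

Lemma quotient_FrobSylow_group : FrobSylow_group S.
Proof. by move=> p P; apply: simple_FrobSylow simS nsolS proper_quotient_proper_nil p P. Qed.

Let frobS := quotient_FrobSylow_group.

Lemma quotient_even : 2 %| #|S|.
Proof.
rewrite dvdn2; apply/negP=> /(odd_FrobSylow_group_trivial frobS).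
by case/simpleP: simS => /eqP.
Qed.

Lemma quotient_card_norm_index :
  [/\ #|S| = 60, #|S : 'N_S(Sylow_repr S 2)| = 5,
      Sylow_norm_index S 3 = 2 & Sylow_norm_index S 5 = 2].
Proof. exact: even_FrobSylow_group frobS simS quotient_even. Qed.

Lemma card_quotient60 : #|S| = 60. Proof. by case: quotient_card_norm_index. Qed.

Lemma quotient_perfect : S^`(1) = S.
Proof. exact: simple_perfect simS nsolS. Qed.

Lemma quotient_isog_Alt5 : S \isog 'Alt_('I_5).
Proof.
have [oS iN _ _] := quotient_card_norm_index.
exact: perfect60_index5_isog_Alt5 quotient_perfect oS iN.
Qed.

Lemma FrobSylow_norm_preim p (P : {group coset_of R}) : FrobSylow S p P ->
  exists K : {group gT}, [/\ R <| K, K / R = 'N_S(P)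
    & exists p' q' (P' Q' : {group gT}), Schmidt p' q' K P' Q'].
Proof.
move=> frobP; have ltNS := FrobSylow_norm_proper frobP simS.
have nnilN := FrobSylow_norm_nnil frobP.
have [K defK sRK sKH] := inv_quotientS nRH (proper_sub ltNS).
exists K; split=> //; first exact: normalS sRK sKH nRH.
apply: Schmidt_exists; last by apply: contra nnilN => nilK; rewrite defK quotient_nil.
apply: nontrivial_quotient_proper_nil; rewrite // -defK ?(proper_neq ltNS) //.
by apply: contraNneq nnilN => ->; apply: nilpotent1.
Qed.

Lemma radical_pi p (P : {group coset_of R}) r :
    FrobSylow S p P -> prime r -> r %| #|R| ->
  (r == p) || (r == #|'N_S(P) : P|).
Proof.
move=> frobP r_pr rR; set q := #|_ : _|.
have [K [nRK defK [p' [q' [P' [Q' schK]]]]]] := FrobSylow_norm_preim frobP.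
have q_pr : prime q := FrobSylow_index_prime frobP.
have dvK s : s %| #|'N_S(P)| -> s %| #|K|.
  by rewrite -defK => /dvdn_trans; apply; apply: dvdn_quotient.
have pK : p %| #|K|.
  apply: dvK; rewrite (FrobSylow_card_norm frobP) dvdn_mulr //.
  by have [_ ->] := pgroup_pdiv (FrobSylow_pgroup frobP) (FrobSylow_neq1 frobP).
have qK : q %| #|K| by apply: dvK; rewrite (FrobSylow_card_norm frobP) dvdn_mull.
have rK : r %| #|K| by apply: dvdn_trans rR (cardSg (normal_sub nRK)).
have neqpq : p != q := FrobSylow_prime_neq_index frobP.
move: (Schmidt_pi schK (FrobSylow_prime frobP) pK) (Schmidt_pi schK q_pr qK) neqpq.
by move: (Schmidt_pi schK r_pr rK); do 3!case/orP=> /eqP->; rewrite ?eqxx ?orbT.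
Qed.

Lemma FrobSylow_3 : FrobSylow S 3 (Sylow_repr S 3).
Proof. by apply: FrobSylow_repr frobS _ _; rewrite card_quotient60. Qed.

Lemma FrobSylow_5 : FrobSylow S 5 (Sylow_repr S 5).
Proof. by apply: FrobSylow_repr frobS _ _; rewrite card_quotient60. Qed.

Lemma radical_2group : 2.-group R.
Proof.
have [_ _ i3 i5] := quotient_card_norm_index.
apply/pgroupP=> r r_pr rR; have := radical_pi FrobSylow_5 r_pr rR.
have := radical_pi FrobSylow_3 r_pr rR.
by rewrite [#|_ : _|]i3 [#|_ : _|]i5 inE => /orP[] // /eqP->.
Qed.

Lemma radical_cyclic : cyclic R.
Proof.
have [_ _ i3 _] := quotient_card_norm_index; have frob3 := FrobSylow_3.
have [K [nRK defK [p [q [P [Q schK]]]]]] := FrobSylow_norm_preim frob3.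
have [U sylU] := Sylow_exists 2 K; have [sUK _ _] := and3P sylU.
have sRU : R \subset U.
  exact: subset_trans (pcore_max radical_2group nRK) (pcore_sub_Hall sylU).
have nnU : ~~ (U <| K).
  have sylUR : 2.-Sylow('N_S(Sylow_repr S 3)) (U / R).
    by rewrite -defK quotient_pHall // (subset_trans sUK) ?normal_norm.
  apply: contra (FrobSylow_Sylow_index_nnormal frob3 (U := U / R) _) => [nUK|].
    by rewrite -defK quotient_normal.
  by rewrite [#|_ : _|]i3.
have [_ cycU] := Schmidt_nnormal_Sylow schK (isT : prime 2) sylU nnU.
exact: cyclicS sRU cycU.
Qed.

Lemma radical_central : R \subset 'Z(H).
Proof. exact: cyclic_normal_perfect_central min_insoluble_perfect nRH radical_cyclic. Qed.

Lemma radical_index_partn2 : (#|H : R|`_2 = 2 ^ 2)%N.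
Proof. by rewrite -card_quotient ?normal_norm // card_quotient60 p_part. Qed.

Lemma isog_Alt5_or_SL25 : H \isog 'Alt_('I_5) \/ H \isog SL25.
Proof.
have isoS := quotient_isog_Alt5; have sRZ := radical_central.
have defH' := min_insoluble_perfect.
have dvR : #|R| %| 2.
  exact: perfect_central_pgroup_card defH' sRZ radical_2group radical_index_partn2.
have /orP[/eqP oR | /eqP oR] := proj2 (primeP (isT : prime 2)) _ dvR; [left | right].
  by apply: isog_trans isoS; rewrite (card1_trivg oR) quotient1_isog.
apply: (perfect_central_ext_isog (isT : prime 2) (L := SL25_group) (Z := SL25_center_group)
          defH' SL25_perfect sRZ SL25_center_central oR card_SL25_center radical_index_partn2).
by apply: isog_trans isoS _; rewrite isog_sym SL25_quotient_isog_Alt5.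
Qed.

Lemma Sylow2_norm_nnil_nnormal (P : {group gT}) :
  2.-Sylow(H) P -> ~~ nilpotent 'N_H(P) /\ ~~ ('N_H(P) <| H).
Proof.
move=> sylP; have [sPH _ _] := and3P sylP; have pr2 : prime 2 by [].
have sRP : R \subset P.
  exact: subset_trans (pcore_max radical_2group nRH) (pcore_sub_Hall sylP).
have sylPS : 2.-Sylow(S) (P / R).
  by rewrite quotient_pHall // (subset_trans sPH) ?normal_norm.
have frobP := frobS pr2 sylPS (Sylow_neq1 pr2 quotient_even sylPS).
have defN : 'N_H(P) / R = 'N_S(P / R) by apply: quotient_subnormG; apply: normalS sRP sPH nRH.
have nnilN : ~~ nilpotent ('N_H(P) / R) by rewrite defN (FrobSylow_norm_nnil frobP).
split; first by apply: contra nnilN; apply: quotient_nil.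
apply/negP=> /quotient_normal_trivial_or_full[] eqN.
  by rewrite eqN nilpotent1 in nnilN.
by have := FrobSylow_norm_proper frobP simS; rewrite -defN eqN properxx.
Qed.

End Radical.

Theorem min_insoluble_classification :
  (H \isog 'Alt_('I_5) \/ H \isog SL25) /\
  forall P : {group gT}, 2.-Sylow(H) P -> ~~ nilpotent 'N_H(P) /\ ~~ ('N_H(P) <| H).
Proof.
have ntH : H :!=: 1 by apply: contraNneq nsolH => ->; apply: solvable1.
have [R maxR] := ex_maxnormal_ntrivg ntH.
by split; [apply: isog_Alt5_or_SL25 maxR | apply: Sylow2_norm_nnil_nnormal maxR].
Qed.

End MinimalInsoluble.

End FiniteClassification.

(** * Finite subgroups of abstract groups *)

Section AbstractGroups.

Import GroupScope.

Section GrpTheory.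
Variable G : Grp.
Implicit Types (x y z g h : G) (A B H K : G -> Prop).

Lemma gmulI x y z : gmul x y = gmul x z -> y = z.
Proof. by move/(congr1 (gmul (ginv x))); rewrite !gmulA !gmulV !gmul1. Qed.

Lemma gmulg1 x : gmul x (gone G) = x.
Proof. by apply: (@gmulI (ginv x)); rewrite gmulA !gmulV gmul1. Qed.

Lemma gmulgV x : gmul x (ginv x) = gone G.
Proof. by apply: (@gmulI (ginv x)); rewrite gmulA gmulV gmul1 gmulg1. Qed.

Lemma ginvK x : ginv (ginv x) = x.
Proof. by apply: (@gmulI (ginv x)); rewrite gmulgV gmulV. Qed.

Lemma ginvM x y : ginv (gmul x y) = gmul (ginv y) (ginv x).
Proof.
apply: (@gmulI (gmul x y)); rewrite gmulgV gmulA -(gmulA x) gmulgV gmulg1.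
by rewrite gmulgV.
Qed.

Definition gconj x g : G := gmul (gmul (ginv g) x) g.

Lemma gconjg1 x : gconj x (gone G) = x.
Proof. by rewrite /gconj gmulg1 -[ginv _]gmulg1 gmulV gmul1. Qed.

Lemma gconjgM x g h : gconj x (gmul g h) = gconj (gconj x g) h.
Proof. by rewrite /gconj ginvM !gmulA. Qed.

Lemma gconjMg x y g : gconj (gmul x y) g = gmul (gconj x g) (gconj y g).
Proof. by rewrite /gconj !gmulA -(gmulA _ g) gmulgV gmulg1. Qed.

Lemma gconjgK x g : gconj (gconj x g) (ginv g) = x.
Proof. by rewrite -gconjgM gmulgV gconjg1. Qed.

Lemma gconj_inj g x y : gconj x g = gconj y g -> x = y.
Proof. by move/(congr1 (gconj^~ (ginv g))); rewrite !gconjgK. Qed.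

Definition gnorm A : G -> Prop := fun g => forall x, A x <-> A (gconj x g).

Lemma gnorm_group A : is_subgroup (gnorm A).
Proof.
split; first by move=> x; rewrite gconjg1.
split=> [g h ng nh x | g ng x]; first by rewrite gconjgM -nh.
by rewrite (ng (gconj x _)) -{2}[g]ginvK gconjgK.
Qed.

Lemma commSub_mono A A' B B' :
  gsubset A A' -> gsubset B B' -> gsubset (commSub A B) (commSub A' B').
Proof.
move=> sA sB z zAB K gK sK; apply: zAB => // _ [x [y [Ax [By ->]]]].
by apply: sK; exists x, y; split; [apply: sA | split; [apply: sB |]].
Qed.

Lemma lcs_mono H K n : gsubset H K -> gsubset (lcs H n) (lcs K n).
Proof. by move=> sHK; elim: n => //= n IHn; apply: commSub_mono. Qed.

Lemma dser_mono H K n : gsubset H K -> gsubset (dser H n) (dser K n).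
Proof. by move=> sHK; elim: n => //= n IHn; apply: commSub_mono. Qed.

Lemma nilpotent_subS H K : gsubset K H -> nilpotent_sub H -> nilpotent_sub K.
Proof. by move=> sKH [n tr]; exists n => x /(lcs_mono sKH)/tr. Qed.

Lemma soluble_subS H K : gsubset K H -> soluble_sub H -> soluble_sub K.
Proof. by move=> sKH [n tr]; exists n => x /(dser_mono sKH)/tr. Qed.

End GrpTheory.

Lemma InP (T : eqType) (x : T) (s : seq T) : reflect (List.In x s) (x \in s).
Proof.
elim: s => [|y s IHs] /=; first exact: ReflectF.
by rewrite inE eq_sym; apply: (iffP orP) => -[/eqP|/IHs]; by [left | right].
Qed.

Definition img (G : Grp) (gT : finGroupType) (f : gT -> G) (A : {set gT}) : G -> Prop :=
  fun g => exists2 x, x \in A & g = f x.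

Lemma finite_subgroup_model (G : Grp) (H : G -> Prop) : is_subgroup H -> finite_sub H ->
  exists (gT : finGroupType) (f : gT -> G),
    [/\ injective f, {morph f : x y / x * y >-> gmul x y}
      & forall x, H x <-> img f [set: gT] x].
Proof.
move=> [H1 [HM HV]] [s Hs].
pose r : seq {classic G} := [seq x : {classic G} <- s | `[< H x >]].
have inr x : x \in r <-> H x.
  rewrite mem_filter; split=> [/andP[/asboolP] // | Hx].
  by apply/andP; split; [apply/asboolP | apply/InP/Hs].
have Hval (x : seq_sub r) : H (ssval x) by apply/inr/(ssvalP x).
pose mul x y := SeqSub (proj2 (inr _) (HM _ _ (Hval x) (Hval y))).
pose one := SeqSub (proj2 (inr _) H1).
pose inv x := SeqSub (proj2 (inr _) (HV _ (Hval x))).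
have mulA : associative mul by move=> x y z; apply: val_inj; apply: gmulA.
have mul1 : left_id one mul by move=> x; apply: val_inj; apply: gmul1.
have mulV : left_inverse one inv mul by move=> x; apply: val_inj; apply: gmulV.
pose gT : finGroupType := HB.pack (seq_sub r) (Finite_isGroup.Build (seq_sub r) mulA mul1 mulV).
exists gT, (fun x : gT => ssval (x : seq_sub r)); split=> [|//|x]; first exact: val_inj.
split=> [/inr rx | [y _ ->]]; last exact: Hval.
by exists (SeqSub rx); rewrite ?inE.
Qed.

Section Image.
Variables (G : Grp) (gT : finGroupType) (f : gT -> G).
Hypotheses (inj_f : injective f) (fM : {morph f : x y / x * y >-> gmul x y}).
Local Notation img := (img f).
Implicit Types (A B : {set gT}) (H K L P : {group gT}) (S : G -> Prop).

Lemma mem_img A x : img A (f x) <-> x \in A.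
Proof. by split=> [[y Ky /inj_f->] | Kx] //; exists x. Qed.

Lemma img_sub A B : gsubset (img A) (img B) <-> A \subset B.
Proof.
split=> [sAB | sAB _ [x Ax ->]]; last by apply/mem_img/(subsetP sAB).
by apply/subsetP=> x /mem_img/sAB/mem_img.
Qed.

Lemma img1 : f 1 = gone G.
Proof. by apply: (@gmulI _ (f 1)); rewrite -fM mulg1 gmulg1. Qed.

Lemma imgV x : f x^-1 = ginv (f x).
Proof. by apply: (@gmulI _ (f x)); rewrite -fM mulgV gmulgV img1. Qed.

Lemma imgJ x y : f (x ^ y) = gconj (f x) (f y).
Proof. by rewrite conjgE !fM imgV /gconj !gmulA. Qed.

Lemma imgR x y : f [~ x, y] = gcomm (f x) (f y).
Proof. by rewrite commgEl conjgE !fM !imgV /gcomm !gmulA. Qed.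

Lemma img_group K : is_subgroup (img K).
Proof.
split; first by exists 1; rewrite ?img1.
split=> [_ _ [x Kx ->] [y Ky ->] | _ [x Kx ->]].
  by rewrite -fM; apply/mem_img; rewrite groupM.
by rewrite -imgV; apply/mem_img; rewrite groupV.
Qed.

Lemma preim_group S : is_subgroup S -> exists K, forall x, x \in K <-> S (f x).
Proof.
move=> [S1 [SM _]]; pose A := [set x | `[< S (f x) >]].
have inA x : x \in A <-> S (f x) by rewrite inE; split=> /asboolP.
have gA : group_set A.
  apply/group_setP; split=> [|x y /inA Sx /inA Sy]; apply/inA; first by rewrite img1.
  by rewrite fM; apply: SM.
by exists (Group gA).
Qed.

Lemma img_commg A B g : commSub (img A) (img B) g <-> img [~: A, B] g.
Proof.
split=> [| [x ABx ->] S gS sS].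
  apply; first exact: img_group.
  move=> _ [_ [_ [[x Ax ->] [[y By ->] ->]]]].
  by rewrite -imgR; apply/mem_img/mem_commg.
have [K inK] := preim_group gS; apply/inK; move: x ABx; apply/subsetP.
rewrite gen_subG; apply/subsetP=> _ /imset2P[x y Ax By ->]; apply/inK.
by rewrite imgR; apply: sS; exists (f x), (f y); split; [|split=> //]; apply/mem_img.
Qed.

Lemma img_lcs K n g : lcs (img K) n g <-> img 'L_n.+1(K) g.
Proof.
elim: n g => [|n IHn] g /=; first by rewrite lcn1.
rewrite lcnSn -img_commg.
by split; apply: commSub_mono => // h; apply IHn.
Qed.

Lemma img_dser K n g : dser (img K) n g <-> img K^`(n) g.
Proof.
elim: n g => [|n IHn] g //=; rewrite dergSn -img_commg.
by split; apply: commSub_mono => // h; apply IHn.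
Qed.

Lemma img_trivial K : is_trivial (img K) <-> K :=: 1.
Proof.
split=> [tr | -> _ [x /set1gP-> ->]]; last exact: img1.
apply/trivgP/subsetP=> x /mem_img/tr fx1; apply/set1gP/inj_f.
by rewrite fx1 img1.
Qed.

Lemma img_nilpotent K : nilpotent_sub (img K) <-> nilpotent K.
Proof.
split=> [[n tr] | /lcnP[n L1]].
  by apply/lcnP; exists n; apply/img_trivial=> g /img_lcs; apply: tr.
by exists n => g /img_lcs; rewrite L1 => /(proj2 (img_trivial 1%G) erefl).
Qed.

Lemma img_solvable K : soluble_sub (img K) <-> solvable K.
Proof.
split=> [[n tr] | /derivedP[n d1]].
  by apply/derivedP; exists n; apply/img_trivial=> g /img_dser; apply: tr.
by exists n => g /img_dser; rewrite d1 => /(proj2 (img_trivial 1%G) erefl).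
Qed.

Lemma img_min_non_nilpotent K : min_non_nilpotent_sub (img K) -> proper_nil K.
Proof.
move=> [_ [_ minK]] L /andP[sLK /subsetPn[x Kx nLx]]; apply/img_nilpotent/minK.
split; first exact: img_group.
split; first exact/img_sub.
by exists (f x); split=> [|/mem_img]; [apply/mem_img | rewrite (negPf nLx)].
Qed.

Lemma img_normal K H : K \subset H -> Defs.normal_sub (img K) -> K <| H.
Proof.
move=> sKH nK; apply/andP; split=> //; apply/subsetP=> x Hx.
rewrite inE; apply/subsetP=> _ /imsetP[y Ky ->]; apply/mem_img.
by rewrite imgJ; apply/nK/mem_img.
Qed.

Lemma gnorm_img A x : gnorm (img A) (f x) <-> x \in 'N(A).
Proof.
split=> [nAx | nAx g].
  rewrite inE; apply/subsetP=> _ /imsetP[y Ay ->]; apply/mem_img.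
  by rewrite imgJ -nAx; apply/mem_img.
split=> [[y Ay ->] | [y Ay eq_y]].
  by rewrite -imgJ; apply/mem_img; rewrite memJ_norm.
exists (y ^ x^-1); first by rewrite memJ_norm ?groupV.
by rewrite imgJ imgV -eq_y gconjgK.
Qed.

Lemma img_isog (rT : finGroupType) H (K : {group rT}) :
  (forall g, img H g) -> H \isog K -> isomorphic_to G K.
Proof.
move=> fullH /isogP[phi inj_phi im_phi].
have /choice[r fK] (g : G) : exists x, x \in H /\ f x = g.
  by have [x Hx ->] := fullH g; exists x.
have Hr g : r g \in H by case: (fK g).
have fr g : f (r g) = g by case: (fK g).
exists (phi \o r); split=> [x y /= |].
  by rewrite -morphM //; congr (phi _); apply: inj_f; rewrite fM !fr.
split=> [x y /= /(injmP inj_phi) eq_r | ].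
  by rewrite -(fr x) -(fr y) eq_r.
split=> [x | y]; rewrite -im_phi; first exact: mem_morphim.
by case/morphimP=> x _ Hx ->; exists (f x) => /=; congr (phi _); apply: inj_f.
Qed.

Lemma img_finite H : (forall g, img H g) -> group_finite G.
Proof.
move=> fullH; exists [seq f x : {classic G} | x <- enum H] => g _; have [x Hx ->] := fullH g.
by apply/(@InP {classic G})/map_f; rewrite mem_enum.
Qed.

Lemma gconj_img_morphism H g : Defs.normal_sub (img H) ->
  exists2 phi : {morphism H >-> gT},
    'injm phi /\ phi @* H \subset H & {in H, forall x, f (phi x) = gconj (f x) g}.
Proof.
move=> nH.
have [phi phiE] : exists phi, forall x, x \in H -> f (phi x) = gconj (f x) g.
  apply: (@fin_all_exists _ (fun=> gT) (fun x y => x \in H -> f y = gconj (f x) g)).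
  move=> x; case: (boolP (x \in H)) => [Hx | _]; last by exists 1.
  by have [y _ eq_y] := nH g _ (proj2 (mem_img H x) Hx); exists y.
have phiM : {in H &, {morph phi : x y / x * y}}.
  move=> x y Hx Hy; apply: inj_f.
  by rewrite fM !phiE ?groupM // fM gconjMg.
exists (Morphism phiM) => //; split.
  apply/injmP=> x y Hx Hy /(congr1 f); rewrite !phiE // => /gconj_inj; exact: inj_f.
apply/subsetP=> _ /morphimP[x _ Hx ->]; apply/mem_img.
by rewrite [f _]phiE //; apply/nH/mem_img.
Qed.

Lemma gFrattini_arg p H P g : Defs.normal_sub (img H) -> p.-Sylow(H) P ->
  exists2 h, h \in H & gnorm (img P) (gmul g (f h)).
Proof.
move=> nH sylP; have sPH := pHall_sub sylP.
have [phi [inj_phi im_phi] phiE] := gconj_img_morphism g nH.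
have sylQ : p.-Sylow(H) (phi @* P).
  rewrite pHallE (subset_trans (morphimS _ sPH) im_phi) card_injm //.
  by rewrite (card_Hall sylP) eqxx.
have [h Hh defP] := Sylow_trans sylQ sylP.
have conjE y : y \in P -> gconj (f y) (gmul g (f h)) = f (phi y ^ h).
  by move=> Py; rewrite gconjgM imgJ phiE // (subsetP sPH).
exists h => // x; split=> [[y Py ->] | [z Pz eq_z]].
  by rewrite conjE //; apply/mem_img; rewrite defP memJ_conjg mem_morphim // (subsetP sPH).
move: Pz; rewrite {1}defP => /imsetP[_ /morphimP[y Hy Py ->] def_z].
by exists y => //; apply: (@gconj_inj _ (gmul g (f h))); rewrite eq_z def_z conjE.
Qed.

Section ParaNilHamiltonian.

Hypothesis paraG : forall S, is_subgroup S -> ~ Defs.normal_sub S ->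
  nilpotent_sub S \/ min_non_nilpotent_sub S.

Lemma para_normal_or_proper_nil H K : K \subset H -> K <| H \/ proper_nil K.
Proof.
move=> sKH; have [nK | nK] := EM (Defs.normal_sub (img K)).
  by left; apply: img_normal.
right; case: (paraG (img_group K) nK) => [nilK L sLK|]; last exact: img_min_non_nilpotent.
by apply/img_nilpotent; apply: nilpotent_subS nilK; apply/img_sub/proper_sub.
Qed.

Lemma para_nonnil_proper_normal K S : is_subgroup S -> ~~ nilpotent K ->
  proper_subgroup (img K) S -> Defs.normal_sub S.
Proof.
move=> gS nnilK pKS; apply: contrapT => nS; case/negP: nnilK.
apply/img_nilpotent; case: (paraG gS nS) => [|[_ [_]]]; last exact.
by apply: nilpotent_subS; case: pKS => _ [].
Qed.

Lemma para_insoluble_normal K : ~~ solvable K -> Defs.normal_sub (img K).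
Proof.
move=> nsolK; apply: contrapT => nK; case/negP: nsolK.
case: (paraG (img_group K) nK) => [/img_nilpotent/nilpotent_sol // |].
by move/img_min_non_nilpotent/proper_nil_sol.
Qed.

Lemma para_img_full p H P : ~~ solvable H -> p.-Sylow(H) P ->
  ~~ nilpotent 'N_H(P) -> ~~ ('N_H(P) <| H) -> forall g, img H g.
Proof.
move=> nsolH sylP nnilN nnormN g; apply: contrapT => nHg; case/negP: nnormN.
have nH := para_insoluble_normal nsolH.
have [h Hh nPgh] := gFrattini_arg g nH sylP.
have normN : Defs.normal_sub (gnorm (img P)).
  apply: (para_nonnil_proper_normal (K := 'N_H(P)%G) (gnorm_group _) nnilN).
  split; first exact: img_group.
  split=> [_ [x /setIP[_ nPx] ->] |]; first exact/gnorm_img.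
  exists (gmul g (f h)); split=> // -[x /setIP[Hx _] eq_x]; apply: nHg.
  exists (x * h^-1); first by rewrite groupM ?groupV.
  by rewrite fM -eq_x imgV -gmulA gmulgV gmulg1.
apply: img_normal => [|y _ [x /setIP[Hx nPx] ->]]; first exact: subsetIl.
have [z Hz eq_z] := nH y _ (proj2 (mem_img H x) Hx); rewrite eq_z.
apply/mem_img/setIP; split=> //; apply/gnorm_img; rewrite -eq_z.
exact/normN/gnorm_img.
Qed.

End ParaNilHamiltonian.

End Image.

End AbstractGroups.

Theorem mainTheorem11 (G : Grp) :
  para_Nil_Hamiltonian G ->
  (exists H : G -> Prop,
     is_subgroup H /\ finite_sub H /\ ~ soluble_sub H) ->
  group_finite G /\ (isomorphic_to G A5 \/ isomorphic_to G SL25).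
Proof.
move=> [_ paraG] [S [gS [finS nsolS]]].
have [gT [f [inj_f fM defS]]] := finite_subgroup_model gS finS.
have [|H minH _] := @mingroup_exists gT (fun K => ~~ solvable K) [set: gT].
  apply/negP=> /(img_solvable inj_f fM) solT; apply: nsolS.
  by apply: soluble_subS solT => x /defS.
have [nsolH solH] : ~~ solvable H /\ forall K : {group gT}, K \proper H -> solvable K.
  case/mingroupP: minH => nsolH minH; split=> // K /andP[sKH]; apply: contraR => nsolK.
  by rewrite (minH K nsolK sKH).
have hamH := @para_normal_or_proper_nil _ _ _ inj_f fM paraG H.
have [isoH normP] := min_insoluble_classification nsolH solH hamH.
have [P sylP] := Sylow_exists 2 H; have [nnilN nnormN] := normP P sylP.
have fullH := para_img_full inj_f fM paraG nsolH sylP nnilN nnormN.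
split; first exact: img_finite fullH.
by case: isoH => /(img_isog inj_f fM fullH); [left | right].
Qed.
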